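(* Let $d\in(0,\frac12)$, $p\in[1,2)$, let $L^d$ be a fractional L\'evy process of bounded $p$-variation, let $(I,\mu,\sigma)$ be a strongly proper triple with state space transform $f$ and friction coefficient $\lambda>0$, and let $\mathcal L^{d,\lambda}_t=\int_{-\infty}^te^{-\lambda(t-s)}\,dL^d_s$, $t\in\mathbb R$, be the corresponding fractional L\'evy--Ornstein--Uhlenbeck process. Set $X_t=f(\mathcal L^{d,\lambda}_t)$ for $t\in\mathbb R$. Then: (i) $X$ is a stationary pathwise solution of the SDE $dX_t=\mu(X_t)\,dt+\sigma(X_t)\,dL^d_t$, $t\in\mathbb R$. (ii) If $\sigma$ has no zeros in $I$, then $X$ is the unique stationary pathwise solution of this SDE (up to almost sure equality of sample paths).
   Context: All random objects live on a complete probability space $(\Omega,\mathcal F,P)$. Fractional L\'evy process. A two-sided L\'evy process is $L_t=L^1_t1_{\{t\ge0\}}+L^2_{-t-}1_{\{t<0\}}$, $t\in\mathbb R$, where $L^1,L^2$ are two independent copies of the same L\'evy process. Let $L$ be a zero-mean two-sided L\'evy process with $E[L(1)^2]<\infty$ and without Brownian component, $d\in(0,\frac12)$. The fractional L\'evy process (FLP) is $L^d_t:=\frac{1}{\Gamma(d+1)}\int_{-\infty}^\infty[(t-s)_+^d-(-s)_+^d]\,L(ds)$ ($L^2(\Omega)$-integral), always taken in its continuous modification $L^d_t=\frac{1}{\Gamma(d)}\int_{\mathbb R}[(t-s)_+^{d-1}-(-s)_+^{d-1}]L(s)\,ds$ (improper Riemann integral). $p$-variation. For $g:[a,b]\to\mathbb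 R$, $v_p(g,[a,b]):=\sup\sum_i|g(x_i)-g(x_{i-1})|^p$, the supremum over all subdivisions of $[a,b]$. $L^d$ is of bounded $p$-variation if almost surely its paths have finite $p$-variation on all compact intervals. $\mathfrak W^{\mathrm{con}}_p(\mathbb R)$ is the set of continuous $g:\mathbb R\to\mathbb R$ with $v_p(g,[s,t])<\infty$ for all compact $[s,t]\subset\mathbb R$. Integrals with respect to $L^d$ are pathwise Riemann--Stieltjes integrals (improper in the definition of $\mathcal L^{d,\lambda}$). Strongly proper triples. $(I,\mu,\sigma)$ is strongly proper if: (P1) $I=(a,b)\subseteq\mathbb R$ is an open interval, $-\infty\le a<b\le\infty$, and $\mu,\sigma:I\to\mathbb R$ are continuous; (P2) there is a strictly decreasing function $\psi$ on $I$, absolutely continuous with respect to Lebesgue measure, with $\psi=\mu/\sigma$ on $I\setminus Z(\sigma)$, where $Z(\sigma)$ is the zero set of $\sigma$, and $\lim_{x\nearrow b}\psi(x)=-\infty$, $\lim_{x\searrow a}\psi(x)=+\infty$; (P3) there is $\lambda>0$ with $\sigma\psi'=-\lambda$ Lebesgue-a.e. on $I$; (P4) the inverse $\psi^{-1}:\mathbb R\to I$ is differentiable and $(\psi^{-1})'$ is Lipschitz continuous on compacts. The (unique) $\lambda$ is the friction coefficient, and $f:\mathbb R\to I$, $f(x):=\psi^{-1}(-\lambda x)$, is the state space transform. Pathwise solutions. A stochastic process $X=(X_t)_{t\in\mathbb R}$ is a pathwise solution of $dX_t=\mu(X_t)\,dt+\sigma(X_t)\,dL^d_t$, $t\in\mathbb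 R$, if for almost all $\omega$: $X\in\mathfrak W^{\mathrm{con}}_p(\mathbb R)$, the image of $X$ is contained in $I$, and for all $s\le t$, $\sigma\circ X$ is Riemann--Stieltjes integrable with respect to $L^d$ on $[s,t]$ and $X_t-X_s=\int_s^t\mu(X_u)\,du+\int_s^t\sigma(X_u)\,dL^d_u$. A process is stationary if its finite-dimensional distributions are invariant under time shifts.
   Formalization: The two-sided Lévy process is taken as L_t = -L^2_{(-t)-} for t<0 (standard sign) instead of +L^2_{-t-}; with the plus sign X is not stationary when L is asymmetric, and for symmetric L both forms agree. *)

(* Defs.v *)
From HB Require Import structures.
From mathcomp Require Import all_boot all_order all_algebra.
From mathcomp Require Import all_classical all_reals all_analysis.

Set Implicit Arguments.
Unset Strict Implicit.
Unset Printing Implicit Defensive.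

Import Order.TTheory GRing.Theory Num.Theory.
Import numFieldNormedType.Exports.

Local Open Scope classical_set_scope.
Local Open Scope ring_scope.

Section riemann_stieltjes.
Context {R : realType}.
Implicit Types (f g : R -> R) (a b : R) (s : seq R) (xi : nat -> R).

(** As in [variation], the subdivision is [a :: s], its [i]-th point is
    [nth b (a :: s) i], and the [i]-th tag is [xi i]. *)
Definition tagged_partition a b s xi : Prop :=
  itv_partition a b s /\
  forall i, (i < size s)%N ->
    nth b (a :: s) i <= xi i <= nth b (a :: s) i.+1.

Definition mesh_lt a b s (delta : R) : Prop :=
  forall i, (i < size s)%N ->
    nth b (a :: s) i.+1 - nth b (a :: s) i < delta.

Definition RS_sum f g a b s xi : R :=
  let x := nth b (a :: s) in
  \sum_(0 <= i < size s) f (xi i) * (g (x i.+1) - g (x i)).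

Definition is_RS_integral f g a b (v : R) : Prop :=
  a <= b /\
  forall eps : R, 0 < eps -> exists2 delta : R, 0 < delta &
    forall s xi, tagged_partition a b s xi -> mesh_lt a b s delta ->
      `|RS_sum f g a b s xi - v| < eps.

Definition RS_integrable f g a b : Prop := exists v, is_RS_integral f g a b v.

(** Meaningful only under [RS_integrable f g a b]. *)
Definition RS_integral f g a b : R := get (is_RS_integral f g a b).

Definition p_variation (p : R) g a b : \bar R :=
  ereal_sup
    [set (let x := nth b (a :: s) in
          \sum_(0 <= i < size s) `|g (x i.+1) - g (x i)| `^ p)%:E
    | s in itv_partition a b].

Definition locally_bounded_p_variation (p : R) g : Prop :=
  forall a b, a <= b -> (p_variation p g a b < +oo)%E.

Definition W_con (p : R) g : Prop :=
  continuous g /\ locally_bounded_p_variation p g.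

(** Approach to an end point of an open interval, from inside it. *)
Definition from_left_end (a : \bar R) : set_system R :=
  match a with r%:E => r^'+ | _ => -oo end.
Definition to_right_end (b : \bar R) : set_system R :=
  match b with r%:E => r^'- | _ => +oo end.

Definition is_improper_riemann (h : R -> R) (a b : \bar R) (v : R) : Prop :=
  (forall x y, (a < x%:E)%E -> x <= y -> (y%:E < b)%E ->
    RS_integrable h id x y) /\
  (fun xy : R * R => RS_integral h id xy.1 xy.2)
    @ filter_prod (from_left_end a) (to_right_end b) --> v.

(** Improper Riemann integral of [h] over ]a, +oo[ with the finitely many
    interior singularities listed, in increasing order, in [s]. *)
Fixpoint is_improper_riemann_split (h : R -> R) (a : \bar R) s (v : R) : Prop :=
  match s with
  | [::] => is_improper_riemann h a +oo%E v
  | c :: s' => exists v1 v2 : R,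
      [/\ (a < c%:E)%E, is_improper_riemann h a c%:E v1,
          is_improper_riemann_split h c%:E s' v2 & v = v1 + v2]
  end.

Definition is_improper_riemann_line (h : R -> R) (v : R) : Prop :=
  exists s, is_improper_riemann_split h -oo%E s v.

End riemann_stieltjes.

Section processes.
Context {d : measure_display} {T : measurableType d} {R : realType}.
Variable P : probability T R.
Implicit Types (X Y Z L Ld : R -> T -> R).

Definition is_process X : Prop := forall t, measurable_fun setT (X t).

Definition fdd_event X n (t : 'I_n -> R) (A : set (n.-tuple (measurableTypeR R)))
  : set T :=
  [set w | A [tuple (X (t i) w : measurableTypeR R) | i < n]].

Definition stationary X : Prop :=
  forall n (t : 'I_n -> R) (h : R) (A : set (n.-tuple (measurableTypeR R))),
    measurable A ->
    P (fdd_event X (fun i => t i + h) A) = P (fdd_event X t A).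

(** Processes indexed by [0, +oo[ are functions on [R] of which only the values
    at nonnegative times are used. *)
Definition same_law_nonneg X Y : Prop :=
  forall n (t : 'I_n -> R) (A : set (n.-tuple (measurableTypeR R))),
    (forall i, 0 <= t i) -> measurable A ->
    P (fdd_event X t A) = P (fdd_event Y t A).

Definition sigma_nonneg X : set (set T) :=
  <<s [set E | exists t (B : set (measurableTypeR R)),
        [/\ 0 <= t, measurable B & E = X t @^-1` B]] >>.

Definition independent_processes_nonneg X Y : Prop :=
  forall E F, sigma_nonneg X E -> sigma_nonneg Y F ->
    P (E `&` F) = (P E * P F)%E.

(** Taking some [B i := setT] gives the product rule for subfamilies. *)
Definition mutually_independent n (V : 'I_n -> T -> R) : Prop :=
  forall B : 'I_n -> set (measurableTypeR R), (forall i, measurable (B i)) ->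
    P (\bigcap_(i in [set: 'I_n]) (V i @^-1` B i)) =
    (\prod_(i < n) P (V i @^-1` B i))%E.

Definition cadlag_nonneg (g : R -> R) : Prop :=
  (forall t, 0 <= t -> g s @[s --> t^'+] --> g t) /\
  (forall t, 0 < t -> cvg (g s @[s --> t^'-])).

Record is_levy_process Z : Prop := {
  levy_measurable : forall t, 0 <= t -> measurable_fun setT (Z t) ;
  levy_start : {ae P, forall w, Z 0 w = 0} ;
  levy_independent_increments :
    forall n (t : nat -> R), 0 <= t 0%N -> (forall i, t i <= t i.+1) ->
      mutually_independent (fun (i : 'I_n) w => Z (t i.+1) w - Z (t i) w) ;
  levy_stationary_increments :
    forall (s t : R) (B : set (measurableTypeR R)), 0 <= s -> 0 <= t ->
      measurable B ->
      P [set w | B (Z (s + t) w - Z s w)] = P [set w | B (Z t w - Z 0 w)] ;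
  levy_stochastically_continuous :
    forall (t eps : R), 0 <= t -> 0 < eps ->
      P [set w | eps < `|Z s w - Z t w|]
        @[s --> within (fun s : R => 0 <= s) (nbhs t)] --> 0%E ;
  levy_cadlag : {ae P, forall w, cadlag_nonneg (Z ^~ w)} }.

(** The sign in front of [L2] is what makes the increments of the two-sided
    process stationary on the whole line. *)
Definition two_sided (L1 L2 : R -> T -> R) : R -> T -> R := fun t w =>
  if 0 <= t then L1 t w else - lim (L2 s w @[s --> (- t)^'-]).

Definition is_two_sided_levy_process L : Prop :=
  exists L1 L2, [/\ is_levy_process L1 /\ is_levy_process L2,
    same_law_nonneg L1 L2, independent_processes_nonneg L1 L2 &
    L = two_sided L1 L2].

(** [gam, A, nu] is the Levy-Khintchine triplet of [V]; with
    [re u + i im u] the characteristic exponent, the two last clauses are the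
    real and imaginary parts of E[exp(i u V)] = exp(re u + i im u). *)
Definition has_levy_khintchine_triplet (V : T -> R) (gam A : R)
    (nu : {measure set (measurableTypeR R) -> \bar R}) : Prop :=
  let re (u : R) := - (A * u ^+ 2 / 2) +
    Rintegral nu setT (fun x : R => cos (u * x) - 1) in
  let im (u : R) := gam * u +
    Rintegral nu setT
      (fun x : R => sin (u * x) - u * x * (`|x| <= 1)%R%:R) in
  [/\ 0 <= A, nu [set 0] = 0%E,
      (\int[nu]_x (Num.min (x ^+ 2) 1)%:E < +oo)%E,
      (forall u : R, 'E_P[fun w => (cos (u * V w) : R)] =
                     (expR (re u) * cos (im u))%:E)%E &
      (forall u : R, 'E_P[fun w => (sin (u * V w) : R)] =
                     (expR (re u) * sin (im u))%:E)%E].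

Definition no_brownian_component L : Prop :=
  exists (gam : R) (nu : {measure set (measurableTypeR R) -> \bar R}),
    has_levy_khintchine_triplet (L 1) gam 0 nu.

(** The list of triples (c, a, b) stands for the sum of the c * 1_(a, b]. *)
Definition step_fun (s : seq (R * R * R)) (x : R) : R :=
  \sum_(q <- s) q.1.1 * ((q.1.2 < x) && (x <= q.2))%R%:R.

Definition step_integral L (s : seq (R * R * R)) (w : T) : R :=
  \sum_(q <- s) q.1.1 * (L q.2 w - L q.1.2 w).

(** [V] is a version of the L^2(Omega)-integral of [k] with respect to [L]. *)
Definition is_L2_integral L (k : R -> R) (V : T -> R) : Prop :=
  measurable_fun setT V /\
  exists s : nat -> seq (R * R * R),
    [/\ forall n q, q \in s n -> q.1.2 <= q.2,
        (\int[lebesgue_measure]_x ((step_fun (s n) x - k x) ^+ 2)%:E)%E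
          @[n --> \oo] --> 0%E &
        'E_P[fun w => ((step_integral L (s n) w - V w) ^+ 2)%R]%E
          @[n --> \oo] --> 0%E].

Definition Gamma (a : R) : R :=
  Rintegral lebesgue_measure `]0, +oo[ (fun x : R => x `^ (a - 1) * expR (- x)).

(** (x)_+^a; since [0 `^ a = 0] for [a != 0], this vanishes for [x <= 0] also
    when the exponent is negative. *)
Definition pos_powR (x a : R) : R := (Num.max x 0) `^ a.

Record is_FLP (dd : R) (L Ld : R -> T -> R) : Prop := {
  FLP_levy : is_two_sided_levy_process L ;
  FLP_zero_mean : forall t, 'E_P[L t]%E = 0%E ;
  FLP_second_moment : ('E_P[fun w => ((L 1 w) ^+ 2)%R] < +oo)%E ;
  FLP_no_brownian : no_brownian_component L ;
  FLP_L2_integral : forall t, is_L2_integral L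
    (fun s => (Gamma (dd + 1))^-1 * (pos_powR (t - s) dd - pos_powR (- s) dd))
    (Ld t) ;
  FLP_continuous_modification : {ae P, forall w, continuous (Ld ^~ w) /\
    forall t, exists2 v : R,
      is_improper_riemann_line
        (fun s => (pos_powR (t - s) (dd - 1) - pos_powR (- s) (dd - 1)) * L s w)
        v &
      Ld t w = (Gamma dd)^-1 * v} }.

Definition bounded_p_variation_paths (p : R) X : Prop :=
  {ae P, forall w, locally_bounded_p_variation p (X ^~ w)}.

(** The improper Riemann-Stieltjes integral of exp(- lam (t - s)) dLd_s over
    ]-oo, t], pathwise. *)
Definition FLOU (lam : R) (Ld : R -> T -> R) : R -> T -> R := fun t w =>
  lim (RS_integral (fun s => expR (- lam * (t - s))) (Ld ^~ w) a t
         @[a --> -oo]).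

Definition open_interval (a b : \bar R) : set R :=
  [set x | (a < x%:E)%E /\ (x%:E < b)%E].

Definition is_pathwise_solution (p : R) (a b : \bar R) (mu sigma : R -> R)
    (Ld X : R -> T -> R) : Prop :=
  is_process X /\
  {ae P, forall w,
    [/\ W_con p (X ^~ w), forall t, open_interval a b (X t w) &
      forall s t, s <= t ->
        RS_integrable (fun u => sigma (X u w)) (Ld ^~ w) s t /\
        X t w - X s w =
          Rintegral lebesgue_measure `[s, t] (fun u => mu (X u w)) +
          RS_integral (fun u => sigma (X u w)) (Ld ^~ w) s t]}.

Definition is_stationary_pathwise_solution (p : R) (a b : \bar R)
    (mu sigma : R -> R) (Ld X : R -> T -> R) : Prop :=
  is_pathwise_solution p a b mu sigma Ld X /\ stationary X.

End processes.

Section strongly_proper.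
Context {R : realType}.

(** Absolute continuity is required on every compact subinterval of [I]; on the
    whole of a bounded [I] it would contradict the infinite limits of [psi]. *)
Definition locally_absolutely_continuous (I : set R) (psi : R -> R) : Prop :=
  forall x y, I x -> I y -> x <= y ->
  forall eps : R, 0 < eps -> exists2 delta : R, 0 < delta &
    forall n (u v : 'I_n -> R),
      (forall i, [/\ x <= u i, u i <= v i & v i <= y]) ->
      (forall i j, i != j -> v i <= u j \/ v j <= u i) ->
      \sum_(i < n) (v i - u i) < delta ->
      \sum_(i < n) `|psi (v i) - psi (u i)| < eps.

(** The triple (]a, b[, mu, sigma) is strongly proper when such [psi], [phi] and
    [lam] exist. It determines [psi] on ]a, b[, hence the inverse [phi] of [psi],
    and the friction coefficient [lam]. *)
Record strongly_proper (a b : \bar R) (mu sigma : R -> R)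
    (psi phi : R -> R) (lam : R) : Prop := {
  sp_interval : (a < b)%E ;
  sp_mu_continuous : {in open_interval a b, continuous mu} ;
  sp_sigma_continuous : {in open_interval a b, continuous sigma} ;
  sp_psi_decreasing : forall x y, open_interval a b x -> open_interval a b y ->
    x < y -> psi y < psi x ;
  sp_psi_abs_continuous : locally_absolutely_continuous (open_interval a b) psi ;
  sp_psi_quotient : forall x, open_interval a b x -> sigma x != 0 ->
    psi x = mu x / sigma x ;
  sp_psi_right_limit : psi x @[x --> to_right_end b] --> -oo ;
  sp_psi_left_limit : psi x @[x --> from_left_end a] --> +oo ;
  sp_lam_gt0 : 0 < lam ;
  sp_friction : {ae lebesgue_measure, forall x : R, open_interval a b x ->
    derivable psi x 1 /\ sigma x * derive1 psi x = - lam} ;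
  sp_phi_inverse : (forall y, open_interval a b (phi y) /\ psi (phi y) = y) /\
    (forall x, open_interval a b x -> phi (psi x) = x) ;
  sp_phi_derivable : forall y, derivable phi y 1 ;
  sp_phi_derive_lipschitz : forall K : set R, compact K ->
    [lipschitz derive1 phi y | y in K] }.

Definition state_space_transform (phi : R -> R) (lam : R) : R -> R :=
  fun x => phi (- lam * x).

End strongly_proper.

(* Main.v *)
(** Pathwise, [FLOU] solves the Langevin equation
    [U t = g t - lam * V t] with [V' = U], [g] being a path of [Ld]; the improper
    integral converges at [-oo] because the increments of [Ld] have second moment
    of order [|t - s|^(2d + 1)], so that chaining bounds the paths by exponentials
    of arbitrarily small rate. Since [f' = sigma o f] and
    [mu (f x) = - lam x f' x], and since finite [p]-variation with [p < 2] makes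
    the sums of squared increments negligible, a Taylor expansion of [f (U t)] turns the Langevin equation into
    the SDE, and, when [sigma] has no zeros, the inverse of [f] turns the SDE back
    into the Langevin equation; the Saks-Henstock lemma avoids any Young estimate
    here.
    Stationarity passes from the increments of [L] to its step integrals, then to
    [L^2]-limits, to the increments of [Ld], to Riemann-Stieltjes sums and to their
    almost sure limits. For uniqueness, two solutions of one Langevin equation
    differ by a multiple of [exp (- lam t)], which is unbounded in probability as
    [t -> -oo] unless it vanishes, whereas stationary processes are tight. *)

Require Import Defs.
From HB Require Import structures.
From mathcomp Require Import all_boot all_order all_algebra.
From mathcomp Require Import all_classical all_reals all_analysis measurable_realfun.
From mathcomp Require Import ring lra zify.

Set Implicit Arguments.
Unset Strict Implicit.
Unset Printing Implicit Defensive.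

Import Order.TTheory GRing.Theory Num.Theory.
Import numFieldNormedType.Exports.

Local Open Scope classical_set_scope.
Local Open Scope ring_scope.

(** * Riemann-Stieltjes sums *)

Section riemann_stieltjes.
Context {R : realType}.
Implicit Types (f g F : R -> R) (a b c dl : R) (q : R -> R -> R -> R)
  (tp : seq (R * R)).

(** Three obstacles shape the proof. (1) Dividing the SDE by [sigma] multiplies every cell of a
    Riemann-Stieltjes sum by a different factor. Convergence of the sums controls only the total
    error, whereas Saks-Henstock controls the sum of the absolute errors, which survives bounded
    factors. (2) A two-sided Levy process is glued at 0 from two independent halves, so the product
    formula for increments is available only along partitions through 0. A shift by [h] is therefore
    compared along partitions that contain both 0 and [-h], and moments of increments across 0 are
    assembled from both sides. (3) Besides zero means, only the second moment at time 1 is given.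
    The others follow because adding an independent centred variable cannot decrease E X^2, and the
    variance is linear in time as a nonnegative additive function. Square integrability of the
    kernel is read off from the existence of its L^2 integral, and self-similarity yields the
    exponent 2d + 1. Completeness of [P] makes the pathwise limits measurable, since they are
    controlled only off a null set. *)

Fixpoint tsum q a tp : R :=
  if tp is (xi, x) :: tp' then q a xi x + tsum q x tp' else 0.

(** Each entry is a tag with the right end of its cell; the left end is carried along as an
    argument. This makes concatenation and induction on cells immediate, and the mesh bound is part
    of the predicate. *)
Fixpoint tpart dl a b tp : Prop :=
  if tp is (xi, x) :: tp' then
    [/\ a < x, a <= xi <= x, x - a < dl & tpart dl x b tp']
  else a = b.

Lemma tpart_of_tagged q b dl s a xi :
  tagged_partition a b s xi -> mesh_lt a b s dl ->
  exists2 tp, tpart dl a b tp &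
    tsum q a tp = \sum_(0 <= i < size s)
      q (nth b (a :: s) i) (xi i) (nth b (a :: s) i.+1).
Proof.
elim: s a xi => [|x s IH] a xi [ip tg] ms.
  by exists [::]; [exact: itv_partition_nil|rewrite big_nil].
have [ax] : a < x /\ True by case: ip => /= /andP[].
have [||tp tpP tpE] := IH x (xi \o S).
- split; first exact: itv_partition_cons ip.
  by move=> i si; exact: (tg i.+1).
- by move=> i si; exact: (ms i.+1).
move=> _; exists ((xi 0%N, x) :: tp).
  split => //; [exact: (tg 0%N)|exact: (ms 0%N)].
by rewrite /= tpE big_nat_recl.
Qed.

Lemma tagged_of_tpart q b dl tp a : tpart dl a b tp ->
  exists s xi, [/\ tagged_partition a b s xi, mesh_lt a b s dl &
    tsum q a tp = \sum_(0 <= i < size s)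
      q (nth b (a :: s) i) (xi i) (nth b (a :: s) i.+1)].
Proof.
elim: tp a => [|[x0 x] tp IH] a /=.
  move=> ->; exists [::], (fun=> 0); rewrite big_nil.
  by do !split => //=.
move=> [ax ax0 xadl /IH[s [xi [[[p1 p2] tg] ms ->]]]].
exists (x :: s), (fun i => if i is j.+1 then xi j else x0); split.
- split; first by split => //=; rewrite ax.
  by case=> [|i] //= si; exact: tg.
- by case=> [|i] //= si; exact: ms.
- by rewrite /= big_nat_recl.
Qed.

Definition RS_term f g (u xi v : R) := f xi * (g v - g u).

Lemma is_RS_integralP f g a b v : is_RS_integral f g a b v <->
  a <= b /\ forall eps, 0 < eps -> exists2 dl, 0 < dl &
    forall tp, tpart dl a b tp -> `|tsum (RS_term f g) a tp - v| < eps.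
Proof.
split=> -[ab H]; split=> // e e0; have [dl dl0 K] := H e e0; exists dl => //.
- move=> tp /(tagged_of_tpart (RS_term f g))[s [xi [tg ms ->]]].
  exact: K.
- move=> s xi tg /(tpart_of_tagged (RS_term f g) tg)[tp tpP E].
  by have := K tp tpP; rewrite E.
Qed.

Lemma tpart_le dl a b tp : tpart dl a b tp -> a <= b.
Proof.
elim: tp a => [|[x0 x] tp IH] a /=; first by move=> ->.
by move=> [/ltW ax _ _ /IH]; exact: le_trans.
Qed.

Lemma tpart_mono dl dl' a b tp : dl <= dl' -> tpart dl a b tp -> tpart dl' a b tp.
Proof.
move=> dd; elim: tp a => [|[x0 x] tp IH] a //= [ax a0 xa /IH h]; split => //.
exact: lt_le_trans dd.
Qed.

Lemma tpart_cat dl a b c t1 t2 : tpart dl a b t1 -> tpart dl b c t2 ->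
  tpart dl a c (t1 ++ t2).
Proof.
move=> + h2; elim: t1 a => [|[x0 x] tp IH] a /=; first by move=> ->.
by move=> [ax a0 xa /IH h].
Qed.

Lemma tsum_cat q dl a b t1 t2 : tpart dl a b t1 ->
  tsum q a (t1 ++ t2) = tsum q a t1 + tsum q b t2.
Proof.
elim: t1 a => [|[x0 x] tp IH] a /=; first by move=> ->; rewrite add0r.
by move=> [ax a0 xa /IH ->]; rewrite addrA.
Qed.

Lemma tpart_exists dl a b : a <= b -> 0 < dl -> exists tp, tpart dl a b tp.
Proof.
move=> ab dl0; have dl20 : 0 < dl / 2 by rewrite divr_gt0.
(* Steps of length [dl / 2] keep the mesh strictly below [dl]; [N] bounds their number and drives
   the induction. *)
have [N] : exists N : nat, b - a < N%:R * (dl / 2).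
  exists (Num.truncn ((b - a) / (dl / 2))).+1.
  by rewrite -ltr_pdivrMr// real_truncnS_gt// num_real.
elim: N a ab => [|N IH] a ab h; first by move: h; rewrite mul0r; lra.
move: ab; rewrite le_eqVlt => /predU1P[->|ab]; first by exists [::].
have [bd|db] := ltP (b - a) dl.
  by exists [:: (b, b)] => /=; split => //; rewrite (ltW ab) /=.
have [||tp H] := IH (a + dl / 2); first by lra.
  by move: h; rewrite -natr1 mulrDl; lra.
exists ((a, a + dl / 2) :: tp); split => //; lra.
Qed.

Lemma ler_tsum q q' dl a b tp : tpart dl a b tp ->
  (forall u xi v, a <= u -> u <= xi -> xi <= v -> v <= b -> v - u < dl ->
    q u xi v <= q' u xi v) ->
  tsum q a tp <= tsum q' a tp.
Proof.
elim: tp a => [|[x0 x] tp IH] a //= [ax /andP[a0 x0x] xa h] H.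
have xb := tpart_le h.
rewrite lerD//; first exact: H.
apply: IH => // u xi v xu *; apply: H => //; exact: le_trans (ltW ax) xu.
Qed.

Lemma tsumB q q' a tp :
  tsum q a tp - tsum q' a tp = tsum (fun u xi v => q u xi v - q' u xi v) a tp.
Proof.
elim: tp a => [|[x0 x] tp IH] a /=; first by rewrite subrr.
by rewrite -IH; ring.
Qed.

Lemma tsumD q q' a tp :
  tsum q a tp + tsum q' a tp = tsum (fun u xi v => q u xi v + q' u xi v) a tp.
Proof.
elim: tp a => [|[x0 x] tp IH] a /=; first by rewrite addr0.
by rewrite -IH; ring.
Qed.

Lemma tsumZ q k a tp : k * tsum q a tp = tsum (fun u xi v => k * q u xi v) a tp.
Proof.
elim: tp a => [|[x0 x] tp IH] a /=; first by rewrite mulr0.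
by rewrite -IH mulrDr.
Qed.

Lemma eq_tsum q q' a tp : (forall u xi v, q u xi v = q' u xi v) ->
  tsum q a tp = tsum q' a tp.
Proof. by move=> e; elim: tp a => [|[x0 x] tp IH] a //=; rewrite e IH. Qed.

Lemma ler_norm_tsum q a tp :
  `|tsum q a tp| <= tsum (fun u xi v => `|q u xi v|) a tp.
Proof.
elim: tp a => [|[x0 x] tp IH] a /=; first by rewrite normr0.
by rewrite (le_trans (ler_normD _ _))// lerD.
Qed.

Lemma tsum_telescope F dl a b tp : tpart dl a b tp ->
  tsum (fun u _ v => F v - F u) a tp = F b - F a.
Proof.
elim: tp a => [|[x0 x] tp IH] a /=; first by move=> ->; rewrite subrr.
by move=> [_ _ _ /IH ->]; ring.
Qed.

Lemma is_RS_integral_unique f g a b v w :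
  is_RS_integral f g a b v -> is_RS_integral f g a b w -> v = w.
Proof.
move=> /is_RS_integralP[ab Hv] /is_RS_integralP[_ Hw].
apply/eqP; rewrite -subr_eq0 -normr_le0; apply/ler_addgt0Pl => e e0.
have e20 : 0 < e / 2 by rewrite divr_gt0.
have [d1 d10 H1] := Hv _ e20; have [d2 d20 H2] := Hw _ e20.
have [tp tpP] : exists tp, tpart (Num.min d1 d2) a b tp.
  by apply: tpart_exists => //; rewrite lt_min d10.
have l1 : Num.min d1 d2 <= d1 by rewrite ge_min lexx.
have l2 : Num.min d1 d2 <= d2 by rewrite ge_min lexx orbT.
have := H1 tp (tpart_mono l1 tpP).
have := H2 tp (tpart_mono l2 tpP).
rewrite addr0 ler_norml => /ltr_normlP[h1 h2] /ltr_normlP[h3 h4].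
by apply/andP; split; lra.
Qed.

Lemma RS_integralE f g a b v : is_RS_integral f g a b v ->
  RS_integral f g a b = v.
Proof.
move=> h; apply: (@is_RS_integral_unique f g a b) => //.
by rewrite /RS_integral; apply: getPex; exists v.
Qed.

Lemma is_RS_integral_sew f g F a b : a <= b ->
  (forall eps, 0 < eps -> exists2 dl, 0 < dl &
    forall tp, tpart dl a b tp ->
     tsum (fun u xi v => `|RS_term f g u xi v - (F v - F u)|) a tp < eps) ->
  is_RS_integral f g a b (F b - F a).
Proof.
move=> ab H; apply/is_RS_integralP; split => // e /H[dl dl0 K].
exists dl => // tp tpP; rewrite -(tsum_telescope F tpP) tsumB.
by apply: le_lt_trans (ler_norm_tsum _ _ _) _; exact: K.
Qed.

Lemma is_RS_integral_sew_lin f g F a b : a <= b ->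
  (forall eps, 0 < eps -> exists2 dl, 0 < dl &
    forall u xi v, a <= u -> u <= xi -> xi <= v -> v <= b -> v - u < dl ->
     `|RS_term f g u xi v - (F v - F u)| <= eps * (v - u)) ->
  is_RS_integral f g a b (F b - F a).
Proof.
move=> ab H; apply: is_RS_integral_sew => // e e0.
have ba : 0 < b - a + 1 by lra.
have [|dl dl0 K] := H (e / (b - a + 1)); first by rewrite divr_gt0.
exists dl => // tp tpP.
have L := ler_tsum tpP K; apply: le_lt_trans L _.
rewrite -tsumZ (tsum_telescope id tpP) /= mulrAC ltr_pdivrMr//; nra.
Qed.

(** Integrability over [a, c] is assumed because a fine partition of it may jump over [b]. Once it
    is known, its value can be read off from a single fine partition through [b]. *)
Lemma is_RS_integral_cat f g a b c v w : is_RS_integral f g a b v ->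
  is_RS_integral f g b c w -> RS_integrable f g a c ->
  is_RS_integral f g a c (v + w).
Proof.
move=> hv hw [z hz]; suff <- : z = v + w by [].
move/is_RS_integralP: hz => [ac Hz].
move/is_RS_integralP: hv => [ab Hv].
move/is_RS_integralP: hw => [bc Hw].
apply/eqP; rewrite -subr_eq0 -normr_le0; apply/ler_addgt0Pl => e e0.
have e20 : 0 < e / 3 by rewrite divr_gt0.
have [d1 d10 H1] := Hv _ e20; have [d2 d20 H2] := Hw _ e20.
have [d3 d30 H3] := Hz _ e20.
have dm : 0 < Num.min d1 (Num.min d2 d3) by rewrite !lt_min d10 d20.
have [t1 t1P] := tpart_exists ab dm; have [t2 t2P] := tpart_exists bc dm.
have l1 : Num.min d1 (Num.min d2 d3) <= d1 by rewrite ge_min lexx.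
have l2 : Num.min d1 (Num.min d2 d3) <= d2 by rewrite !ge_min lexx orbT.
have l3 : Num.min d1 (Num.min d2 d3) <= d3 by rewrite !ge_min lexx !orbT.
have := H1 _ (tpart_mono l1 t1P); have := H2 _ (tpart_mono l2 t2P).
have := H3 _ (tpart_mono l3 (tpart_cat t1P t2P)).
rewrite (tsum_cat _ _ t1P).
move=> /ltr_normlP[h1 h2] /ltr_normlP[h3 h4] /ltr_normlP[h5 h6].
by rewrite addr0 ler_norml; apply/andP; split; lra.
Qed.

(** Each term of a fine tagged sum whose error has the sign of [k] is kept, and
    each other one is replaced by a sum over a much finer partition of the same
    cell. *)
Lemma saks_henstock_half (k : R) f g (J : R -> R -> R) dl a b tp :
  0 < dl -> tpart dl a b tp ->
  (forall u v, a <= u -> u <= v -> v <= b -> is_RS_integral f g u v (J u v)) ->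
  forall eta, 0 < eta -> exists2 tp', tpart dl a b tp' &
    tsum (fun u xi v => Num.max 0 (k * (RS_term f g u xi v - J u v))) a tp <=
    k * (tsum (RS_term f g) a tp' - tsum (fun u _ v => J u v) a tp) + eta.
Proof.
move=> dl0; elim: tp a => [|[x0 x] tp IH] a /=.
  by move=> -> _ e e0; exists [::] => //=; rewrite subrr; lra.
move=> [ax a0 xa tpP] HJ e e0.
have xb := tpart_le tpP.
have e20 : 0 < e / 2 by lra.
have [|tp' tp'P h] := IH x tpP _ _ e20.
  by move=> u v xu; apply: HJ; exact: le_trans (ltW ax) xu.
have [pos|neg] := leP 0 (k * (RS_term f g a x0 x - J a x)).
  by exists ((x0, x) :: tp') => //=; lra.
have /is_RS_integralP[_ HI] := HJ a x (lexx _) (ltW ax) xb.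
have k10 : 0 < `|k| + 1 by rewrite ltr_wpDl.
have [|d1 d10 K] := HI (e / 2 / (`|k| + 1)); first by rewrite divr_gt0.
have [|t t_] := tpart_exists (ltW ax) (_ : 0 < Num.min dl d1).
  by rewrite lt_min dl0.
have tdl : tpart dl a x t by apply: tpart_mono t_; rewrite ge_min lexx.
have /K kt : tpart d1 a x t by apply: tpart_mono t_; rewrite ge_min lexx orbT.
exists (t ++ tp'); first exact: tpart_cat tp'P.
rewrite (tsum_cat _ _ tdl).
have : `|k * (tsum (RS_term f g) a t - J a x)| <= e / 2.
  rewrite normrM (le_trans (ler_wpM2l (normr_ge0 k) (ltW kt)))//.
  rewrite mulrCA ler_piMr ?(ltW e20)// ler_pdivrMr//; lra.
rewrite ler_norml => /andP[h1 h2]; lra.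
Qed.

(** The half lemma with [k = 1] and [k = -1] bounds the positive and the negative parts of the cell
    errors. Since [J] is additive, its sum telescopes to [J a b], so each bound is the total error
    of one other fine partition. *)
Lemma saks_henstock f g (J : R -> R -> R) a b : a <= b ->
  (forall u v, a <= u -> u <= v -> v <= b -> is_RS_integral f g u v (J u v)) ->
  forall eps, 0 < eps -> exists2 dl, 0 < dl &
    forall tp, tpart dl a b tp ->
      tsum (fun u xi v => `|RS_term f g u xi v - J u v|) a tp < eps.
Proof.
move=> ab HJ e e0.
have Jadd u v w : a <= u -> u <= v -> v <= w -> w <= b -> J u w = J u v + J v w.
  move=> au uv vw wb; apply: (@is_RS_integral_unique f g u w).
    by apply: HJ => //; exact: le_trans vw.
  apply: is_RS_integral_cat.
  - by apply: HJ => //; exact: le_trans wb.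
  - by apply: HJ => //; exact: le_trans uv.
  - by exists (J u w); apply: HJ => //; exact: le_trans vw.
have Jtele : forall dl tp, tpart dl a b tp ->
    tsum (fun u _ v => J u v) a tp = J a b.
  move=> dl tp; elim: tp a {ab HJ} Jadd => [|[x0 x] tp IH] a' Ja /=.
    move=> ab'; move: Ja; rewrite ab' => Ja; have := Ja b b b (lexx _) (lexx _) (lexx _) (lexx _); lra.
  move=> [ax a0 xa tpP]; have xb := tpart_le tpP; rewrite (IH x) //.
    by rewrite -Ja // ltW.
  by move=> u v w xu; apply: Ja; exact: le_trans (ltW ax) xu.
have /is_RS_integralP[_ HI] := HJ a b (lexx _) ab (lexx _).
have e80 : 0 < e / 8 by lra.
have [dl dl0 K] := HI _ e80.
exists dl => // tp tpP.
have [t1 /K k1 h1] := saks_henstock_half 1 dl0 tpP HJ e80.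
have [t2 /K k2 h2] := saks_henstock_half (-1) dl0 tpP HJ e80.
rewrite (Jtele _ _ tpP) in h1 h2.
have -> : tsum (fun u xi v => `|RS_term f g u xi v - J u v|) a tp =
  tsum (fun u xi v => Num.max 0 (1 * (RS_term f g u xi v - J u v))) a tp +
  tsum (fun u xi v => Num.max 0 (-1 * (RS_term f g u xi v - J u v))) a tp.
  rewrite tsumD; apply: eq_tsum => u xi v; rewrite mul1r mulN1r.
  set z := RS_term f g u xi v - J u v.
  have [z0|z0] := leP 0 z.
    by rewrite ger0_norm// max_l ?addr0 //; lra.
  by rewrite ltr0_norm// max_r ?add0r //; lra.
move: k1 k2 => /ltr_normlP[? ?] /ltr_normlP[? ?]; lra.
Qed.

End riemann_stieltjes.

(** * Continuous functions on compact intervals and their antiderivatives *)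

Section real_functions.
Context {R : realType}.
Implicit Types (f g F h : R -> R) (a b c : R).
Local Notation mu := (@lebesgue_measure R).

(** Heine-Cantor by near coverings: the modulus is the covering parameter, tending to 0 from the
    right, so that compactness turns local moduli into a common one. *)
Lemma continuous_uniform_itv g a b e : continuous g -> 0 < e ->
  exists2 dl, 0 < dl & forall x y, a <= x <= b -> a <= y <= b ->
    `|x - y| < dl -> `|g x - g y| < e.
Proof.
move=> cg e0.
have /compact_near_coveringP/(_ R (0^'+)
  (fun dl x => forall y, `|x - y| < dl -> `|g x - g y| < e)) K :=
  @segment_compact R a b.
have [x _|d /= d0 H] := K _.
  have e20 : 0 < e / 2 by rewrite divr_gt0.
  have := cg x; move=> /cvgrPdist_lt/(_ _ e20)[d /= d0 dH].
  exists (ball x (d / 2), [set y | 0 < y < d / 2]).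
    split; first by apply: nbhsx_ballx; rewrite divr_gt0.
    near=> z => /=; apply/andP; split => //.
    near: z; apply: nbhs_right_lt; by rewrite divr_gt0.
  move=> [x' dl] /= []; rewrite /ball /= => xx' /andP[dl0 dld] y x'y.
  have h1 := dH x' (_ : ball x d x').
  have h2 := dH y (_ : ball x d y).
  have {}h1 : `|g x - g x'| < e / 2.
    by apply: h1; rewrite /ball /=; apply: lt_trans xx' _; lra.
  have {}h2 : `|g x - g y| < e / 2.
    apply: h2; rewrite /ball /= -(subrK x' x) -addrA.
    by rewrite (le_lt_trans (ler_normD _ _))//; lra.
  rewrite (_ : g x' - g y = (g x - g y) - (g x - g x')); last by ring.
  by rewrite (le_lt_trans (ler_normB _ _))//; lra.
exists (d / 2); first by rewrite divr_gt0.
move=> x y xab yab xy; apply: (H (d / 2)) => //=.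
- by rewrite sub0r normrN ger0_norm ?divr_ge0 ?ltW//; lra.
- by rewrite divr_gt0.
Unshelve. all: by end_near. Qed.

Lemma continuous_bounded_itv g a b : continuous g ->
  exists2 M, 0 < M & forall x, a <= x <= b -> `|g x| <= M.
Proof.
move=> cg.
have : compact (g @` `[a, b]).
  apply: continuous_compact; last exact: segment_compact.
  exact: continuous_subspaceT.
move=> /compact_bounded[M [_ H]].
exists (`|M| + 1); first by rewrite ltr_wpDl.
move=> x xab; apply: H; first by rewrite (le_lt_trans (ler_norm M))// ltrDl.
by exists x => //=; rewrite in_itv.
Qed.

Lemma is_derive_continuous f df : (forall x : R, is_derive x 1 f (df x)) ->
  continuous f.
Proof.
by move=> H x; apply/differentiable_continuous/derivable1_diffP; case: (H x).
Qed.

Lemma lipschitz_of_derive f df B a b : (forall x : R, is_derive x 1 f (df x)) ->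
  a <= b -> (forall x, a <= x <= b -> `|df x| <= B) ->
  `|f b - f a| <= B * (b - a).
Proof.
move=> fdf ab dfB.
have [c cab ->] := @MVT_segment R f df a b ab (fun x _ => fdf x)
  (continuous_subspaceT (is_derive_continuous fdf)).
rewrite normrM (ger0_norm (_ : 0 <= b - a)) ?subr_ge0//.
by rewrite ler_wpM2r ?subr_ge0// dfB// -in_itv.
Qed.

Lemma continuous_integrable_itv f a b : continuous f ->
  mu.-integrable `[a, b] (EFin \o f).
Proof.
move=> cf; apply: continuous_compact_integrable; first exact: segment_compact.
exact: continuous_subspaceT.
Qed.

Lemma Rintegral_itv_cat f a b c : continuous f -> a <= b -> b <= c ->
  Rintegral mu `[a, c] f = Rintegral mu `[a, b] f + Rintegral mu `[b, c] f.
Proof.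
move=> cf ab bc.
have I := continuous_integrable_itv a c cf.
apply/eqP; rewrite addrC -subr_eq; apply/eqP.
rewrite Rintegral_itvB//= ?bnd_simp//.
rewrite Rintegral_itv_obnd_cbnd//.
apply: integrableS I => //; apply: subset_itv; rewrite ?bnd_simp//.
Qed.

(** The fundamental theorem needs a base point to the left of [x], so the base [-N] moves with [x].
    Subtracting the integral over [-N, 0] makes the value independent of [N]. *)
Lemma continuous_antiderivative f : continuous f ->
  exists F : R -> R, forall x : R, is_derive x 1 F (f x).
Proof.
move=> cf.
pose P N x := Rintegral mu `[- N, x] f - Rintegral mu `[- N, 0] f.
have PP N M x : 0 <= N -> - N <= x -> 0 <= M -> - M <= x -> P N x = P M x.
  move=> N0 Nx M0 Mx; wlog NM : N M N0 Nx M0 Mx / N <= M.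
    move=> W; have [NM|/ltW NM] := leP N M; first exact: W.
    by symmetry; apply: W.
  rewrite /P (@Rintegral_itv_cat f (- M) (- N) x)//; last by lra.
  by rewrite (@Rintegral_itv_cat f (- M) (- N) 0)//; [ring|lra|lra].
exists (fun x => P (`|x| + 1) x) => x.
pose N := `|x| + 2.
have dN : is_derive x 1 (P N) (f x).
  have x1 : x < x + 1 by lra.
  have Nx : - N < x by rewrite /N ltrNl; have := ler_norm (- x); rewrite normrN; lra.
  have [] := @continuous_FTC1 R f (BLeft (- N)) x (x + 1) x1.
  - exact: continuous_integrable_itv.
  - by rewrite ?bnd_simp /= ?bnd_simp; exact: Nx.
  - exact: cf.
  move=> dx <-.
  rewrite -[X in is_derive _ _ _ X]subr0 derive1E.
  by apply: is_deriveB; exact: derivableP.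
apply: near_eq_is_derive dN; near=> y.
have y1 : `|x - y| < 1.
  by near: y; have := @nbhsx_ballx R R x 1 ltr01.
rewrite /N; apply: PP.
- by have := normr_ge0 x; lra.
- have := ler_normD (x - y) (- x); rewrite normrN.
  rewrite (_ : x - y - x = - y); last by ring.
  by have := ler_norm (- y); lra.
- by have := normr_ge0 y; lra.
- by have := ler_norm (- y); rewrite normrN; lra.
Unshelve. all: by end_near. Qed.

Lemma Rintegral_derive F f a b : continuous f ->
  (forall x : R, is_derive x 1 F (f x)) -> a <= b ->
  Rintegral mu `[a, b] f = F b - F a.
Proof.
move=> cf dF; rewrite le_eqVlt => /predU1P[<-|ab].
  by rewrite set_itv1 Rintegral_set1 subrr.
have cF := is_derive_continuous dF.
rewrite /Rintegral (@continuous_FTC2 R f F a b)//.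
- exact: continuous_subspaceT.
- split; first by move=> x _; case: (dF x).
    exact/cvg_at_right_filter/cF.
  exact/cvg_at_left_filter/cF.
- by move=> x _; rewrite derive1E; case: (dF x).
Qed.

End real_functions.

(** * Finite p-variation, the chain rule and integration by parts *)

Section p_variation.
Context {R : realType}.
Implicit Types (f g h F : R -> R) (a b c p : R).

Lemma p_variation_boundP p g a b :
  (p_variation p g a b < +oo)%E <->
  exists M, forall s, itv_partition a b s ->
    \sum_(0 <= i < size s)
      `|g (nth b (a :: s) i.+1) - g (nth b (a :: s) i)| `^ p <= M.
Proof.
split=> [finV|[M HM]].
  exists (fine (p_variation p g a b)) => s sP.
  have le : ((\sum_(0 <= i < size s)
      `|g (nth b (a :: s) i.+1) - g (nth b (a :: s) i)| `^ p)%:E <=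
      p_variation p g a b)%E by apply: ereal_sup_ubound; exists s.
  rewrite -lee_fin fineK// fin_numE; apply/andP; split; last by rewrite lt_eqF.
  by rewrite gt_eqF// (lt_le_trans _ le)// ltNyr.
apply: (@le_lt_trans _ _ M%:E); last by rewrite ltry.
by apply: ge_ereal_sup => _ [s sP <-]; rewrite lee_fin; exact: HM.
Qed.

Lemma powRD_le p (x y : R) : 0 <= p -> 0 <= x -> 0 <= y ->
  (x + y) `^ p <= 2 `^ p * (x `^ p + y `^ p).
Proof.
move=> p0; wlog xy : x y / x <= y.
  move=> W x0 y0; have [xy|/ltW xy] := leP x y; first exact: W.
  by rewrite addrC (addrC (x `^ p)); exact: W.
move=> x0 y0; apply: (@le_trans _ _ ((2 * y) `^ p)).
  by apply: ge0_ler_powR => //; rewrite ?nnegrE; lra.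
rewrite powRM// ler_wpM2l ?powR_ge0//.
by rewrite lerDr powR_ge0.
Qed.

(** Since [p >= 1], the p-th power of a cell length is at most a constant times the length, and
    lengths telescope. The [g] part is bounded by the p-variation of [g]. *)
Lemma p_variation_dominated p g h a b (K1 K2 : R) : 1 <= p -> 0 <= K1 -> 0 <= K2 ->
  (forall u v, a <= u -> u <= v -> v <= b ->
    `|h v - h u| <= K1 * `|g v - g u| + K2 * (v - u)) ->
  (p_variation p g a b < +oo)%E -> (p_variation p h a b < +oo)%E.
Proof.
move=> p1 K10 K20 H /p_variation_boundP[M HM]; apply/p_variation_boundP.
have p0 : 0 <= p by lra.
pose C1 := 2 `^ p * K1 `^ p.
pose C2 := 2 `^ p * (K2 `^ p * (1 + `|b - a|) `^ (p - 1)).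
have C10 : 0 <= C1 by rewrite mulr_ge0 ?powR_ge0.
have C20 : 0 <= C2 by rewrite !mulr_ge0 ?powR_ge0.
exists (C1 * M + C2 * (b - a)) => s sP.
have ab := itv_partition_le sP.
have key u v : a <= u -> u <= v -> v <= b ->
    `|h v - h u| `^ p <= C1 * `|g v - g u| `^ p + C2 * (v - u).
  move=> au uv vb; have vu0 : 0 <= v - u by lra.
  apply: (@le_trans _ _ ((K1 * `|g v - g u| + K2 * (v - u)) `^ p)).
    by apply: ge0_ler_powR => //; rewrite ?nnegrE ?addr_ge0 ?mulr_ge0//; exact: H.
  apply: le_trans (powRD_le _ _ _) _; rewrite ?mulr_ge0//.
  rewrite /C1 /C2 !powRM// -!mulrA -mulrDr ler_wpM2l ?powR_ge0// lerD2l.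
  rewrite ler_wpM2l ?powR_ge0//.
  rewrite -(mulr_powRB1 vu0); last lra.
  rewrite mulrC ler_wpM2r//; apply: ge0_ler_powR; rewrite ?nnegrE; try lra.
    by rewrite addr_ge0.
  by rewrite ger0_norm; lra.
have -> : b - a = \sum_(0 <= i < size s) (nth b (a :: s) i.+1 - nth b (a :: s) i).
  by rewrite telescope_sumr// (itv_partition_nth_size b sP).
apply: (@le_trans _ _ (C1 * (\sum_(0 <= i < size s)
      `|g (nth b (a :: s) i.+1) - g (nth b (a :: s) i)| `^ p) +
    C2 * \sum_(0 <= i < size s) (nth b (a :: s) i.+1 - nth b (a :: s) i)));
  last by rewrite lerD2r ler_wpM2l// HM.
rewrite !mulr_sumr -big_split/= big_nat_cond [leRHS]big_nat_cond.
apply: ler_sum => i; rewrite andbT => /andP[_ si].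
have [aa bb] : a <= nth b (a :: s) i /\ nth b (a :: s) i.+1 <= b.
  split.
    have : a \in [:: a] by rewrite inE.
    case: i si => // i si /= _.
    case: sP => /(order_path_min lt_trans)/all_nthP => /(_ b i (ltnW si)) /ltW + _.
    by [].
  have := sP; rewrite /itv_partition => -[].
  rewrite -{1}(cat_take_drop i.+1 s) cat_path => /andP[_ ps] /eqP lb.
  have : itv_partition (nth b s i) b (drop i.+1 s).
    split; first by move: ps; rewrite (take_nth b)// last_rcons.
    have := congr1 (last a) (cat_take_drop i.+1 s).
    by rewrite last_cat (take_nth b)// last_rcons lb => /eqP.
  exact: itv_partition_le.
apply: key => //.
by case: sP => /(pathP b)/(_ i si)/ltW.
Qed.

(** Inserting the tags as division points gives a subdivision again. A tag equal to an end of its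
    cell is dropped, since subdivisions are strict; its term vanishes because 0 to a positive power
    is 0. *)
Lemma p_variation_tagged p g a b : 0 < p -> (p_variation p g a b < +oo)%E ->
  exists M, forall dl tp, tpart dl a b tp ->
    tsum (fun u xi v => `|g v - g xi| `^ p + `|g xi - g u| `^ p) a tp <= M.
Proof.
move=> p0 /p_variation_boundP[M HM]; exists M => dl tp tpP.
suff [s sP <-] : exists2 s, itv_partition a b s & \sum_(0 <= i < size s)
   `|g (nth b (a :: s) i.+1) - g (nth b (a :: s) i)| `^ p =
   tsum (fun u xi v => `|g v - g xi| `^ p + `|g xi - g u| `^ p) a tp by exact: HM.
elim: tp a tpP {M HM} => [|[x0 x] tp IH] a /=.
  by move=> ->; exists [::]; [split|rewrite big_nil].
move=> [ax /andP[ax0 x0x] _ /IH[s [s1 s2] <-]].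
have z0 : `|0 : R| `^ p = 0 by rewrite normr0 powR0// gt_eqF.
move: ax0; rewrite le_eqVlt => /predU1P[<-|ax0].
  exists (x :: s); first by split => //=; rewrite ax.
  by rewrite big_nat_recl//= subrr z0 addr0.
move: x0x; rewrite le_eqVlt => /predU1P[->|x0x].
  exists (x :: s); first by split => //=; rewrite ax.
  by rewrite big_nat_recl//= subrr z0 add0r.
exists (x0 :: x :: s); first by split => //=; rewrite ax0 x0x.
by rewrite !big_nat_recl//= addrA (addrC (_ `^ _)).
Qed.

(** The terms of a fine tagged sum of squares are [p]-th powers times a positive
    power of the oscillation. *)
Lemma tagged_squares_small p g a b : 1 <= p < 2 -> continuous g ->
  (p_variation p g a b < +oo)%E ->
  forall eps, 0 < eps -> exists2 dl, 0 < dl & forall tp, tpart dl a b tp ->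
    tsum (fun u xi v => (g v - g xi) ^+ 2 + (g xi - g u) ^+ 2) a tp < eps.
Proof.
move=> /andP[p1 p2] cg /(p_variation_tagged (lt_le_trans ltr01 p1))[M HM] e e0.
have M0 : 0 < `|M| + 1 by rewrite ltr_wpDl.
have p20 : 0 < 2 - p by lra.
pose e' := e / (`|M| + 1).
have e'0 : 0 < e' by rewrite divr_gt0.
pose w := e' `^ (2 - p)^-1.
have w0 : 0 < w by rewrite powR_gt0.
have wE : w `^ (2 - p) = e' by rewrite -powRrM mulVf ?gt_eqF// powRr1// ltW.
have [dl dl0 H] := @continuous_uniform_itv R g a b w cg w0.
exists dl => // tp tpP.
apply: (@le_lt_trans _ _ (e' * M)); last first.
  rewrite (le_lt_trans (ler_wpM2l (ltW e'0) (ler_norm M)))// /e' mulrAC.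
  by rewrite ltr_pdivrMr//; nra.
apply: le_trans (ler_wpM2l (ltW e'0) (HM _ _ tpP)); rewrite tsumZ.
have sq x y : a <= x <= b -> a <= y <= b -> `|x - y| < dl ->
    (g x - g y) ^+ 2 <= e' * `|g x - g y| `^ p.
  move=> xab yab /(H _ _ xab yab) gxy.
  rewrite -real_normK ?num_real//; set z := `|g x - g y|.
  have [->|z0] := eqVneq z 0.
    by rewrite expr0n/= mulr_ge0 ?powR_ge0// ltW.
  have -> : z ^+ 2 = z `^ (2 - p) * z `^ p.
    rewrite -powRD; last by apply/implyP.
    by rewrite subrK powR_mulrn// normr_ge0.
  rewrite ler_wpM2r ?powR_ge0// -wE; apply: ge0_ler_powR; rewrite ?nnegrE ?normr_ge0//.
  - exact: ltW.
  - exact: ltW.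
  - exact: ltW.
apply: ler_tsum tpP _ => u xi v au uxi xiv vb vu.
rewrite mulrDr lerD//; apply: sq.
- by apply/andP; split; lra.
- by apply/andP; split; lra.
- by rewrite ger0_norm; lra.
- by apply/andP; split; lra.
- by apply/andP; split; lra.
- by rewrite ger0_norm; lra.
Qed.

(** Expanding [F] around the tag towards both ends of the cell leaves at most [K] times the two
    squared increments of [U], whose sums are small by [tagged_squares_small]. *)
Lemma RS_chain_rule p a b U (phi F : R -> R) K : 1 <= p < 2 -> 0 <= K ->
  continuous U -> (p_variation p U a b < +oo)%E ->
  (forall x y, a <= x <= b -> a <= y <= b ->
    `|F y - F x - phi x * (U y - U x)| <= K * (U y - U x) ^+ 2) ->
  forall eps, 0 < eps -> exists2 dl, 0 < dl & forall tp, tpart dl a b tp ->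
    tsum (fun u xi v => `|RS_term phi U u xi v - (F v - F u)|) a tp < eps.
Proof.
move=> p12 K0 cU pU HT e e0.
have K1 : 0 < K + 1 by lra.
have [|dl dl0 H] := tagged_squares_small p12 cU pU (_ : 0 < e / (K + 1)).
  by rewrite divr_gt0.
exists dl => // tp tpP; have := H _ tpP.
rewrite ltr_pdivlMr// mulrC tsumZ; apply: le_lt_trans.
apply: ler_tsum tpP _ => u xi v au uxi xiv vb vu.
rewrite /RS_term.
have uI : a <= u <= b by apply/andP; split; lra.
have xI : a <= xi <= b by apply/andP; split; lra.
have vI : a <= v <= b by apply/andP; split; lra.
have h1 := HT _ _ xI uI; have h2 := HT _ _ xI vI.
rewrite (_ : phi xi * (U v - U u) - (F v - F u) =
  (F u - F xi - phi xi * (U u - U xi)) - (F v - F xi - phi xi * (U v - U xi))).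
  apply: le_trans (ler_normB _ _) (le_trans (lerD h1 h2) _).
  rewrite -subr_ge0 (_ : _ - _ = (U v - U xi) ^+ 2 + (U xi - U u) ^+ 2).
    by rewrite addr_ge0 ?sqr_ge0.
  by ring.
by ring.
Qed.

(** The integrator [g] is only continuous. The cell error splits at the tag into increments of
    [G - k * g c], with [c] the end of the cell on that side. The derivative [dk r * (g r - g c)] of
    this function is small by uniform continuity, so the error is o(v - u). *)
Lemma is_RS_integral_by_parts (k dk g G : R -> R) a b : a <= b ->
  (forall x : R, is_derive x 1 k (dk x)) -> continuous dk -> continuous g ->
  (forall x : R, is_derive x 1 G (dk x * g x)) ->
  is_RS_integral k g a b ((k b * g b - G b) - (k a * g a - G a)).
Proof.
move=> ab dkP cdk cg dG.
apply: (@is_RS_integral_sew_lin R k g (fun x => k x * g x - G x)) => // e e0.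
have [M M0 HM] := continuous_bounded_itv a b cdk.
have [|dl dl0 H] := @continuous_uniform_itv R g a b (e / M) cg.
  by rewrite divr_gt0.
exists dl => // u xi v au uxi xiv vb vu; rewrite /RS_term.
have aux c x y : a <= x -> x <= y -> y <= b -> (c = u \/ c = v) ->
    u <= x -> y <= v ->
    `|(G y - k y * g c) - (G x - k x * g c)| <= e * (y - x).
  move=> ax xy yb cuv ux yv.
  apply: (@lipschitz_of_derive R (fun r => G r - k r * g c)
    (fun r => dk r * g r - dk r * g c)) => //.
    move=> r; have D := is_deriveB (dG r) (@is_deriveZ R R R k (g c) r 1 (dk r) (dkP r)).
    have -> : (fun r0 => G r0 - k r0 * g c) = G - g c \*: k.
      by apply/funext => z; rewrite mulrC.
    by apply: is_derive_eq; rewrite [g c *: _]mulrC.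
  move=> r /andP[xr ry]; rewrite -mulrBr normrM.
  have rI : a <= r <= b by apply/andP; split; lra.
  have cI : a <= c <= b by case: cuv => ->; apply/andP; split; lra.
  have := H r c rI cI; have -> : `|r - c| < dl.
    by rewrite ltr_norml; case: cuv => ->; apply/andP; split; lra.
  move=> /(_ isT)/ltW h; rewrite -[e](divfK (negbT (gt_eqF M0))) mulrC.
  by rewrite ler_pM//; exact: HM.
rewrite (_ : _ - _ = ((G v - k v * g v) - (G xi - k xi * g v)) +
   ((G xi - k xi * g u) - (G u - k u * g u))); last by ring.
apply: le_trans (ler_normD _ _) _.
have -> : e * (v - u) = e * (v - xi) + e * (xi - u) by ring.
by apply: lerD; apply: aux => //; lra.
Qed.

End p_variation.

(** * The Langevin equation *)

Section langevin.
Context {R : realType}.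
Implicit Types (f g h U V W G : R -> R) (a b c p lam : R).
Local Notation mu := (@lebesgue_measure R).

Lemma expR_derive c (x : R) : is_derive x 1 (fun y => expR (c * y)) (c * expR (c * x)).
Proof.
have D : is_derive x 1 (fun y : R => c * y) c.
  have := @is_deriveZ R R R id c x 1 1 (is_derive_id _ _).
  by rewrite [_ *: 1]mulr1.
have := @is_derive1_comp R expR (fun y => c * y) x _ _ (is_derive_expR _) D.
by rewrite mulrC.
Qed.

Lemma is_derive_mul f g (x df dg : R) : is_derive x 1 f df -> is_derive x 1 g dg ->
  is_derive x 1 (fun y => f y * g y) (f x * dg + df * g x).
Proof.
move=> hf hg; have := is_deriveM hf hg.
by rewrite [f x *: _]/(f x * dg) [g x *: _]/(g x * df) (mulrC df).
Qed.

Lemma derive0_constant f : (forall x : R, is_derive x 1 f 0) -> forall x y, f x = f y.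
Proof.
move=> H; suff W x y : x <= y -> f x = f y.
  by move=> x y; have [xy|/ltW xy] := leP x y; [exact: W|symmetry; exact: W].
move=> xy; have := @lipschitz_of_derive R f (fun=> 0) 0 x y H xy.
rewrite mul0r normr0 => /(_ (fun=> fun=> lexx _)).
by rewrite normr_le0 subr_eq0 => /eqP.
Qed.

(** This is the integrated equation, as [g] need not be differentiable. The additive constant of [V]
    is free, so for nonzero [lam] only the increments of [g] and [U] are constrained. *)
Definition langevin lam g U := exists V, forall t : R,
  is_derive t 1 V (U t) /\ U t = g t - lam * V t.

(** The difference of the two antiderivatives solves W' = -lam W, so exp(lam t) W is constant; the
    difference of the solutions is -lam W. *)
Lemma langevin_diff lam g U U' : langevin lam g U -> langevin lam g U' ->
  forall t, U t - U' t = expR (- lam * t) * (U 0 - U' 0).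
Proof.
move=> [V HV] [V' HV'] t.
pose D r := expR (lam * r) * (V r - V' r).
have D0 (r : R) : is_derive r 1 D 0.
  have [d1 e1] := HV r; have [d2 e2] := HV' r.
  have D' := is_derive_mul (expR_derive lam r) (is_deriveB d1 d2).
  by apply: (is_derive_eq D'); rewrite e1 e2 !fctE; ring.
have := derive0_constant D0 t 0.
rewrite /D mulr0 expR0 mul1r => Dt.
have [_ ->] := HV t; have [_ ->] := HV' t; have [_ ->] := HV 0; have [_ ->] := HV' 0.
have e : expR (- lam * t) * expR (lam * t) = 1 by rewrite -expRD mulNr addNr expR0.
transitivity (- lam * (expR (- lam * t) * expR (lam * t)) * (V t - V' t)); first by rewrite e; ring.
have -> : V 0 = expR (lam * t) * (V t - V' t) + V' 0 by rewrite Dt; ring.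
by ring.
Qed.

Lemma langevin_continuous lam g U : continuous g -> langevin lam g U -> continuous U.
Proof.
move=> cg [V HV].
have cV : continuous V by apply: (@is_derive_continuous R V U) => x; case: (HV x).
have -> : U = fun t => g t - lam * V t by apply/funext => t; case: (HV t).
move=> t; apply: cvgB; first exact: cg.
by apply: cvgMl_tmp; exact: cV.
Qed.

(** On the negative half-line the derivative of [G] is dominated by that of
    [E x = (2 K / lam) exp(lam x / 2)], so increments of [G] are dominated by those of [E]. Thus
    [E + G] is nondecreasing and bounded below, hence converges to its infimum, while [E] tends to
    0. *)
Lemma exp_growth_antiderivative lam K g G : 0 < lam ->
  (forall x : R, is_derive x 1 G (expR (lam * x) * g x)) ->
  (forall x, x <= 0 -> `|g x| <= K * expR (- (lam / 2) * x)) ->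
  exists l : R, G x @[x --> -oo] --> l.
Proof.
move=> lam0 dG gK.
have K0 : 0 <= K by have := gK 0 (lexx _); rewrite mulr0 expR0 mulr1; exact: le_trans.
pose C := 2 * K / lam.
have C0 : 0 <= C by rewrite /C divr_ge0 ?mulr_ge0// ltW.
have CE : C * (lam / 2) = K by rewrite /C; field; rewrite gt_eqF.
pose E x := C * expR (lam / 2 * x).
have E0 x : 0 <= E x by rewrite mulr_ge0// expR_ge0.
have inc x y : x <= y -> y <= 0 -> `|G y - G x| <= E y - E x.
  move=> xy y0.
  have dE (s r : R) : is_derive r 1 (fun r => E r + s * G r)
      (K * expR (lam / 2 * r) + s * (expR (lam * r) * g r)).
    have D' := is_deriveD (is_deriveZ C (expR_derive (lam / 2) r)) (is_deriveZ s (dG r)).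
  apply: (is_derive_eq D').
    by rewrite -CE -(mulrA C).
  have mon s : `|s| = 1 -> E x + s * G x <= E y + s * G y.
    move=> s1.
    have [c cxy] := @MVT_segment R _ _ x y xy (fun r _ => dE s r)
      (continuous_subspaceT (is_derive_continuous (dE s))).
    move=> eq; rewrite -subr_ge0 eq mulr_ge0 ?subr_ge0//.
    have c0 : c <= 0 by move: cxy; rewrite in_itv/= => /andP[_ cy]; exact: le_trans y0.
    suff : `|s * (expR (lam * c) * g c)| <= K * expR (lam / 2 * c).
      by rewrite ler_norml => /andP[h _]; lra.
    rewrite normrM s1 mul1r normrM (ger0_norm (expR_ge0 _)).
    apply: le_trans (ler_wpM2l (expR_ge0 _) (gK c c0)) _.
    rewrite mulrCA -expRD (_ : _ + _ = lam / 2 * c)//; lra.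
  have := mon 1 (normr1 _); have := mon (-1); rewrite normrN normr1 => /(_ erefl).
  by move=> h1 h2; rewrite ler_norml; apply/andP; split; lra.
pose S := [set E x + G x | x in [set x | x <= 0]].
have lbS : has_inf S.
  split; first by exists (E 0 + G 0), 0 => //=.
  exists (G 0 - E 0) => _ [x /= x0 <-].
  have := inc x 0 x0 (lexx _); rewrite ler_norml => /andP[h1 h2].
  have := E0 x; lra.
have cE : E x @[x --> -oo] --> (0 : R).
  rewrite -[X in _ --> X](mulr0 C).
  apply: cvgMl_tmp.
  apply/cvgNy_compNP.
  have -> : (fun x => expR (lam / 2 * x)) \o -%R = fun x => expR (- (lam / 2 * x)).
    by apply/funext => x /=; rewrite mulrN.
  apply: (@cvg_comp _ _ _ (fun x => lam / 2 * x) (fun x => expR (- x)) _ (pinfty_nbhs R)).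
    by apply: gt0_cvgMry; first by rewrite divr_gt0.
  exact: (@cvgr_expR R).
exists (inf S).
suff H : (E x + G x) @[x --> -oo] --> inf S.
  have H' := cvgB H cE; rewrite subr0 in H'.
  have -> : G = (fun x => E x + G x) - E by apply/funext => x; rewrite !fctE addrAC subrr add0r.
  exact: H'.
apply/cvgrPdist_le => e e0.
have [_ [x0 /= x00 <-] hx0] := inf_adherent e0 lbS.
near=> x.
have xx0 : x <= x0 by near: x; apply: nbhs_ninfty_le; rewrite num_real.
have x_0 : x <= 0 by exact: le_trans x00.
have : inf S <= E x + G x by apply: ge_inf => //; [case: lbS|exists x].
have := inc x x0 xx0 x00; rewrite ler_norml => /andP[h1 h2] h3.
by rewrite ler_norml; apply/andP; split; lra.
Unshelve. all: by end_near. Qed.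

Lemma exp_growth_vanish lam K g : 0 < lam ->
  (forall x, x <= 0 -> `|g x| <= K * expR (- (lam / 2) * x)) ->
  (expR (lam * x) * g x) @[x --> -oo] --> (0 : R).
Proof.
move=> lam0 gK.
have c0 : K * expR (lam / 2 * x) @[x --> -oo] --> (0 : R).
  rewrite -[X in _ --> X](mulr0 K).
  apply: cvgMl_tmp.
  apply/cvgNy_compNP.
  have -> : (fun x => expR (lam / 2 * x)) \o -%R = fun x => expR (- (lam / 2 * x)).
    by apply/funext => x /=; rewrite mulrN.
  apply: (@cvg_comp _ _ _ (fun x => lam / 2 * x) (fun x => expR (- x)) _ (pinfty_nbhs R)).
    by apply: gt0_cvgMry; first by rewrite divr_gt0.
  exact: (@cvgr_expR R).
apply: norm_cvg0.
apply: (@squeeze_cvgr _ _ _ _ (fun=> 0) (fun x => K * expR (lam / 2 * x))) => //.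
  near=> x.
  have x0 : x <= 0 by near: x; apply: nbhs_ninfty_le; rewrite num_real.
  rewrite normr_ge0/= normrM (ger0_norm (expR_ge0 _)).
  apply: le_trans (ler_wpM2l (expR_ge0 _) (gK x x0)) _.
  rewrite mulrCA -expRD (_ : _ + _ = lam / 2 * x)//; lra.
exact: cvg_cst.
Unshelve. all: by end_near. Qed.

(** Integration by parts in a form where [a] occurs only in the last bracket, which has a limit as
    [a] tends to minus infinity. *)
Lemma is_RS_integral_exp lam g G a t : a <= t -> continuous g ->
  (forall x : R, is_derive x 1 G (expR (lam * x) * g x)) ->
  is_RS_integral (fun s => expR (- lam * (t - s))) g a t
    ((g t - lam * expR (- lam * t) * G t) -
     expR (- lam * t) * (expR (lam * a) * g a - lam * G a)).
Proof.
move=> at_ cg dG.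
have kE s : expR (- lam * (t - s)) = expR (- lam * t) * expR (lam * s).
  by rewrite -expRD; congr expR; ring.
have cexp : continuous (fun x : R => expR (lam * x)).
  exact: is_derive_continuous (expR_derive lam).
have -> : (fun s => expR (- lam * (t - s))) =
    (fun s => expR (- lam * t) * expR (lam * s)) by apply/funext.
have -> : g t - lam * expR (- lam * t) * G t -
    expR (- lam * t) * (expR (lam * a) * g a - lam * G a) =
  (expR (- lam * t) * expR (lam * t) * g t - expR (- lam * t) * lam * G t) -
  (expR (- lam * t) * expR (lam * a) * g a - expR (- lam * t) * lam * G a) :> R.
  by rewrite -(kE t) subrr mulr0 expR0; ring.
apply: (@is_RS_integral_by_parts R _ (fun s => expR (- lam * t) * (lam * expR (lam * s)))
  g (fun s => expR (- lam * t) * lam * G s)) => //.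
- move=> x; exact: (is_deriveZ _ (expR_derive lam x)).
- move=> x; apply: cvgMl_tmp; apply: cvgMl_tmp; exact: cexp.
- move=> x; have D' := is_deriveZ (expR (- lam * t) * lam) (dG x).
  apply: (is_derive_eq D').
  rewrite -[LHS]/(expR (- lam * t) * lam * (expR (lam * x) * g x)).
  by rewrite !mulrA.
Qed.

Lemma langevin_exp_growth lam K g : 0 < lam -> continuous g ->
  (forall x, x <= 0 -> `|g x| <= K * expR (- (lam / 2) * x)) ->
  exists2 U, langevin lam g U & forall t,
    RS_integral (fun s => expR (- lam * (t - s))) g a t @[a --> -oo] --> U t.
Proof.
move=> lam0 cg gK.
have cexp : continuous (fun x : R => expR (lam * x)).
  exact: is_derive_continuous (expR_derive lam).
have [G dG] : exists G : R -> R, forall x : R, is_derive x 1 G (expR (lam * x) * g x).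
  by apply: continuous_antiderivative => x; apply: cvgM; [exact: cexp|exact: cg].
have [l Gl] := exp_growth_antiderivative lam0 dG gK.
(* This is the integral of exp(-lam (t - s)) g(s) ds over s < t, the limit [l] of [G] normalising
   the antiderivative at minus infinity. *)
pose V t := expR (- lam * t) * (G t - l).
exists (fun t => g t - lam * V t).
  exists V => t; split => //.
  have D' := is_derive_mul (expR_derive (- lam) t) (is_deriveB (dG t) (is_derive_cst l t 1)).
  apply: (is_derive_eq D'); rewrite /V subr0 mulrA -expRD mulNr addNr expR0 /= mulNr.
  by rewrite !fctE /cst; ring.
move=> t.
have -> : g t - lam * V t = (g t - lam * expR (- lam * t) * G t) -
  expR (- lam * t) * (0 - lam * l) by rewrite /V; ring.
have H : (g t - lam * expR (- lam * t) * G t) -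
  expR (- lam * t) * (expR (lam * a) * g a - lam * G a) @[a --> -oo] -->
  (g t - lam * expR (- lam * t) * G t) - expR (- lam * t) * (0 - lam * l).
  apply: cvgB; first exact: cvg_cst.
  apply: cvgMl_tmp; apply: cvgB; first exact: (exp_growth_vanish lam0 gK).
  exact: cvgMl_tmp.
apply: cvg_trans H; apply: near_eq_cvg; near=> a.
rewrite (RS_integralE (@is_RS_integral_exp lam g G _ _ _ _ _))//.
Unshelve. all: by end_near. Qed.

Lemma RS_integrable_exp lam g a t : a <= t -> continuous g ->
  RS_integrable (fun s => expR (- lam * (t - s))) g a t.
Proof.
move=> at_ cg; have [G dG] : exists G : R -> R, forall x : R,
    is_derive x 1 G (expR (lam * x) * g x).
  apply: continuous_antiderivative => x; apply: cvgM; last exact: cg.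
  exact: (is_derive_continuous (expR_derive lam)).
by eexists; exact: is_RS_integral_exp.
Qed.

End langevin.

(** * Passing between the Langevin equation and the SDE *)

Section sde.
Context {R : realType}.
Implicit Types (f df g h U V W A phi w sg m : R -> R) (a b c p lam : R).
Local Notation mu := (@lebesgue_measure R).

Definition locally_lipschitz f := forall M, exists2 K, 0 <= K &
  forall x y, `|x| <= M -> `|y| <= M -> `|f y - f x| <= K * `|y - x|.

Lemma locally_lipschitz_continuous f : locally_lipschitz f -> continuous f.
Proof.
move=> lf x; have [K K0 HK] := lf (`|x| + 1).
apply/cvgrPdist_lt => e e0.
have eK : 0 < e / (K + 1) by rewrite divr_gt0// ltr_wpDl.
near=> y.
have yx : `|x - y| < 1 by near: y; exact: (@nbhsx_ballx R R x 1 ltr01).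
have ye : `|x - y| < e / (K + 1).
  by near: y; exact: (@nbhsx_ballx R R x _ eK).
have y1 : `|y| <= `|x| + 1.
  by rewrite -(subrK x y) addrC (le_trans (ler_normD _ _))// lerD2l distrC ltW.
rewrite distrC; apply: le_lt_trans (HK x y _ _) _ => //; first by rewrite lerDl.
rewrite distrC; move: ye; rewrite ltr_pdivlMr ?ltr_wpDl// => ye.
by have := normr_ge0 (x - y); nra.
Unshelve. all: by end_near. Qed.

Lemma taylor_locally_lipschitz f df : (forall x : R, is_derive x 1 f (df x)) ->
  locally_lipschitz df -> forall M, exists2 K, 0 <= K &
  forall x y, `|x| <= M -> `|y| <= M ->
    `|f y - f x - df x * (y - x)| <= K * (y - x) ^+ 2.
Proof.
move=> dfP ldf M; have [K K0 HK] := ldf M; exists K => // x y xM yM.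
have dT (r : R) : is_derive r 1 (fun r => f r - df x * r) (df r - df x).
  have D := is_deriveB (dfP r) (@is_deriveZ R R R id (df x) r 1 1 (is_derive_id _ _)).
  by apply: (is_derive_eq D); rewrite [_ *: 1]mulr1.
have between u v r : `|u| <= M -> `|v| <= M -> u <= r <= v -> `|r| <= M.
  rewrite !ler_norml => /andP[u1 u2] /andP[v1 v2] /andP[r1 r2].
  by apply/andP; split; lra.
rewrite (_ : _ - _ = (f y - df x * y) - (f x - df x * x)); last by ring.
have [xy|/ltW yx] := leP x y.
  rewrite expr2 mulrA; apply: (lipschitz_of_derive dT) => // r rI.
  rewrite (le_trans (HK x r _ (between _ _ _ xM yM rI)))// ler_wpM2l//.
  by move: rI => /andP[h1 h2]; rewrite ger0_norm; lra.
rewrite distrC (_ : (y - x) ^+ 2 = (x - y) * (x - y)); last by ring.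
rewrite mulrA; apply: (lipschitz_of_derive dT) => // r rI.
rewrite (le_trans (HK x r _ (between _ _ _ yM xM rI)))// ler_wpM2l//.
by move: rI => /andP[h1 h2]; rewrite distrC ger0_norm; lra.
Qed.

Lemma lipschitz_on_of_derive f df M : (forall x : R, is_derive x 1 f (df x)) ->
  continuous df -> exists2 K, 0 <= K & forall x y, `|x| <= M -> `|y| <= M ->
    `|f y - f x| <= K * `|y - x|.
Proof.
move=> dfP cdf; have [K K0 HK] := continuous_bounded_itv (- M) M cdf.
exists K => [|x y]; first exact: ltW.
wlog xy : x y / x <= y.
  move=> W xM yM; have [xy|/ltW yx] := leP x y; first exact: W.
  by rewrite (distrC (f y)) (distrC y); exact: W.
move=> /ler_normlP[x1 x2] /ler_normlP[y1 y2].
rewrite (ger0_norm (_ : 0 <= y - x)) ?subr_ge0//.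
apply: (lipschitz_of_derive dfP xy) => r /andP[r1 r2]; apply: HK.
by apply/andP; split; lra.
Qed.

Lemma tsum_lin_small (q : R -> R -> R -> R) a b : a <= b ->
  (forall eps, 0 < eps -> exists2 dl, 0 < dl &
    forall u xi v, a <= u -> u <= xi -> xi <= v -> v <= b -> v - u < dl ->
     `|q u xi v| <= eps * (v - u)) ->
  forall eps, 0 < eps -> exists2 dl, 0 < dl &
    forall tp, tpart dl a b tp -> tsum (fun u xi v => `|q u xi v|) a tp < eps.
Proof.
move=> ab H e e0.
have ba : 0 < b - a + 1 by lra.
have [|dl dl0 K] := H (e / (b - a + 1)); first by rewrite divr_gt0.
exists dl => // tp tpP.
have L := ler_tsum tpP K; apply: le_lt_trans L _.
rewrite -tsumZ (tsum_telescope id tpP) /= mulrAC ltr_pdivrMr//; nra.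
Qed.

(** Handles the absolutely continuous part of the integrator: within a fine cell the factor [phi]
    may be frozen at the tag, by uniform continuity. *)
Lemma frozen_factor_small phi w V A a b : a <= b -> continuous phi ->
  continuous w -> (forall r : R, is_derive r 1 V (w r)) ->
  (forall r : R, is_derive r 1 A (phi r * w r)) ->
  forall eps, 0 < eps -> exists2 dl, 0 < dl & forall tp, tpart dl a b tp ->
    tsum (fun u xi v => `|phi xi * (V v - V u) - (A v - A u)|) a tp < eps.
Proof.
move=> ab cphi cw dV dA; apply: tsum_lin_small => // e e0.
have [M M0 HM] := continuous_bounded_itv a b cw.
have [|dl dl0 H] := @continuous_uniform_itv R phi a b (e / M) cphi.
  by rewrite divr_gt0.
exists dl => // u xi v au uxi xiv vb vu.
rewrite (_ : _ - _ = (phi xi * V v - A v) - (phi xi * V u - A u)); last by ring.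
have dD (r : R) : is_derive r 1 (fun r => phi xi * V r - A r)
    (phi xi * w r - phi r * w r).
  exact: (is_deriveB (is_deriveZ (phi xi) (dV r)) (dA r)).
apply: (lipschitz_of_derive dD); first exact: le_trans xiv.
move=> r /andP[ur rv]; rewrite -mulrBl normrM.
have rI : a <= r <= b by apply/andP; split; lra.
have xI : a <= xi <= b by apply/andP; split; lra.
have := H _ _ xI rI; have -> : `|xi - r| < dl.
  by rewrite ltr_norml; apply/andP; split; lra.
move=> /(_ isT)/ltW h; rewrite -[e](divfK (negbT (gt_eqF M0))).
by rewrite ler_pM//; exact: HM.
Qed.

Lemma langevin_to_sde p lam g U f sg m : 1 <= p < 2 -> W_con p g -> langevin lam g U ->
  continuous g ->
  (forall x : R, is_derive x 1 f (sg (f x))) ->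
  locally_lipschitz (fun x => sg (f x)) ->
  (forall x, m (f x) = - lam * x * sg (f x)) ->
  W_con p (f \o U) /\
  forall s t, s <= t -> is_RS_integral (fun r => sg (f (U r))) g s t
   (f (U t) - f (U s) - Rintegral mu `[s, t] (fun r => m (f (U r)))).
Proof.
move=> p12 [_ pg] LU cg df lsg mE.
have cU := langevin_continuous cg LU.
have [V HV] := LU.
have csg := locally_lipschitz_continuous lsg.
have cf := is_derive_continuous df.
have cfU : continuous (f \o U) by move=> x; exact: (continuous_comp (cU x) (cf _)).
have csU : continuous (fun r => sg (f (U r))).
  by move=> x; exact: (continuous_comp (cU x) (csg _)).
(* [U] inherits finite p-variation from [g], since [V] is Lipschitz on compact intervals. *)
have pU s t : s <= t -> (p_variation p U s t < +oo)%E.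
  move=> st; have [M M0 HM] := continuous_bounded_itv s t cU.
  apply: (@p_variation_dominated R p g U s t 1 (`|lam| * M)) => //.
  - by case/andP: p12.
  - by rewrite mulr_ge0// ltW.
  - move=> u v su uv vt.
    have [_ ->] := HV v; have [_ ->] := HV u.
    rewrite (_ : _ - _ = (g v - g u) - lam * (V v - V u)); last by ring.
    rewrite mul1r (le_trans (ler_normB _ _))// lerD2l normrM -mulrA ler_wpM2l//.
    apply: (@lipschitz_of_derive R V U) => //; first by move=> x; case: (HV x).
    by move=> x /andP[ux xv]; apply: HM; apply/andP; split; lra.
  - exact: pg.
split.
  split => // s t st; have [M M0 HM] := continuous_bounded_itv s t cU.
  have [K K0 HK] := lipschitz_on_of_derive M df csg.
  apply: (@p_variation_dominated R p U (f \o U) s t K 0) => //.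
  - by case/andP: p12.
  - move=> u v su uv vt; rewrite mul0r addr0.
    by apply: HK; apply: HM; apply/andP; split; lra.
  - exact: pU.
move=> s t st.
have cm : continuous (fun r => m (f (U r))).
  have -> : (fun r => m (f (U r))) = (fun r => sg (f (U r)) * (- lam * U r)).
    by apply/funext => r; rewrite mE; ring.
  move=> r; apply: cvgM; first exact: csU.
  by apply: cvgMl_tmp; exact: cU.
have [A dA] := continuous_antiderivative cm.
rewrite (Rintegral_derive cm dA st).
have -> : f (U t) - f (U s) - (A t - A s) = (f (U t) - A t) - (f (U s) - A s) by ring.
apply: (@is_RS_integral_sew R _ g (fun r => f (U r) - A r)) => // e e0.
have e20 : 0 < e / 2 by lra.
have [M M0 HM] := continuous_bounded_itv s t cU.
have [K K0 HK] := taylor_locally_lipschitz df lsg M.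
have [|d1 d10 H1] := @RS_chain_rule R p s t U (fun r => sg (f (U r))) (fun r => f (U r))
  K p12 K0 cU (pU s t st) _ _ e20.
  by move=> x y xI yI; apply: HK; exact: HM.
have cw : continuous (fun r => - lam * U r) by move=> r; apply: cvgMl_tmp; exact: cU.
have [||d2 d20 H2] := @frozen_factor_small (fun r => sg (f (U r))) (fun r => - lam * U r)
  (fun r => - lam * V r) A s t st csU cw _ _ _ e20.
- by move=> r; have [h _] := HV r; exact: (is_deriveZ (- lam) h).
- by move=> r; have := dA r; rewrite mE mulrC.
exists (Num.min d1 d2); first by rewrite lt_min d10.
move=> tp tpP.
have l1 : Num.min d1 d2 <= d1 by rewrite ge_min lexx.
have l2 : Num.min d1 d2 <= d2 by rewrite ge_min lexx orbT.
have := H1 _ (tpart_mono l1 tpP); have := H2 _ (tpart_mono l2 tpP).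
move=> h2 h1; apply: le_lt_trans (_ : _ < e); last first.
  have := ltrD h1 h2; rewrite -splitr; exact.
rewrite tsumD.
apply: ler_tsum tpP _ => u xi v *; rewrite /RS_term.
have gE r : g r = U r + lam * V r by have [_ ->] := HV r; ring.
rewrite !gE; apply: le_trans (ler_normB _ _).
by rewrite le_eqVlt; apply/orP; left; apply/eqP; congr (`|_|); ring.
Qed.

(** With [Y = f (h t)], the SDE is multiplied cell by cell by [1 / sg Y] at the tag. The increment
    of [Y] becomes that of [h] by the chain rule, the drift becomes that of [- lam Vh] by freezing,
    and Saks-Henstock bounds what is lost on the integral against [g]. Each of the three errors gets
    a third of [e]. *)
Lemma sde_to_langevin p lam g h f sg m : 1 <= p < 2 -> 0 < lam ->
  continuous g -> continuous h -> locally_bounded_p_variation p (f \o h) ->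
  (forall x : R, is_derive x 1 f (sg (f x))) ->
  locally_lipschitz (fun x => sg (f x)) ->
  (forall x, sg (f x) != 0) ->
  (forall x, m (f x) = - lam * x * sg (f x)) ->
  (forall s t, s <= t -> RS_integrable (fun r => sg (f (h r))) g s t /\
     f (h t) - f (h s) = Rintegral mu `[s, t] (fun r => m (f (h r))) +
       RS_integral (fun r => sg (f (h r))) g s t) ->
  langevin lam g h.
Proof.
move=> p12 lam0 cg ch pY df lsg sg0 mE sol.
have csg := locally_lipschitz_continuous lsg.
have cf := is_derive_continuous df.
have cY : continuous (f \o h) by move=> x; exact: (continuous_comp (ch x) (cf _)).
have cish : continuous (fun x => (sg (f x))^-1) by move=> x; apply: cvgV => //; exact: csg.
have cphi : continuous (fun r => (sg (f (h r)))^-1).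
  by move=> x; exact: (continuous_comp (ch x) (cish _)).
have csh : continuous (fun r => sg (f (h r))).
  by move=> x; exact: (continuous_comp (ch x) (csg _)).
have cm : continuous (fun r => m (f (h r))).
  have -> : (fun r => m (f (h r))) = (fun r => sg (f (h r)) * (- lam * h r)).
    by apply/funext => r; rewrite mE; ring.
  move=> r; apply: cvgM; first exact: csh.
  by apply: cvgMl_tmp; exact: ch.
have [A dA] := continuous_antiderivative cm.
have [Vh dV] := continuous_antiderivative ch.
(* The value that the SDE forces on the integral against [g] over [u, v]. *)
pose J u v := f (h v) - f (h u) - (A v - A u).
have HJ u v : u <= v -> is_RS_integral (fun r => sg (f (h r))) g u v (J u v).
  move=> uv; have [[z hz] eq] := sol u v uv.
  rewrite (_ : J u v = z)//; move: eq.
  by rewrite /J (RS_integralE hz) (Rintegral_derive cm dA uv) => ->; ring.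
(* [F] being constant is the Langevin equation for [h]; its value only shifts the antiderivative
   [Vh]. *)
pose F r := h r - g r + lam * Vh r.
suff Fc s t : s <= t -> F t = F s.
  have F0 t : F t = F 0 by have [/Fc//|/ltW/Fc] := leP 0 t.
  exists (fun t => Vh t - F 0 / lam) => t; split.
    have D := is_deriveB (dV t) (is_derive_cst (F 0 / lam) t 1).
    by apply: (is_derive_eq D); rewrite subr0.
  by rewrite -(F0 t) /F; field; rewrite gt_eqF.
move=> st; apply/eqP; rewrite -subr_eq0 -normr_le0; apply/ler_addgt0Pl => e e0.
rewrite addr0.
have e30 : 0 < e / 3 by lra.
have [M M0 HM] := continuous_bounded_itv s t ch.
have [B B0 HB] := continuous_bounded_itv (- M) M cish.
have [K K0 HK] := taylor_locally_lipschitz df lsg M.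
have hI r : s <= r <= t -> - M <= h r <= M by move=> /HM; rewrite ler_norml.
have KB0 : 0 <= K * B ^+ 3 by rewrite mulr_ge0// exprn_ge0// ltW.
(* The inverse of [f] is Lipschitz on the range in question, by the mean value theorem and the bound
   [B] on [1 / f']. No inverse function has to be differentiated. *)
have lower x y : - M <= x <= M -> - M <= y <= M -> `|y - x| <= B * `|f y - f x|.
  wlog xy : x y / x <= y.
    move=> W xM yM; have [xy|/ltW yx] := leP x y; first exact: W.
    by rewrite distrC (distrC (f y)); exact: W.
  move=> /andP[x1 x2] /andP[y1 y2].
  have [c] := @MVT_segment R f _ x y xy (fun r _ => df r) (continuous_subspaceT cf).
  rewrite in_itv/= => /andP[xc cy] ->.
  have cM : - M <= c <= M by apply/andP; split; lra.
  rewrite normrM mulrA ler_peMl//.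
  have <- : `|(sg (f c))^-1| * `|sg (f c)| = 1 by rewrite -normrM mulVf// normr1.
  by apply: ler_wpM2r => //; exact: HB.
(* The chain rule for [h] as a function of [Y]: dividing the Taylor remainder of [f] by [f'] costs
   one factor [B], and expressing the squared increment of [h] by that of [Y] costs two more. *)
have [|d1 d10 H1] := @RS_chain_rule R p s t (f \o h) (fun r => (sg (f (h r)))^-1) h
  _ p12 KB0 cY (pY s t st) _ _ e30.
  move=> x y xst yst /=.
  have T := HK _ _ (HM x xst) (HM y yst).
  have L := lower _ _ (hI x xst) (hI y yst).
  rewrite (_ : _ - _ = - ((sg (f (h x)))^-1 *
     (f (h y) - f (h x) - sg (f (h x)) * (h y - h x)))); last first.
    by field; exact: sg0.
  rewrite normrN normrM.
  apply: le_trans (_ : B * (K * (h y - h x) ^+ 2) <= _).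
    by apply: ler_pM => //; apply: HB; exact: hI.
  rewrite (_ : K * B ^+ 3 * _ = B * (K * (B * (f (h y) - f (h x))) ^+ 2)); last by ring.
  rewrite ler_pM2l// ler_wpM2l// -(real_normK (num_real (h y - h x))).
  rewrite -(real_normK (num_real (B * _))) normrM (gtr0_norm B0).
  by rewrite ler_pXn2r ?nnegrE// ?mulr_ge0 ?(ltW B0).
have [|d2 d20 H2] := @frozen_factor_small (fun r => (sg (f (h r)))^-1)
  (fun r => m (f (h r))) A (fun r => - lam * Vh r) s t st cphi cm dA _ _ e30.
  move=> r; apply: (is_derive_eq (is_deriveZ (- lam) (dV r))).
  by rewrite mE -[LHS]/(- lam * h r); field; exact: sg0.
have [N N0 HN] := continuous_bounded_itv s t cphi.
have [||d3 d30 H3] := @saks_henstock R (fun r => sg (f (h r))) g J s t st _ (e / 3 / N).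
- by move=> u v _ uv _; exact: HJ.
- by rewrite divr_gt0.
have dm : 0 < Num.min d1 (Num.min d2 d3) by rewrite !lt_min d10 d20.
have [tp tpP] := tpart_exists st dm.
have l1 : Num.min d1 (Num.min d2 d3) <= d1 by rewrite ge_min lexx.
have l2 : Num.min d1 (Num.min d2 d3) <= d2 by rewrite !ge_min lexx orbT.
have l3 : Num.min d1 (Num.min d2 d3) <= d3 by rewrite !ge_min lexx !orbT.
have h1 := H1 _ (tpart_mono l1 tpP); have h2 := H2 _ (tpart_mono l2 tpP).
have := H3 _ (tpart_mono l3 tpP); rewrite ltr_pdivlMr// mulrC => h3.
rewrite -(tsum_telescope F tpP) (le_trans (ler_norm_tsum _ _ _))//.
have hh := ltrD h1 (ltrD h3 h2).
apply: ltW; have -> : e = e / 3 + (e / 3 + e / 3) by lra.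
apply: le_lt_trans hh; rewrite tsumZ !tsumD.
apply: ler_tsum tpP _ => u xi v su uxi xiv vt *; rewrite /RS_term.
have xI : s <= xi <= t by apply/andP; split; lra.
have x0 := sg0 (h xi).
apply: (@le_trans _ _ (`|(sg (f (h xi)))^-1 * ((f \o h) v - (f \o h) u) - (h v - h u)| +
  (`|(sg (f (h xi)))^-1 * (sg (f (h xi)) * (g v - g u) - J u v)| +
   `|(sg (f (h xi)))^-1 * (A v - A u) - (- lam * Vh v - - lam * Vh u)|))); last first.
  by rewrite lerD2l lerD2r normrM ler_wpM2r// HN.
rewrite -[X in _ <= X + _]normrN -[X in _ <= _ + (X + _)]normrN.
apply: le_trans (lerD (lexx _) (ler_normD _ _)).
apply: le_trans (ler_normD _ _).
rewrite le_eqVlt; apply/orP; left; apply/eqP; congr (`|_|).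
by rewrite /J /F /=; field.
Qed.

End sde.

(** * Strongly proper triples *)

Section proper_triples.
Context {R : realType}.
Implicit Types (x y z : R).
Local Notation leb := (@lebesgue_measure R).

Lemma open_interval_nbhs (a b : \bar R) x : open_interval a b x ->
  exists2 e : R, 0 < e & forall z, `|x - z| < e -> open_interval a b z.
Proof.
move=> [ax xb].
have [e1 e10 H1] : exists2 e : R, 0 < e & forall z, `|x - z| < e -> (a < z%:E)%E.
  case: a ax => [r| |] //= ax.
    exists (x - r); first by rewrite subr_gt0 -lte_fin.
    by move=> z /ltr_normlP[h1 h2]; rewrite lte_fin; lra.
  by exists 1 => // z _; rewrite ltNyr.
have [e2 e20 H2] : exists2 e : R, 0 < e & forall z, `|x - z| < e -> (z%:E < b)%E.
  case: b xb => [r| |] //= xb.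
    exists (r - x); first by rewrite subr_gt0 -lte_fin.
    by move=> z /ltr_normlP[h1 h2]; rewrite lte_fin; lra.
  by exists 1 => // z _; rewrite ltry.
exists (Num.min e1 e2); first by rewrite lt_min e10.
by move=> z; rewrite lt_min => /andP[/H1 ? /H2 ?].
Qed.

(** A set of full measure is dense. *)
Lemma ae_eq0_continuous (a b : \bar R) (q : R -> R) x0 :
  {ae leb, forall x, open_interval a b x -> q x = 0} ->
  open_interval a b x0 -> q x @[x --> x0] --> q x0 -> q x0 = 0.
Proof.
move=> [N [mN N0 sN]] Ix0 cq; apply/eqP/negPn/negP => q0.
have [e e0 He] := open_interval_nbhs Ix0.
have q00 : 0 < `|q x0| by rewrite normr_gt0.
move/cvgrPdist_lt : cq => /(_ _ q00)[d /= d0 Hd].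
have sub : ball x0 (Num.min e d) `<=` N.
  move=> z; rewrite /ball /= lt_min => /andP[ze zd]; apply: sN => /= H.
  have := Hd z zd; rewrite H ?subr0 ?ltxx//; exact: He.
have md : 0 < Num.min e d by rewrite lt_min e0.
have : (leb (ball x0 (Num.min e d)) <= 0)%E.
  by rewrite -N0; apply: le_measure => //; rewrite inE//; exact: measurable_ball.
by rewrite lebesgue_measure_ball ?(ltW md)// lee_fin leNgt mulrn_wgt0.
Qed.

Section fixed_triple.
Variables (a b : \bar R) (mu sigma psi phi : R -> R) (lam : R).
Hypothesis hsp : strongly_proper a b mu sigma psi phi lam.
Let f := state_space_transform phi lam.

Lemma strongly_proper_psi_continuous x : open_interval a b x ->
  psi z @[z --> x] --> psi x.
Proof.
move=> Ix; have [e e0 He] := open_interval_nbhs Ix.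
have I1 : open_interval a b (x - e / 2).
  by apply: He; rewrite opprB addrCA subrr addr0 gtr0_norm; lra.
have I2 : open_interval a b (x + e / 2).
  by apply: He; rewrite opprD addNKr normrN gtr0_norm; lra.
apply/cvgrPdist_lt => t t0.
have [|d d0 Hd] := sp_psi_abs_continuous hsp I1 I2 _ t0; first by lra.
near=> z.
have ze : `|x - z| < e / 2.
  by near: z; apply: (@nbhsx_ballx R R x); rewrite divr_gt0.
have zd : `|x - z| < d by near: z; exact: (@nbhsx_ballx R R x).
have := Hd 1%N (fun=> Num.min x z) (fun=> Num.max x z).
rewrite !big_ord1; have [xz|zx] := leP x z.
  rewrite distrC => H; apply: H.
  - by move=> _; move/ltr_normlP : ze => [h1 h2]; split; lra.
  - by move=> i j; rewrite !ord1.
  - by move/ltr_normlP : zd => [h1 h2]; lra.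
move=> H; apply: H.
- by move=> _; move/ltr_normlP : ze => [h1 h2]; split; lra.
- by move=> i j; rewrite !ord1.
- by move/ltr_normlP : zd => [h1 h2]; lra.
Unshelve. all: by end_near. Qed.

Lemma strongly_proper_phi_derive y : is_derive y 1 phi (derive1 phi y).
Proof. by rewrite derive1E; apply: derivableP; exact: sp_phi_derivable hsp y. Qed.

Lemma strongly_proper_derive1_phi_lipschitz : locally_lipschitz (derive1 phi).
Proof.
move=> M; have := sp_phi_derive_lipschitz hsp (@segment_compact R (- M) M).
move=> [K0 [_ HK]]; exists (`|K0| + 1); first by rewrite addr_ge0.
move=> x y xM yM; apply: (HK (`|K0| + 1) _ (y, x)) => /=.
  by rewrite (le_lt_trans (ler_norm _))// ltrDl.
by rewrite !in_itv/= -!ler_norml.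
Qed.

(** Where [psi] is differentiable, differentiating [phi (psi z) = z] shows that the derivative of
    [phi] at [psi z] is the inverse of that of [psi], so the friction identity gives the formula
    almost everywhere. Both sides are continuous, and a full set is dense. *)
Lemma strongly_proper_sigmaE x : open_interval a b x ->
  sigma x = - lam * derive1 phi (psi x).
Proof.
move=> Ix; apply/eqP; rewrite -subr_eq0; apply/eqP.
pose q x := sigma x - - lam * derive1 phi (psi x).
rewrite -[LHS]/(q x); apply: (@ae_eq0_continuous a b) => //; last first.
  apply: cvgB; first by apply: (sp_sigma_continuous hsp); rewrite inE.
  apply: cvgMl_tmp; apply: continuous_comp (strongly_proper_psi_continuous Ix) _.
  exact: (locally_lipschitz_continuous strongly_proper_derive1_phi_lipschitz).
have := sp_friction hsp; apply: filterS; first exact: (ae_filter_ringOfSetsType leb).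
move=> z Hz Iz.
have [dz sz] := Hz Iz; rewrite derive1E in sz.
have [e e0 He] := open_interval_nbhs Iz.
have D := is_derive1_comp (strongly_proper_phi_derive (psi z)) (derivableP dz).
have D1 : is_derive z 1 (phi \o psi) (1 : R).
  apply: near_eq_is_derive (is_derive_id z (1 : R)).
  near=> w => /=; rewrite (sp_phi_inverse hsp).2//; apply: He.
  by near: w; exact: (@nbhsx_ballx R R z).
have E : derive1 phi (psi z) * 'D_1 psi z = 1 by case: D => _ e1; case: D1 => _ e2; rewrite -e1 -[RHS]e2.
have p0 : 'D_1 psi z != 0.
  by apply/eqP => p0; move: E => /eqP; rewrite p0 mulr0 eq_sym oner_eq0.
rewrite /q; apply: (mulIf p0); rewrite mul0r mulrBl sz -mulrA E; ring.
Unshelve. all: by end_near. Qed.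

(** The friction identity with nonzero [lam] excludes zeros of [sigma] almost everywhere, so the
    quotient formula holds on a full set; continuity extends the product form to the zeros of
    [sigma]. *)
Lemma strongly_proper_muE x : open_interval a b x -> mu x = psi x * sigma x.
Proof.
move=> Ix; apply/eqP; rewrite -subr_eq0; apply/eqP.
pose q x := mu x - psi x * sigma x.
rewrite -[LHS]/(q x); apply: (@ae_eq0_continuous a b) => //; last first.
  apply: cvgB; first by apply: (sp_mu_continuous hsp); rewrite inE.
  apply: cvgM; first exact: strongly_proper_psi_continuous.
  by apply: (sp_sigma_continuous hsp); rewrite inE.
have := sp_friction hsp; apply: filterS; first exact: (ae_filter_ringOfSetsType leb).
move=> z Hz Iz.
have [dz sz] := Hz Iz.
have s0 : sigma z != 0.
  apply/eqP => s0; move: sz => /eqP; rewrite s0 mul0r eq_sym oppr_eq0.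
  by rewrite gt_eqF// (sp_lam_gt0 hsp).
by rewrite /q (sp_psi_quotient hsp Iz s0) divfK// subrr.
Qed.

Lemma state_space_transform_in x : open_interval a b (f x).
Proof. exact: ((sp_phi_inverse hsp).1 (- lam * x)).1. Qed.

Lemma psi_state_space_transform x : psi (f x) = - lam * x.
Proof. exact: ((sp_phi_inverse hsp).1 (- lam * x)).2. Qed.

Lemma state_space_transform_psi x : open_interval a b x ->
  f (- lam^-1 * psi x) = x.
Proof.
move=> Ix; rewrite /f /state_space_transform mulrA mulrNN divff ?mul1r.
  exact: (sp_phi_inverse hsp).2.
by rewrite gt_eqF// (sp_lam_gt0 hsp).
Qed.

Lemma sigma_state_space_transform x :
  sigma (f x) = - lam * derive1 phi (- lam * x).
Proof.
by rewrite (strongly_proper_sigmaE (state_space_transform_in x)) psi_state_space_transform.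
Qed.

Lemma mu_state_space_transform x : mu (f x) = - lam * x * sigma (f x).
Proof.
by rewrite (strongly_proper_muE (state_space_transform_in x)) psi_state_space_transform.
Qed.

Lemma state_space_transform_derive x : is_derive x 1 f (sigma (f x)).
Proof.
have D : is_derive x 1 (fun z => - lam * z) (- lam).
  have := @is_deriveZ R R R id (- lam) x 1 1 (is_derive_id _ _).
  by rewrite [_ *: 1]mulr1.
have := is_derive1_comp (strongly_proper_phi_derive (- lam * x)) D.
by rewrite mulrC -sigma_state_space_transform.
Qed.

Lemma sigma_transform_lipschitz : locally_lipschitz (fun x => sigma (f x)).
Proof.
move=> M; have [K K0 HK] := strongly_proper_derive1_phi_lipschitz (`|lam| * M).
exists (`|lam| * (K * `|lam|)); first by rewrite !mulr_ge0.
move=> x y xM yM; rewrite !sigma_state_space_transform -mulrBr normrM normrN -mulrA.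
rewrite ler_wpM2l//.
have := HK (- lam * x) (- lam * y); rewrite -mulrBr !normrM !normrN mulrA.
by apply; rewrite ler_wpM2l.
Qed.

End fixed_triple.
End proper_triples.

(** * Growth of paths by chaining *)

Section chaining.
Context {R : realType}.
Implicit Types (g : R -> R) (A rho c x : R).

Lemma expR_le_mono c x y : 0 <= c -> x <= y -> expR (c * x) <= expR (c * y).
Proof. by move=> c0 xy; rewrite ler_expR ler_wpM2l. Qed.

Lemma geometric_sum_le rho n : 0 <= rho < 1 -> \sum_(i < n) rho ^+ i <= (1 - rho)^-1.
Proof.
move=> /andP[r0 r1]; have r10 : 0 < 1 - rho by lra.
rewrite -[leRHS]mul1r ler_pdivlMr// mulrC -opprB mulNr.
by rewrite -subrX1 opprB gerBl exprn_ge0.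
Qed.

(** At level 0 the point [j] is reached by [j] unit steps. A point of level [k + 1] is either one of
    level [k] or a single fine step beyond it, which costs one more term of the geometric sum. *)
Lemma dyadic_chaining g A rho c : 0 <= A -> 0 <= rho < 1 -> 0 <= c ->
  (forall k j : nat, `|g (- (j.+1%:R / 2 ^+ k)) - g (- (j%:R / 2 ^+ k))| <=
     A * rho ^+ k * expR (c * (j%:R / 2 ^+ k))) ->
  forall k j : nat, `|g (- (j%:R / 2 ^+ k)) - g 0| <=
    A * expR (c * (j%:R / 2 ^+ k)) *
      (j%:R / 2 ^+ k + \sum_(i < k.+1) rho ^+ i).
Proof.
move=> A0 rho01 c0 H; have /andP[rho0 rho1] := rho01; elim=> [|k IH] j.
  rewrite big_ord1 !expr0 !divr1; elim: j => [|j IHj].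
    by rewrite mulr0n oppr0 subrr normr0 add0r mulr1 mulr_ge0 ?expR_ge0.
  rewrite -(subrK (g (- j%:R)) (g (- j.+1%:R))) -addrA.
  apply: le_trans (ler_normD _ _) _.
  have := H 0%N j; rewrite !expr0 !divr1 mulr1 => Hj.
  apply: le_trans (lerD Hj IHj) _.
  rewrite -[X in X + _]mulr1 -mulrDr addrC.
  apply: ler_pM; rewrite ?mulr_ge0 ?expR_ge0 ?addr_ge0//.
    by rewrite ler_wpM2l// expR_le_mono// ler_nat.
  by rewrite -natr1; lra.
have p2 : 0 < 2 ^+ k :> R by rewrite exprn_gt0.
have half i : (i.*2)%:R / 2 ^+ k.+1 = i%:R / 2 ^+ k :> R.
  by rewrite -muln2 natrM exprS; field; rewrite gt_eqF.
have S0 : 0 <= \sum_(i < k.+1) rho ^+ i by apply: sumr_ge0 => i _; exact: exprn_ge0.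
rewrite -(odd_double_half j); set i := j./2.
have xi0 : 0 <= i%:R / 2 ^+ k :> R by rewrite divr_ge0// ltW.
case: (odd j) => /=; last first.
  rewrite add0n half; apply: le_trans (IH i) _.
  by rewrite ler_wpM2l ?mulr_ge0 ?expR_ge0// lerD2l [leRHS]big_ord_recr/= lerDl exprn_ge0.
rewrite add1n; have := H k.+1 i.*2; rewrite half => Hi.
rewrite -(subrK (g (- (i%:R / 2 ^+ k))) (g (- ((i.*2).+1%:R / _)))) -addrA.
apply: le_trans (ler_normD _ _) _; apply: le_trans (lerD Hi (IH i)) _.
have le1 : i%:R / 2 ^+ k <= (i.*2).+1%:R / 2 ^+ k.+1 :> R.
  by rewrite -half ler_wpM2r ?invr_ge0 ?exprn_ge0// ler_nat.
rewrite [in leRHS]big_ord_recr/=.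
set e := expR _; set S := \sum_(i0 < _) _.
have -> : A * rho ^+ k.+1 * e + A * e * (i%:R / 2 ^+ k + S) =
  A * e * (i%:R / 2 ^+ k + (S + rho ^+ k.+1)) by ring.
apply: ler_pM; rewrite ?mulr_ge0 ?expR_ge0 ?addr_ge0 ?exprn_ge0//.
  by rewrite ler_wpM2l// expR_le_mono.
by rewrite lerD2r.
Qed.

(** The rate doubles from [c] to [2 c] because the linear factor left by the unit steps is absorbed
    by [x <= exp(c x) / c]. Continuity extends the bound from dyadic points to the half-line. *)
Lemma chaining_growth g A rho c : 0 <= A -> 0 <= rho < 1 -> 0 < c ->
  continuous g ->
  (forall k j : nat, `|g (- (j.+1%:R / 2 ^+ k)) - g (- (j%:R / 2 ^+ k))| <=
     A * rho ^+ k * expR (c * (j%:R / 2 ^+ k))) ->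
  exists K, forall x, x <= 0 -> `|g x| <= K * expR (- (2 * c) * x).
Proof.
move=> A0 rho01 c0 cg H.
have r10 : 0 < 1 - rho by move/andP : rho01; lra.
pose K := A * (c^-1 + (1 - rho)^-1).
have K0 : 0 <= K by rewrite mulr_ge0// addr_ge0// invr_ge0 ltW.
have dy k j : `|g (- (j%:R / 2 ^+ k)) - g 0| <= K * expR (2 * c * (j%:R / 2 ^+ k)).
  apply: le_trans (dyadic_chaining A0 rho01 (ltW c0) H k j) _.
  set x := j%:R / 2 ^+ k.
  have x0 : 0 <= x by rewrite divr_ge0// exprn_ge0.
  rewrite (_ : 2 * c * x = c * x + c * x); last by ring.
  rewrite expRD /K -!mulrA ler_wpM2l// [leRHS]mulrCA ler_wpM2l ?expR_ge0//.
  rewrite mulrDl; apply: lerD.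
    rewrite mulrC ler_pdivlMr// mulrC; apply: le_trans (expR_ge1Dx _).
    by rewrite lerDr.
  apply: le_trans (geometric_sum_le _ rho01) _.
  rewrite ler_peMr ?invr_ge0 ?(ltW r10)//.
  by apply: le_trans (expR_ge1Dx _); rewrite lerDl mulr_ge0// ltW.
exists (K + `|g 0|) => x x0.
have e1 : 1 <= expR (- (2 * c) * x).
  by apply: le_trans (expR_ge1Dx _); rewrite lerDl; nra.
suff : `|g x - g 0| <= K * expR (- (2 * c) * x).
  move=> h; rewrite -(subrK (g 0) (g x)) (le_trans (ler_normD _ _))// mulrDl lerD//.
  by rewrite ler_peMr.
apply/ler_addgt0Pr => e e0.
have := cg x => /cvgrPdist_lt/(_ _ e0)[d /= d0 Hd].
(* Then [1 / d < k + 1 <= 2 ^ k], so dyadic steps of level [k] are shorter than [d]. The dyadic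
   point chosen below lies to the right of [x], where the exponential bound is smaller. *)
pose k := Num.truncn d^-1.
have p2 : 0 < 2 ^+ k :> R by rewrite exprn_gt0.
have kd : (2 ^+ k)^-1 < d.
  rewrite -[d]invrK ltf_pV2 ?posrE ?invr_gt0//.
  apply: lt_le_trans (real_truncnS_gt (num_real _)) _.
  by rewrite -natrX ler_nat ltn_expl.
pose j := Num.truncn (- x * 2 ^+ k).
have /andP[j1 j2] : j%:R <= - x * 2 ^+ k < j.+1%:R.
  by apply: truncn_itv; rewrite mulr_ge0 ?oppr_ge0// ltW.
have jx : j%:R / 2 ^+ k <= - x by rewrite ler_pdivrMr.
have xj : - x < j%:R / 2 ^+ k + d.
  apply: lt_le_trans (_ : j.+1%:R / 2 ^+ k <= _); first by rewrite ltr_pdivlMr.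
  by rewrite -natr1 mulrDl mul1r lerD2l ltW.
have D1 : `|g x - g (- (j%:R / 2 ^+ k))| < e.
  by apply: Hd; rewrite /= opprK ltr_norml; apply/andP; split; lra.
rewrite -(subrK (g (- (j%:R / 2 ^+ k))) (g x)) -addrA (le_trans (ler_normD _ _))//.
have D2 := dy k j.
suff : K * expR (2 * c * (j%:R / 2 ^+ k)) <= K * expR (- (2 * c) * x) by lra.
rewrite ler_wpM2l// mulNr -mulrN expR_le_mono//.
by rewrite mulr_ge0// ltW.
Qed.

End chaining.

(** * Equality in law *)

Section laws.
Context {d : measure_display} {T : measurableType d} {R : realType}.
Variable P : probability T R.
Implicit Types (n : nat).

Definition rvec n (V : 'I_n -> T -> R) (w : T) : n.-tuple (measurableTypeR R) :=
  [tuple (V i w : measurableTypeR R) | i < n].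

Lemma measurable_rvec n (V : 'I_n -> T -> R) :
  (forall i, measurable_fun setT (V i)) -> measurable_fun setT (rvec V).
Proof.
move=> mV; apply/measurable_fun_tnthP => i.
suff -> : (@tnth n (measurableTypeR R) ^~ i) \o rvec V = V i by exact: mV.
by apply: funext => w /=; rewrite /rvec tnth_mktuple.
Qed.

Definition same_law n (V V' : 'I_n -> T -> R) : Prop :=
  forall A : set (n.-tuple (measurableTypeR R)), measurable A ->
    P [set w | A (rvec V w)] = P [set w | A (rvec V' w)].

(** Open upper orthants form a generating pi-system, so they determine laws. Openness makes a box
    the increasing union of the boxes with slightly larger corners, which is what limits in
    probability require. *)
Definition upper_box n (a : 'I_n -> R) : set (n.-tuple (measurableTypeR R)) :=
  [set x | forall i, a i < tnth x i].

Definition upper_event n (V : 'I_n -> T -> R) (a : 'I_n -> R) : set T :=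
  [set w | forall i, a i < V i w].

Lemma measurable_upper_box n (a : 'I_n -> R) : measurable (upper_box a).
Proof.
have -> : upper_box a = \bigcap_(i in [set: 'I_n])
    ((fun x : n.-tuple (measurableTypeR R) => tnth x i) @^-1` `]a i, +oo[).
  by apply/seteqP; split=> x /= H i => [_|]; have := H i; rewrite /= in_itv/= andbT//; apply.
apply: fin_bigcap_measurable => // i _; rewrite -[X in measurable X]setTI.
exact: measurable_tnth.
Qed.

(** A half-space bounding one coordinate is a countable union of boxes whose other corners are [-k],
    as the finitely many coordinates of a point are bounded below. *)
Lemma generated_by_upper_boxes n :
  @measurable _ (n.-tuple (measurableTypeR R)) =
  <<s [set upper_box a | a in [set: 'I_n -> R]] >>.
Proof.
set G := [set _ | _ in _].
have sG : sigma_algebra setT <<s G >> by exact: smallest_sigma_algebra.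
rewrite eqEsubset; split; last first.
  apply: smallest_sub; first exact: sigma_algebra_measurable.
  by move=> _ [a _ <-]; exact: measurable_upper_box.
apply: smallest_sub => //.
move=> A; rewrite -bigcup_seq => -[i _ [B mB <-]]; rewrite setTI.
move: B mB.
suff : @measurable _ (measurableTypeR R) `<=`
    [set B | <<s G >> ((fun x : n.-tuple (measurableTypeR R) => tnth x i) @^-1` B)].
  by move=> H B mB; apply: H.
rewrite (_ : @measurable _ (measurableTypeR R) =
  (@RGenOInfty.G R).-sigma.-measurable); last first.
  by rewrite -RGenOInfty.measurableE.
apply: smallest_sub.
  split.
  - by rewrite /= preimage_set0; exact: sigma_algebra0.
  - move=> B /= HB; rewrite setTD preimage_setC.
    by have := sigma_algebraCD HB; rewrite setTD.
  - by move=> F HF /=; rewrite preimage_bigcup; exact: sigma_algebra_bigcup.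
move=> _ [r ->] /=.
have -> : (fun x : n.-tuple (measurableTypeR R) => tnth x i) @^-1` `]r, +oo[ =
  \bigcup_k upper_box (fun j => if j == i then r else - k%:R).
  apply/seteqP; split => [x|x [k _ H]] /=; rewrite in_itv/= andbT; last first.
    by have := H i; rewrite eqxx.
  move=> rx.
  have [k Hk] : exists k : nat, forall j, - k%:R < tnth x j.
    exists (\max_(j < n) (Num.truncn `|tnth x j|).+1)%N => j.
    rewrite ltrNl; apply: le_lt_trans (ler_norm _) _; rewrite normrN.
    apply: lt_le_trans (real_truncnS_gt (num_real _)) _.
    by rewrite ler_nat; exact: (leq_bigmax j).
  by exists k => // j; case: eqP => [->//|_]; exact: Hk.
by apply: sigma_algebra_bigcup => k; apply: sub_sigma_algebra; eexists.
Qed.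

Lemma upper_box_rvec n (V : 'I_n -> T -> R) a :
  [set w | upper_box a (rvec V w)] = upper_event V a.
Proof.
by apply/seteqP; split=> w H i; have := H i; rewrite /rvec tnth_mktuple.
Qed.

Lemma same_law_upper n (V V' : 'I_n -> T -> R) :
  (forall i, measurable_fun setT (V i)) ->
  (forall i, measurable_fun setT (V' i)) ->
  (forall a, P (upper_event V a) = P (upper_event V' a)) -> same_law V V'.
Proof.
move=> mV mV' H A mA.
pose X : {mfun T >-> n.-tuple (measurableTypeR R)} :=
  HB.pack (rvec V) (isMeasurableFun.Build _ _ _ _ _ (measurable_rvec mV)).
pose X' : {mfun T >-> n.-tuple (measurableTypeR R)} :=
  HB.pack (rvec V') (isMeasurableFun.Build _ _ _ _ _ (measurable_rvec mV')).
apply: (measure_unique [set upper_box a | a in [set: 'I_n -> R]]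
  (fun k => upper_box (fun=> - k%:R)) _ _ _ _
  (distribution P X) (distribution P X')) => //.
- exact: generated_by_upper_boxes.
- move=> _ _ [a _ <-] [b _ <-]; exists (fun i => Num.max (a i) (b i)) => //.
  apply/seteqP; split=> x /=.
    by move=> h; split => i; have := h i; rewrite gt_max => /andP[].
  by move=> [h1 h2] i; rewrite gt_max h1 h2.
- apply/seteqP; split => // x _.
  exists (\max_(j < n) (Num.truncn `|tnth x j|).+1)%N => // j.
  rewrite ltrNl; apply: le_lt_trans (ler_norm _) _; rewrite normrN.
  apply: lt_le_trans (real_truncnS_gt (num_real _)) _.
  by rewrite ler_nat; exact: (leq_bigmax j).
- move=> _ [a _ <-]; rewrite /distribution /pushforward /=.
  have := H a; rewrite -!upper_box_rvec; exact.
- by move=> k; rewrite (le_lt_trans (probability_le1 _ _))// ?ltry//; exact: measurable_upper_box.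
Qed.

Lemma same_law_sym n (V V' : 'I_n -> T -> R) : same_law V V' -> same_law V' V.
Proof. by move=> H A mA; rewrite H. Qed.

Lemma same_law_map n m (V V' : 'I_n -> T -> R) (W W' : 'I_m -> T -> R)
    (F : n.-tuple (measurableTypeR R) -> m.-tuple (measurableTypeR R)) :
  measurable_fun setT F -> (forall w, rvec W w = F (rvec V w)) ->
  (forall w, rvec W' w = F (rvec V' w)) -> same_law V V' -> same_law W W'.
Proof.
move=> mF WF WF' H A mA.
under eq_set do rewrite WF.
under [in RHS]eq_set do rewrite WF'.
by apply: (H (F @^-1` A)); rewrite -[X in measurable X]setTI; exact: mF.
Qed.

Lemma measurable_upper_event n (V : 'I_n -> T -> R) a :
  (forall i, measurable_fun setT (V i)) -> measurable (upper_event V a).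
Proof.
move=> mV; rewrite -upper_box_rvec -[X in measurable X]setTI.
by apply: measurable_rvec => //; exact: measurable_upper_box.
Qed.

Definition cvg_in_probability (Vs : nat -> T -> R) (V : T -> R) : Prop :=
  forall e : R, 0 < e ->
    P [set w | e < `|Vs k w - V w|] @[k --> \oo] --> 0%E.

Lemma measurable_dist_gt (X Y : T -> R) (e : R) :
  measurable_fun setT X -> measurable_fun setT Y ->
  measurable [set w | e < `|X w - Y w|].
Proof.
move=> mX mY.
have mD : measurable_fun setT (fun w => `|X w - Y w|).
  by apply: measurableT_comp => //; exact: measurable_funB.
rewrite (_ : [set _ | _] = setT `&` (fun w => `|X w - Y w|) @^-1` `]e, +oo[).
  exact: mD.
by rewrite setTI; apply/seteqP; split => w /=; rewrite in_itv/= andbT.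
Qed.

Lemma upper_event_shift n (V W : 'I_n -> T -> R) a (e : R) :
  (forall i, measurable_fun setT (V i)) -> (forall i, measurable_fun setT (W i)) ->
  (P (upper_event V (fun i => (a i + e)%R)) <=
   P (upper_event W a) + \sum_(i < n) P [set w | (e < `|V i w - W i w|)%R])%E.
Proof.
move=> mV mW.
have mB : measurable (\big[setU/set0]_(i < n) [set w | (e < `|V i w - W i w|)%R]).
  by apply: bigsetU_measurable => i _; exact: measurable_dist_gt.
apply: (@le_trans _ _ (P (upper_event W a `|`
    \big[setU/set0]_(i < n) [set w | (e < `|V i w - W i w|)%R]))).
  apply: le_measure; rewrite ?inE.
  - exact: measurable_upper_event.
  - by apply: measurableU => //; exact: measurable_upper_event.
  move=> w Vw.
  have [[i Hi]|H] := pselect (exists i, e < `|V i w - W i w|).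
    by right; rewrite -bigcup_seq; exists i => //=; rewrite mem_index_enum.
  left => i; rewrite ltNge; apply/negP => Wa; apply: H; exists i.
  have := Vw i; have := ler_norm (V i w - W i w); lra.
apply: le_trans (measureU2 _ _ _) _ => //; first exact: measurable_upper_event.
rewrite leeD2l//.
suff [//] : measurable (\big[setU/set0]_(i < n) [set w | (e < `|V i w - W i w|)%R]) /\
  (P (\big[setU/set0]_(i < n) [set w | (e < `|V i w - W i w|)%R]) <=
   \sum_(i < n) P [set w | (e < `|V i w - W i w|)%R])%E.
apply: (big_ind2 (fun A x => measurable A /\ (P A <= x)%E)).
- by rewrite measure0; split.
- move=> A x B y [mA Ax] [mB' By]; split; first exact: measurableU.
  by apply: le_trans (measureU2 _ _ _) _ => //; exact: leeD.
- by move=> i _; split => //; exact: measurable_dist_gt.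
Qed.

(** Raising the corner by [2 e] pays for two replacements, [V] by [Vs k] and [Vs' k] by [V'], each
    up to an event of vanishing probability. Exchanging the roles of the two families gives the
    reverse inequality. *)
Lemma limit_upper_event_le n (Vs Vs' : nat -> 'I_n -> T -> R) (V V' : 'I_n -> T -> R) :
  (forall k i, measurable_fun setT (Vs k i)) -> (forall k i, measurable_fun setT (Vs' k i)) ->
  (forall i, measurable_fun setT (V i)) -> (forall i, measurable_fun setT (V' i)) ->
  (forall i, cvg_in_probability (fun k => Vs k i) (V i)) ->
  (forall i, cvg_in_probability (fun k => Vs' k i) (V' i)) ->
  (forall k, same_law (Vs k) (Vs' k)) ->
  forall a, (P (upper_event V a) <= P (upper_event V' a))%E.
Proof.
move=> mVs mVs' mV mV' cV cV' sl a.
have shift (e : R) : 0 < e ->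
    (P (upper_event V (fun i => (a i + (e + e))%R)) <= P (upper_event V' a))%E.
  move=> e0.
  have dV i : P [set w | e < `|V i w - Vs k i w|] @[k --> \oo] --> 0%E.
    under eq_fun do under eq_set do rewrite distrC; exact: cV.
  have H k : (P (upper_event V (fun i => (a i + (e + e))%R)) <=
      P (upper_event V' a) + (\sum_(i < n) P [set w | (e < `|V i w - Vs k i w|)%R] +
      \sum_(i < n) P [set w | (e < `|Vs' k i w - V' i w|)%R]))%E.
    under eq_fun do rewrite addrA.
    apply: le_trans (upper_event_shift (fun i => a i + e) e mV (mVs k)) _.
    rewrite (addeC (\sum_(_ < _) _)%E) addeA leeD2r//.
    have -> : P (upper_event (Vs k) (fun i => a i + e)) =
              P (upper_event (Vs' k) (fun i => a i + e)).
      by rewrite -!upper_box_rvec; apply: sl; exact: measurable_upper_box.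
    exact: upper_event_shift.
  have L : (P (upper_event V' a) + (\sum_(i < n) P [set w | (e < `|V i w - Vs k i w|)%R] +
      \sum_(i < n) P [set w | (e < `|Vs' k i w - V' i w|)%R]))%E @[k --> \oo] -->
      (P (upper_event V' a) + (\sum_(i < n) 0 + \sum_(i < n) 0))%E.
    apply: cvgeD; first by rewrite !big1// !adde0 fin_num_adde_defl.
      exact: cvg_cst.
    apply: cvgeD; first by rewrite !big1.
      by apply: cvg_nnesum => // i _; apply: nearW => k.
    by apply: cvg_nnesum => // i _; [apply: nearW => k|exact: cV'].
  rewrite !big1// !adde0 in L.
  by apply: cvge_ge L; apply: nearW.
(* Now [e] tends to 0: continuity from below along [e = 1 / (k + 1)]. *)
have : P (upper_event V (fun i => (a i + (k.+1%:R^-1 + k.+1%:R^-1))%R)) @[k --> \oo]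
    --> P (upper_event V a).
  have -> : upper_event V a =
      \bigcup_k upper_event V (fun i => (a i + (k.+1%:R^-1 + k.+1%:R^-1))%R).
    apply/seteqP; split => [w H|w [k _ H] i]; last first.
      have := H i; have : 0 < k.+1%:R^-1 :> R by rewrite invr_gt0.
      move: (k.+1%:R^-1) => z *; lra.
    have [k Hk] : exists k : nat, forall i, 2 / (V i w - a i) < k%:R.
      exists (\max_(j < n) (Num.truncn (2 / (V j w - a j))).+1)%N => j.
      apply: lt_le_trans (real_truncnS_gt (num_real _)) _.
      by rewrite ler_nat; exact: (leq_bigmax j).
    exists k => // i.
    have D0 : 0 < V i w - a i by have := H i; lra.
    suff : k.+1%:R^-1 + k.+1%:R^-1 < V i w - a i.
      by move: (k.+1%:R^-1) => z; lra.
    have -> : k.+1%:R^-1 + k.+1%:R^-1 = 2 / k.+1%:R :> R by move: (k.+1%:R^-1) => z; ring.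
    rewrite ltr_pdivrMr// mulrC -ltr_pdivrMr//.
    by apply: lt_trans (Hk i) _; rewrite ltr_nat.
  apply: nondecreasing_cvg_mu.
  - by move=> k; exact: measurable_upper_event.
  - by apply: bigcupT_measurable => k; exact: measurable_upper_event.
  - apply/nondecreasing_seqP => k; apply/subsetPset => w H i; have := H i.
    have : k.+2%:R^-1 <= k.+1%:R^-1 :> R by rewrite lef_pV2 ?posrE// ler_nat.
    by move: (k.+2%:R^-1) (k.+1%:R^-1) => y z; lra.
by apply: cvge_le; apply: nearW => k; exact: shift.
Qed.

Lemma same_law_limit n (Vs Vs' : nat -> 'I_n -> T -> R) (V V' : 'I_n -> T -> R) :
  (forall k i, measurable_fun setT (Vs k i)) -> (forall k i, measurable_fun setT (Vs' k i)) ->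
  (forall i, measurable_fun setT (V i)) -> (forall i, measurable_fun setT (V' i)) ->
  (forall i, cvg_in_probability (fun k => Vs k i) (V i)) ->
  (forall i, cvg_in_probability (fun k => Vs' k i) (V' i)) ->
  (forall k, same_law (Vs k) (Vs' k)) -> same_law V V'.
Proof.
move=> mVs mVs' mV mV' cV cV' sl; apply: same_law_upper => // a.
apply/eqP; rewrite eq_le; apply/andP; split.
  exact: (limit_upper_event_le mVs mVs').
by apply: (limit_upper_event_le mVs' mVs) => // k; exact: same_law_sym.
Qed.

End laws.

(** * Square-integrable functions and their inner product *)

Section square_integrable.
Context {d : measure_display} {T : measurableType d} {R : realType}.
Variable mu : {measure set T -> \bar R}.
Implicit Types X Y Z : T -> R.

Definition square_integrable X : Prop :=
  measurable_fun setT X /\ (\int[mu]_w ((X w) ^+ 2)%:E < +oo)%E.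

Definition inner X Y : R := Rintegral mu setT (fun w => X w * Y w).

Lemma measurable_EFin_sqr X : measurable_fun setT X ->
  measurable_fun setT (fun w => ((X w) ^+ 2)%:E).
Proof. by move=> mX; apply/measurable_EFinP; exact: measurable_funX. Qed.

Lemma square_integrableP X : square_integrable X ->
  mu.-integrable setT (fun w => ((X w) ^+ 2)%:E).
Proof.
move=> [mX finV]; apply/integrableP; split; first exact: measurable_EFin_sqr.
rewrite (eq_integral (fun w => ((X w) ^+ 2)%:E))// => w _.
by rewrite gee0_abs// lee_fin sqr_ge0.
Qed.

Lemma integrable_inner X Y : square_integrable X -> square_integrable Y ->
  mu.-integrable setT (EFin \o (fun w => X w * Y w)).
Proof.
move=> hX hY.
apply: (le_integrable measurableT _ _
  (integrableD measurableT (square_integrableP hX) (square_integrableP hY))).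
  by apply/measurable_EFinP; apply: measurable_funM; [case: hX|case: hY].
move=> w _ /=; rewrite lee_fin [leRHS]ger0_norm ?addr_ge0 ?sqr_ge0// ler_norml.
by apply/andP; split; nra.
Qed.

Lemma integral_sqr_inner X : square_integrable X ->
  (\int[mu]_w ((X w) ^+ 2)%:E)%E = (inner X X)%:E.
Proof.
move=> hX; rewrite /inner /Rintegral fineK//.
exact: integrable_fin_num (integrable_inner hX hX).
Qed.

Lemma innerC X Y : inner X Y = inner Y X.
Proof. by rewrite /inner; apply: eq_Rintegral => w _; rewrite mulrC. Qed.

Lemma square_integrable0 : square_integrable (fun=> 0).
Proof.
split; first exact: measurable_cst.
by rewrite integral0_eq ?ltry// => w _; rewrite expr0n.
Qed.

Lemma square_integrableD X Y : square_integrable X -> square_integrable Y ->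
  square_integrable (fun w => X w + Y w).
Proof.
move=> hX hY; have mD : measurable_fun setT (fun w => X w + Y w).
  by apply: measurable_funD; [case: hX|case: hY].
split => //.
have I := integrableD measurableT (square_integrableP hX) (square_integrableP hY).
have I2 := integrableZl measurableT 2 I.
case/integrableP : I2 => mI; apply: le_lt_trans.
apply: ge0_le_integral => //.
- by move=> w _; rewrite lee_fin sqr_ge0.
- exact: measurable_EFin_sqr.
- by apply: measurableT_comp => //; exact: mI.
move=> w _; rewrite -EFinD -EFinM lee_fin.
rewrite ger0_norm ?mulr_ge0 ?addr_ge0 ?sqr_ge0//.
have := sqr_ge0 (X w - Y w); nra.
Qed.

Lemma square_integrableZ k X : square_integrable X ->
  square_integrable (fun w => k * X w).
Proof.
move=> hX; split; first by apply: measurable_funM => //; case: hX.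
under eq_integral do rewrite exprMn EFinM.
rewrite ge0_integralZl//.
- rewrite integral_sqr_inner// -EFinM ltry//.
- by apply: measurable_EFin_sqr; case: hX.
- by move=> w _; rewrite lee_fin sqr_ge0.
- by rewrite lee_fin sqr_ge0.
Qed.

Lemma square_integrableB X Y : square_integrable X -> square_integrable Y ->
  square_integrable (fun w => X w - Y w).
Proof.
move=> hX hY; have := square_integrableD hX (square_integrableZ (-1) hY).
by under eq_fun do rewrite mulN1r.
Qed.

Lemma square_integrable_sum (I : Type) (s : seq I) (F : I -> T -> R) :
  (forall i, square_integrable (F i)) ->
  square_integrable (fun w => \sum_(i <- s) F i w).
Proof.
move=> hF; elim: s => [|i s IH].
  by under eq_fun do rewrite big_nil; exact: square_integrable0.
by under eq_fun do rewrite big_cons; exact: square_integrableD.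
Qed.

Lemma innerDl X Y Z : square_integrable X -> square_integrable Y ->
  square_integrable Z -> inner (fun w => X w + Y w) Z = inner X Z + inner Y Z.
Proof.
move=> hX hY hZ; rewrite /inner -RintegralD//; try exact: integrable_inner.
by apply: eq_Rintegral => w _; rewrite mulrDl.
Qed.

Lemma innerZl k X Y : square_integrable X -> square_integrable Y ->
  inner (fun w => k * X w) Y = k * inner X Y.
Proof.
move=> hX hY; rewrite /inner -RintegralZl//; last exact: integrable_inner.
by apply: eq_Rintegral => w _; rewrite mulrA.
Qed.

Lemma innerBl X Y Z : square_integrable X -> square_integrable Y ->
  square_integrable Z -> inner (fun w => X w - Y w) Z = inner X Z - inner Y Z.
Proof.
move=> hX hY hZ; rewrite -mulN1r -innerZl// -innerDl//; last exact: square_integrableZ.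
by apply: eq_Rintegral => w _; rewrite mulN1r.
Qed.

Lemma inner_suml (I : Type) (s : seq I) (F : I -> T -> R) Z :
  (forall i, square_integrable (F i)) -> square_integrable Z ->
  inner (fun w => \sum_(i <- s) F i w) Z = \sum_(i <- s) inner (F i) Z.
Proof.
move=> hF hZ; elim: s => [|i s IH].
  rewrite big_nil /inner /Rintegral integral0_eq// => w _.
  by rewrite big_nil mul0r.
rewrite big_cons -IH -innerDl//; last exact: square_integrable_sum.
by apply: eq_Rintegral => w _; rewrite big_cons.
Qed.

Lemma innerDr X Y Z : square_integrable X -> square_integrable Y ->
  square_integrable Z -> inner Z (fun w => X w + Y w) = inner Z X + inner Z Y.
Proof. by move=> *; rewrite innerC innerDl// !(innerC Z). Qed.

Lemma innerBr X Y Z : square_integrable X -> square_integrable Y ->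
  square_integrable Z -> inner Z (fun w => X w - Y w) = inner Z X - inner Z Y.
Proof. by move=> *; rewrite innerC innerBl// !(innerC Z). Qed.

Lemma inner_sqrB X Y : square_integrable X -> square_integrable Y ->
  inner (fun w => X w - Y w) (fun w => X w - Y w) =
  inner X X - 2 * inner X Y + inner Y Y.
Proof.
move=> hX hY; have hXY := square_integrableB hX hY.
by rewrite innerBl// !innerBr// (innerC Y X); ring.
Qed.

Lemma inner_sqrD X Y : square_integrable X -> square_integrable Y ->
  inner (fun w => X w + Y w) (fun w => X w + Y w) =
  inner X X + 2 * inner X Y + inner Y Y.
Proof.
move=> hX hY; have hXY := square_integrableD hX hY.
by rewrite innerDl// !innerDr// (innerC Y X); ring.
Qed.

Lemma inner_ge0 X : 0 <= inner X X.
Proof. by apply: Rintegral_ge0 => w _; rewrite -expr2 sqr_ge0. Qed.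

Lemma inner_double_sum (I : Type) (s : seq I) (c : I -> R) (F : I -> T -> R) :
  (forall i, square_integrable (F i)) ->
  inner (fun w => \sum_(i <- s) c i * F i w) (fun w => \sum_(i <- s) c i * F i w) =
  \sum_(i <- s) \sum_(j <- s) c i * c j * inner (F i) (F j).
Proof.
move=> hF.
have hcF i : square_integrable (fun w => c i * F i w) by exact: square_integrableZ.
rewrite inner_suml//; last exact: square_integrable_sum.
apply: eq_bigr => i _; rewrite innerC inner_suml//; apply: eq_bigr => j _.
by rewrite innerZl// innerC innerZl// (innerC (F i)); ring.
Qed.

(** Stated in the extended reals, so that it can itself establish finiteness. *)
Lemma integral_sqrD_le X Y : measurable_fun setT X -> measurable_fun setT Y ->
  (\int[mu]_w ((X w + Y w) ^+ 2)%:E <=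
   2%:E * (\int[mu]_w ((X w) ^+ 2)%:E + \int[mu]_w ((Y w) ^+ 2)%:E))%E.
Proof.
move=> mX mY; rewrite -ge0_integralD//; try exact: measurable_EFin_sqr;
  try by move=> w _; rewrite lee_fin sqr_ge0.
rewrite -ge0_integralZl//.
- apply: ge0_le_integral => //.
  + by move=> w _; rewrite lee_fin sqr_ge0.
  + by apply: measurable_EFin_sqr; exact: measurable_funD.
  + by apply: measurable_funeM; apply: emeasurable_funD; exact: measurable_EFin_sqr.
  move=> w _; rewrite -EFinD -EFinM lee_fin.
  by have := sqr_ge0 (X w - Y w); nra.
- by apply: emeasurable_funD; exact: measurable_EFin_sqr.
- by move=> w _; rewrite adde_ge0// lee_fin sqr_ge0.
Qed.

End square_integrable.

(** * Modes of convergence and measurability up to null sets *)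

Section probability_tools.
Context {d : measure_display} {T : measurableType d} {R : realType}.
Variable P : probability T R.
Implicit Types X Y Z : T -> R.

(** The limit superior of the deviation events is negligible, and it is the decreasing limit of the
    tail unions, which contain the events. *)
Lemma ae_cvg_in_probability (Xs : nat -> T -> R) X :
  (forall k, measurable_fun setT (Xs k)) -> measurable_fun setT X ->
  {ae P, forall w, Xs k w @[k --> \oo] --> X w} -> cvg_in_probability P Xs X.
Proof.
move=> mXs mX [N [mN N0 sN]] e e0.
pose F k := [set w | e < `|Xs k w - X w|].
have mF k : measurable (F k) by exact: measurable_dist_gt.
have Foo : (P (\bigcup_(k in [set k | (0 <= k)%N]) F k) < +oo)%E.
  by rewrite (le_lt_trans (probability_le1 _ _))// ?ltry//; exact: bigcup_measurable.
have E : P (lim_sup_set F) = 0%E.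
  apply/eqP; rewrite eq_le measure_ge0 andbT -N0; apply: le_measure; rewrite ?inE//.
    by apply: bigcap_measurable => // k _; exact: bigcup_measurable.
  move=> w Hw; apply: sN => /= cw.
  move/cvgrPdist_le : cw => /(_ _ e0)[k _ Hk].
  have [j /= kj] := Hw k I; rewrite /F /= distrC ltNge => /negP; apply.
  exact: Hk.
have H : P (\bigcup_(k in [set k | (n <= k)%N]) F k) @[n --> \oo] --> 0%E.
  by rewrite -E; exact: lim_sup_set_cvg.
apply: (squeeze_cvge _ (cvg_cst 0%E) H); apply: nearW => k.
rewrite measure_ge0 /=; apply: le_measure; rewrite ?inE.
- exact: mF.
- by apply: bigcup_measurable => j _; exact: mF.
by move=> w Fw; exists k => /=.
Qed.

Lemma L2_cvg_in_probability (Xs : nat -> T -> R) X :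
  (forall k, measurable_fun setT (Xs k)) -> measurable_fun setT X ->
  (\int[P]_w ((Xs k w - X w) ^+ 2)%:E)%E @[k --> \oo] --> 0%E ->
  cvg_in_probability P Xs X.
Proof.
move=> mXs mX H e e0.
have mD k : measurable_fun setT (fun w => Xs k w - X w) by exact: measurable_funB.
have bnd k : (P [set w | (e < `|Xs k w - X w|)%R] <=
    (e ^- 2)%:E * \int[P]_w ((Xs k w - X w) ^+ 2)%:E)%E.
  rewrite -[leLHS]mul1e -[X in (X%:E * _)%E](mulVf (negbT (gt_eqF (exprn_gt0 2 e0)))).
  rewrite EFinM -muleA lee_wpmul2l ?lee_fin ?invr_ge0 ?exprn_ge0 ?(ltW e0)//.
  have mE := measurable_dist_gt e (mXs k) mX.
  rewrite -integral_cst//.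
  apply: (@le_trans _ _ (\int[P]_(w in [set w | (e < `|Xs k w - X w|)%R])
      ((Xs k w - X w) ^+ 2)%:E)%E).
    apply: ge0_le_integral => //.
    - by move=> w _; rewrite lee_fin exprn_ge0// ltW.
    - by apply: measurable_funTS; exact: measurable_EFin_sqr.
    move=> w /= h; rewrite lee_fin -[leRHS]real_normK ?num_real//.
    by rewrite ler_pXn2r ?nnegrE ?(ltW e0)// ltW.
  apply: ge0_subset_integral => //; first exact: measurable_EFin_sqr.
  by move=> w _; rewrite lee_fin sqr_ge0.
have L : ((e ^- 2)%:E * \int[P]_w ((Xs k w - X w) ^+ 2)%:E)%E @[k --> \oo] --> 0%E.
  by rewrite -[X in _ --> X](mule0 (e ^- 2)%:E); apply: cvgeZl.
apply: (squeeze_cvge _ (cvg_cst 0%E) L); apply: nearW => k.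
by rewrite measure_ge0 bnd.
Qed.

Hypothesis hP : measure_is_complete P.

(** Completeness enters here: whatever [X] does on the null set [N] is measurable. This covers
    values of [lim] and [get] on paths where nothing converges. *)
Lemma complete_measurable_fun (N : set T) X : measurable N -> P N = 0%E ->
  measurable_fun (~` N) X -> measurable_fun setT X.
Proof.
move=> mN N0 mX; rewrite -(setvU N); apply/measurable_funU => //.
  exact: measurableC.
split => // _ B mB; apply: hP; exists N; split => //.
Qed.

Lemma ae_eq_measurable_fun X Y : {ae P, forall w, X w = Y w} ->
  measurable_fun setT Y -> measurable_fun setT X.
Proof.
move=> [N [mN N0 sN]] mY; apply: (complete_measurable_fun mN N0).
apply: (@eq_measurable_fun _ _ _ _ _ Y); last exact: measurable_funTS.
move=> w; rewrite inE => wN; symmetry; apply: contrapT => h; apply: wN.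
by apply: sN => /=.
Qed.

Lemma ae_cvg_measurable_fun (Xs : nat -> T -> R) X :
  (forall k, measurable_fun setT (Xs k)) ->
  {ae P, forall w, Xs k w @[k --> \oo] --> X w} -> measurable_fun setT X.
Proof.
move=> mXs [N [mN N0 sN]]; apply: (complete_measurable_fun mN N0).
apply: (@measurable_fun_cvg _ _ _ _ Xs) => [k|w wN]; first exact: measurable_funTS.
by apply: contrapT => h; apply: wN; apply: sN => /=.
Qed.

End probability_tools.

(** * Second moments of sums of independent variables *)

Section independence.
Context {d : measure_display} {T : measurableType d} {R : realType}.
Variable P : probability T R.
Implicit Types X Y Z : T -> R.

Definition independent2 X Y : Prop :=
  forall A B : set (measurableTypeR R), measurable A -> measurable B ->
    P (X @^-1` A `&` Y @^-1` B) = (P (X @^-1` A) * P (Y @^-1` B))%E.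

Section sqr.
Variables X Y : T -> R.
Hypotheses (mX : measurable_fun setT X) (mY : measurable_fun setT Y).
Hypothesis XY : independent2 X Y.
Hypothesis iY : P.-integrable setT (EFin \o Y).
Hypothesis EY : (\int[P]_w (Y w)%:E = 0)%E.

Let mXf : {mfun T >-> R} :=
  HB.pack X (isMeasurableFun.Build _ _ _ _ _ mX).
Let mYf : {mfun T >-> R} :=
  HB.pack Y (isMeasurableFun.Build _ _ _ _ _ mY).
Let mXY : measurable_fun setT (fun w => (X w, Y w) : R * R).
Proof. exact: measurable_fun_pair. Qed.
Let mXYf : {mfun T >-> (R * R)%type} :=
  HB.pack (fun w => (X w, Y w) : R * R)
   (isMeasurableFun.Build _ _ _ _ _ mXY).
Let muX := distribution P mXf.
Let muY := distribution P mYf.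

Lemma independent_tonelli (f : R * R -> R) :
  measurable_fun setT f ->
  (forall z, 0 <= f z) ->
  (\int[P]_w (f (X w, Y w))%:E = \int[muX]_x \int[muY]_y (f (x, y))%:E)%E.
Proof.
move=> mf f0.
pose g : R * R -> \bar R := fun z => (f z)%:E.
have mg : measurable_fun setT g by exact/measurable_EFinP.
transitivity (\int[distribution P mXYf]_z g z)%E.
  by rewrite ge0_integral_distribution// => z; rewrite lee_fin.
transitivity (\int[muX \x muY]_z g z)%E; last first.
  by rewrite fubini_tonelli1// => z; rewrite lee_fin.
apply: eq_measure_integral => A mA _; symmetry.
apply: product_measure_unique => // B C mB mC.
Qed.

Let msum : measurable_fun setT
  ((fun z => (z.1 + z.2) ^+ 2) : R * R -> R).
Proof.
by apply: measurable_funX; apply: measurable_funD.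
Qed.

Let iy : muY.-integrable setT (EFin : R -> \bar R).
Proof.
apply/integrableP; split; first by apply/measurable_EFinP; exact: measurable_id.
case/integrableP : iY => _; apply: le_lt_trans.
by rewrite ge0_integral_distribution//; apply: measurableT_comp => //;
  apply/measurable_EFinP; exact: measurable_id.
Qed.

Let Ey : (\int[muY]_y y%:E = 0)%E.
Proof.
rewrite -EY integral_distribution//; apply/measurable_EFinP; exact: measurable_id.
Qed.

(** For fixed [x], integrating [(x + y)^2 >= x^2 + 2 x y] against a centred law leaves [x^2]. The
    inequality holds in the extended reals and is used to deduce that [X] has a second moment from
    the fact that [X + Y] has one. *)
Lemma integral_sqr_le_add_independent :
  (\int[P]_w ((X w) ^+ 2)%:E <= \int[P]_w ((X w + Y w) ^+ 2)%:E)%E.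
Proof.
rewrite (independent_tonelli msum); last by move=> z; rewrite sqr_ge0.
have m2 : measurable_fun setT (fun x : R => (x ^+ 2)%:E).
  by apply/measurable_EFinP; exact: measurable_funX.
rewrite (_ : \int[P]_w ((X w) ^+ 2)%:E = \int[muX]_x (x ^+ 2)%:E)%E; last first.
  by rewrite ge0_integral_distribution// => x; rewrite lee_fin sqr_ge0.
apply: ge0_le_integral => //.
- by move=> x _; rewrite lee_fin sqr_ge0.
- apply: (@measurable_fun_fubini_tonelli_F _ _ _ _ _ muY
     (fun z : R * R => ((z.1 + z.2) ^+ 2)%:E)).
    exact/measurable_EFinP.
  by move=> z; rewrite lee_fin sqr_ge0.
move=> x _.
have ms : measurable_fun setT (fun y : R => ((x + y) ^+ 2)%:E).
  by apply/measurable_EFinP; apply: measurable_funX; exact: measurable_funD.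
have [finV|] := ltP (\int[muY]_y ((x + y) ^+ 2)%:E)%E (+oo)%E; last first.
  by rewrite leye_eq => /eqP ->; rewrite leey.
have i1 : muY.-integrable setT (fun y : R => ((x + y) ^+ 2)%:E).
  apply/integrableP; split => //.
  rewrite (eq_integral (fun y => ((x + y) ^+ 2)%:E))// => y _.
  by rewrite gee0_abs// lee_fin sqr_ge0.
have i2 : muY.-integrable setT (fun y : R => (2 * x)%:E * y%:E)%E.
  exact: integrableZl.
have i3 : muY.-integrable setT (cst (x ^+ 2)%:E).
  exact: finite_measure_integrable_cst.
have : (\int[muY]_y ((x ^+ 2)%:E + (2 * x)%:E * y%:E) <= \int[muY]_y ((x + y) ^+ 2)%:E)%E.
  apply: le_integral => //; first exact: integrableD.
  by move=> y _; rewrite -EFinM -EFinD lee_fin; have := sqr_ge0 y; nra.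
rewrite integralD// integralZl// Ey mule0 adde0 integral_cst//.
by rewrite [X in (_ * X)%E](_ : _ = 1%E) ?mule1//; exact: (probability_setT muY).
Qed.

Hypotheses (sX : square_integrable P X) (sY : square_integrable P Y).

Lemma inner_independent : inner P X Y = 0.
Proof.
have sXY := square_integrableD sX sY.
have m2 : measurable_fun setT (fun x : R => (x ^+ 2)%:E).
  by apply/measurable_EFinP; exact: measurable_funX.
(* Polarisation: only the nonnegative square of the sum has to go through Tonelli, never the product
   [X Y]. *)
suff : (\int[P]_w ((X w + Y w) ^+ 2)%:E =
        \int[P]_w ((X w) ^+ 2)%:E + \int[P]_w ((Y w) ^+ 2)%:E)%E.
  rewrite !integral_sqr_inner// -EFinD => -[].
  by rewrite innerDl// !innerDr// (innerC _ Y X); lra.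
rewrite (independent_tonelli msum); last by move=> z; rewrite sqr_ge0.
have EX2 : (\int[P]_w ((X w) ^+ 2)%:E = \int[muX]_x (x ^+ 2)%:E)%E.
  by rewrite ge0_integral_distribution// => x; rewrite lee_fin sqr_ge0.
have EY2 : (\int[P]_w ((Y w) ^+ 2)%:E = \int[muY]_x (x ^+ 2)%:E)%E.
  by rewrite ge0_integral_distribution// => x; rewrite lee_fin sqr_ge0.
have iy2 : muY.-integrable setT (fun y : R => (y ^+ 2)%:E).
  apply/integrableP; split => //.
  rewrite (eq_integral (fun y : R => (y ^+ 2)%:E)); last first.
    by move=> y _; rewrite gee0_abs// lee_fin sqr_ge0.
  by rewrite -EY2; case: sY.
transitivity (\int[muX]_x ((x ^+ 2)%:E + \int[muY]_y (y ^+ 2)%:E))%E.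
  apply: eq_integral => x _.
  have i2 : muY.-integrable setT (fun y : R => (2 * x)%:E * y%:E)%E.
    exact: integrableZl.
  have i3 : muY.-integrable setT (cst (x ^+ 2)%:E).
    exact: finite_measure_integrable_cst.
  transitivity (\int[muY]_y (((x ^+ 2)%:E + (2 * x)%:E * y%:E) + (y ^+ 2)%:E))%E.
    apply: eq_integral => y _; rewrite -EFinM -!EFinD; congr EFin => /=; ring.
  rewrite integralD//; last exact: integrableD.
  rewrite integralD// integralZl// Ey mule0 adde0 integral_cst//.
  by rewrite [X in (_ * X)%E](_ : _ = 1%E) ?mule1//; exact: (probability_setT muY).
rewrite ge0_integralD//.
- rewrite integral_cst// EX2 EY2.
  by rewrite [X in (_ * X)%E](_ : _ = 1%E) ?mule1//; exact: (probability_setT muX).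
- by move=> x _; rewrite lee_fin sqr_ge0.
- by move=> x _; apply: integral_ge0 => y _; rewrite lee_fin sqr_ge0.
Qed.

End sqr.
End independence.

(** * Increments of two-sided Levy processes *)

Section two_sided_levy.
Context {d : measure_display} {T : measurableType d} {R : realType}.
Variable P : probability T R.
Hypothesis hP : measure_is_complete P.
Implicit Types (X Y Z L : R -> T -> R).

Lemma ae_eq_probability (A B : set T) : measurable A -> measurable B ->
  {ae P, forall w, A w <-> B w} -> P A = P B.
Proof.
move=> mA mB [N [mN N0 sN]].
have half (C D : set T) : measurable C -> measurable D ->
    (forall w, ~ N w -> C w -> D w) -> (P C <= P D)%E.
  move=> mC mD H; rewrite -[leRHS]adde0 -N0; apply: le_trans (measureU2 _ _ _) => //.
  apply: le_measure; rewrite ?inE//; first exact: measurableU.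
  by move=> w Cw; have [|nNw] := pselect (N w); [right|left; exact: H].
apply/eqP; rewrite eq_le; apply/andP; split; apply: half => // w nN.
  by apply: contrapT => h; apply: nN; apply: sN => -[].
by apply: contrapT => h; apply: nN; apply: sN => -[].
Qed.

(** Along a sequence increasing to [t] the path converges to its left limit, and stochastic
    continuity gives convergence in probability to [Z t]; the two limits agree almost surely. This
    removes the left limit from the negative half of the two-sided process. *)
Lemma levy_left_limit Z t : is_levy_process P Z -> 0 < t ->
  {ae P, forall w, lim (Z s w @[s --> t^'-]) = Z t w}.
Proof.
move=> hZ t0.
pose s k : R := t - t / k.+2%:R.
have sk0 k : 0 <= s k < t.
  rewrite /s subr_ge0 ler_pdivrMr// ler_peMr ?(ltW t0) ?ler1n//=.
  by rewrite ltrBlDr ltrDl divr_gt0.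
have st : s k @[k --> \oo] --> t.
  rewrite -[X in _ --> X]subr0; apply: cvgB; first exact: cvg_cst.
  rewrite -[X in _ --> X](mulr0 t); apply: cvgMl_tmp.
  by have := @cvg_harmonic R; rewrite -cvg_shiftS.
pose l w := lim (Z s w @[s --> t^'-]).
have cl : {ae P, forall w, Z (s k) w @[k --> \oo] --> l w}.
  have := levy_cadlag hZ; apply: filterS => w [_ /(_ t t0) cw].
  apply: (@cvg_comp _ _ _ s (Z ^~ w) _ (t^'-)) => //.
  move=> A /= [e /= e0 eA]; have := st; move=> /cvgrPdist_lt/(_ _ e0)[N _ HN].
  exists N => // k /= Nk; apply: eA; first exact: HN.
  by case/andP : (sk0 k).
have mZs k : measurable_fun setT (Z (s k)).
  by apply: (levy_measurable hZ); case/andP : (sk0 k).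
have mZt : measurable_fun setT (Z t) by apply: (levy_measurable hZ); exact: ltW.
have ml : measurable_fun setT l by exact: (ae_cvg_measurable_fun hP mZs cl).
have c1 := ae_cvg_in_probability mZs ml cl.
have c2 : cvg_in_probability P (fun k => Z (s k)) (Z t).
  move=> e e0; have := levy_stochastically_continuous hZ (ltW t0) e0.
  apply: (@cvg_comp _ _ _ s _ _ (within (fun s : R => 0 <= s) (nbhs t))).
  move=> A HA; have [N _ HN] : \forall k \near \oo, 0 <= s k -> A (s k) := st _ HA.
  by exists N => // k Nk; apply: HN => //; case/andP : (sk0 k).
have mF k : measurable [set w | k.+1%:R^-1 < `|l w - Z t w|] by exact: measurable_dist_gt.
have F0 (e : R) : 0 < e -> P [set w | e + e < `|l w - Z t w|] = 0%E.
  move=> e0; apply/eqP; rewrite eq_le measure_ge0 andbT.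
  have L : (P [set w | (e < `|Z (s k) w - l w|)%R] + P [set w | (e < `|Z (s k) w - Z t w|)%R])%E
     @[k --> \oo] --> 0%E.
    by rewrite -[X in _ --> X](adde0 0%E); apply: cvgeD => //; [exact: c1|exact: c2].
  apply: cvge_ge L; apply: nearW => k.
  apply: le_trans (measureU2 _ _ _); try exact: measurable_dist_gt.
  apply: le_measure; rewrite ?inE.
  - exact: measurable_dist_gt.
  - by apply: measurableU; exact: measurable_dist_gt.
  move=> w /= h.
  have [h1|h1] := ltP e `|Z (s k) w - l w|; first by left.
  have [h2|h2] := ltP e `|Z (s k) w - Z t w|; first by right.
  exfalso; move: h; rewrite ltNge => /negP; apply.
  rewrite -(subrK (Z (s k) w) (l w)) -addrA (le_trans (ler_normD _ _))// lerD//.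
  by rewrite distrC.
suff : P.-negligible (\bigcup_k [set w | k.+1%:R^-1 < `|l w - Z t w|]).
  apply: negligibleS.
  move=> w /= /eqP; rewrite -subr_eq0 -normr_gt0 => h.
  exists (Num.truncn (`|l w - Z t w|^-1)) => //=.
  rewrite -[X in _ < X]invrK ltf_pV2 ?posrE ?invr_gt0//.
  by apply: real_truncnS_gt; exact: num_real.
apply: negligible_bigcup => k; apply/negligibleP => //.
have := F0 (k.+1%:R^-1 / 2); rewrite -splitr; apply.
by rewrite divr_gt0// invr_gt0.
Qed.

End two_sided_levy.

Section levy_increments.
Context {d : measure_display} {T : measurableType d} {R : realType}.
Variable P : probability T R.
Hypothesis hP : measure_is_complete P.
Implicit Types (X Y Z L : R -> T -> R).

Lemma sigma_nonneg_increment X (s t : R) (B : set (measurableTypeR R)) :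
  0 <= s -> 0 <= t -> measurable B ->
  sigma_nonneg X [set w | B (X t w - X s w)].
Proof.
move=> s0 t0 mB.
pose G := [set E | exists t (B : set (measurableTypeR R)),
        [/\ 0 <= t, measurable B & E = X t @^-1` B]].
have mX (r : R) : 0 <= r -> measurable_fun (setT : set (g_sigma_algebraType G)) (X r).
  move=> r0 _ C mC; rewrite setTI; apply: sub_sigma_algebra.
  by exists r, C; split.
have := measurable_funB (mX t t0) (mX s s0) measurableT mB.
by rewrite setTI.
Qed.

Lemma sigma_nonneg_bigcap X n (F : 'I_n -> set T) :
  (forall i, sigma_nonneg X (F i)) ->
  sigma_nonneg X (\bigcap_(i in [set: 'I_n]) F i).
Proof.
move=> H.
pose G := [set E | exists t (B : set (measurableTypeR R)),
        [/\ 0 <= t, measurable B & E = X t @^-1` B]].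
by apply: (@fin_bigcap_measurable _ (g_sigma_algebraType G)) => // i _; exact: H.
Qed.

(** Independence and stationarity of increments in one product formula. The index [k0] marks 0 as a
    division point, so that no increment straddles the point where the two halves are glued. *)
Definition has_increment_law L (q : R -> set (measurableTypeR R) -> \bar R) : Prop :=
  forall (tau : nat -> R) (k0 N : nat) (B : nat -> set (measurableTypeR R)),
  (forall i, tau i <= tau i.+1) -> tau k0 = 0 -> (forall j, measurable (B j)) ->
  P (\bigcap_(j in [set j | (j < k0 + N)%N])
       [set w | B j (L (tau j.+1) w - L (tau j) w)]) =
  (\prod_(j < k0 + N) q (tau j.+1 - tau j)%R (B j))%E.

Section two_sided.
Variables (L L1 L2 : R -> T -> R).
Hypotheses (levy1 : is_levy_process P L1) (levy2 : is_levy_process P L2).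
Hypotheses (law12 : same_law_nonneg P L1 L2)
  (ind12 : independent_processes_nonneg P L1 L2).
Hypothesis LE : L = two_sided L1 L2.

Definition increment_law (r : R) (B : set (measurableTypeR R)) : \bar R :=
  P [set w | B (L1 r w - L1 0 w)].

Lemma two_sided_nonneg t : 0 <= t -> {ae P, forall w, L t w = L1 t w}.
Proof. by move=> t0; apply: aeW => w; rewrite LE /two_sided t0. Qed.

Lemma two_sided_nonpos t : t <= 0 -> {ae P, forall w, L t w = - L2 (- t) w}.
Proof.
rewrite le_eqVlt => /predU1P[->|t0].
  have := levy_start levy1; have := levy_start levy2; rewrite LE /two_sided lexx oppr0.
  by move=> h2 h1; near=> w; rewrite (near h1 w)// (near h2 w)// oppr0.
have := levy_left_limit hP levy2 (_ : 0 < - t); rewrite oppr_gt0 => /(_ t0) h.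
by near=> w; rewrite LE /two_sided leNgt t0 /= (near h w).
Unshelve. all: by end_near. Qed.

Lemma measurable_two_sided t : measurable_fun setT (L t).
Proof.
have [t0|/ltW t0] := leP 0 t.
  by apply: (ae_eq_measurable_fun hP (two_sided_nonneg t0)); exact: (levy_measurable levy1).
apply: (ae_eq_measurable_fun hP (two_sided_nonpos t0)).
by apply: measurableT_comp => //; apply: (levy_measurable levy2); rewrite oppr_ge0.
Qed.

Lemma increment_law1 s t B : 0 <= s -> s <= t -> measurable B ->
  P [set w | B (L1 t w - L1 s w)] = increment_law (t - s) B.
Proof.
move=> s0 st mB; have := levy_stationary_increments levy1 s0 (_ : 0 <= t - s) mB.
by rewrite subr_ge0 => /(_ st); rewrite subrKC.
Qed.

Lemma increment_law2 s t B : 0 <= s -> s <= t -> measurable B ->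
  P [set w | B (L2 t w - L2 s w)] = increment_law (t - s) B.
Proof.
move=> s0 st mB; have := levy_stationary_increments levy2 s0 (_ : 0 <= t - s) mB.
rewrite subr_ge0 => /(_ st); rewrite subrKC => ->.
pose tt (i : 'I_2) : R := if i == ord0 then t - s else 0.
pose A : set (2.-tuple (measurableTypeR R)) :=
  [set x | B (tnth x ord0 - tnth x (lift ord0 ord0))].
have mA : measurable A.
  rewrite -[X in measurable X]setTI.
  have := measurable_funB (measurable_tnth (ord0 : 'I_2))
    (measurable_tnth (lift ord0 ord0 : 'I_2)).
  by move=> /(_ R) ; apply.
have tt0 i : 0 <= tt i by rewrite /tt; case: ifP => // _; rewrite subr_ge0.
have E (X : R -> T -> R) : fdd_event X tt A = [set w | B (X (t - s) w - X 0 w)].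
  by apply/seteqP; split => w; rewrite /fdd_event /A /= !tnth_mktuple.
by have := law12 tt0 mA; rewrite !E => <-.
Qed.

(** Cells to the right of 0 are increments of [L1], those to the left are increments of [L2] in
    reversed time. Independence of the halves splits the probability, and within each half the Levy
    property gives the product. *)
Lemma levy_increments_law : has_increment_law L increment_law.
Proof.
move=> tau k0 N B tauS tau0 mB.
have tau_mono i j : (i <= j)%N -> tau i <= tau j.
  by move=> /subnK <-; elim: (j - i)%N => [|n IH]; rewrite ?add0n// addSn (le_trans IH).
have mL t := measurable_two_sided t.
have mset X s t C : measurable_fun setT (X s) -> measurable_fun setT (X t) ->
    measurable C -> measurable [set w | C (X t w - X s w)].
  move=> ms mt mC; rewrite -[X in measurable X]setTI.
  exact: (measurable_funB mt ms).
pose E1 (i : 'I_N) := [set w | B (k0 + i)%N (L1 (tau (k0 + i).+1) w - L1 (tau (k0 + i)%N) w)].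
(* Time reversal: the [i]-th increment of [L2] away from 0 is the increment of [L] over the cell
   [k0 - i.+1], because the two signs cancel. *)
pose E2 (i : 'I_k0) :=
  [set w | B (k0 - i.+1)%N (L2 (- tau (k0 - i.+1)%N) w - L2 (- tau (k0 - i)%N) w)].
have t1 i : 0 <= tau (k0 + i)%N by rewrite -tau0 tau_mono// leq_addr.
have t2 i : 0 <= - tau (k0 - i)%N by rewrite oppr_ge0 -tau0 tau_mono// leq_subr.
have t1S i : 0 <= tau (k0 + i).+1 by rewrite -addnS.
have mE1 i : measurable (E1 i).
  exact: (mset L1 _ _ _ (levy_measurable levy1 (t1 i)) (levy_measurable levy1 (t1S i)) (mB _)).
have mE2 i : measurable (E2 i).
  exact: (mset L2 _ _ _ (levy_measurable levy2 (t2 i)) (levy_measurable levy2 (t2 i.+1)) (mB _)).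
transitivity (P (\bigcap_(i in [set: 'I_N]) E1 i `&` \bigcap_(i in [set: 'I_k0]) E2 i)).
  apply: ae_eq_probability.
  - by apply: bigcap_measurableType => j _; exact: (mset L _ _ _ (mL _) (mL _) (mB _)).
  - by apply: measurableI; apply: fin_bigcap_measurable => // i _.
  have h1 : {ae P, forall w, forall j, (k0 <= j)%N -> L (tau j) w = L1 (tau j) w}.
    apply/ae_foralln => j; have [kj|jk] := leqP k0 j; last by apply: aeW.
    have := two_sided_nonneg (_ : 0 <= tau j); rewrite -tau0 => /(_ (tau_mono _ _ kj)).
    by apply: filterS.
  have h2 : {ae P, forall w, forall j, (j <= k0)%N -> L (tau j) w = - L2 (- tau j) w}.
    apply/ae_foralln => j; have [jk|kj] := leqP j k0; last by apply: aeW.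
    have := two_sided_nonpos (_ : tau j <= 0); rewrite -tau0 => /(_ (tau_mono _ _ jk)).
    by apply: filterS.
  near=> w.
  have w1 := near h1 w _; have w2 := near h2 w _.
  have e1 (i : nat) : L (tau (k0 + i).+1) w - L (tau (k0 + i)%N) w =
      L1 (tau (k0 + i).+1) w - L1 (tau (k0 + i)%N) w.
    by rewrite !w1// ?leq_addr// -addnS leq_addr.
  have e2 (i : nat) : (i < k0)%N -> L (tau (k0 - i.+1).+1) w - L (tau (k0 - i.+1)%N) w =
      L2 (- tau (k0 - i.+1)%N) w - L2 (- tau (k0 - i)%N) w.
    by move=> ik; rewrite subnSK// !w2 ?leq_subr// opprK addrC.
  split.
    move=> H; split => [i _|i _]; rewrite /E1 /E2 /=.
      by rewrite -e1; apply: (H (k0 + i)%N); rewrite /= ltn_add2l.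
    rewrite -e2//; have := H (k0 - i.+1)%N; rewrite /= subnSK//; apply.
    by have := ltn_ord i; lia.
  move=> [H1 H2] j /= jN; have [kj|jk] := leqP k0 j.
    have iN : (j - k0 < N)%N by rewrite ltn_subLR.
    by have := H1 (Ordinal iN) I; rewrite /E1 /= -e1 subnKC.
  have ik : (k0 - j.+1 < k0)%N by rewrite ltn_subrL/=; case: (k0) jk.
  have := H2 (Ordinal ik) I; rewrite /E2 /= -e2//.
  by rewrite (_ : (k0 - (k0 - j.+1).+1)%N = j); [|lia].
rewrite ind12; last 2 first.
- by apply: sigma_nonneg_bigcap => i; exact: (sigma_nonneg_increment (t1 i) (t1S i) (mB _)).
- by apply: sigma_nonneg_bigcap => i; exact: (sigma_nonneg_increment (t2 i) (t2 i.+1) (mB _)).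
have -> : P (\bigcap_(i in [set: 'I_N]) E1 i) =
    (\prod_(i < N) increment_law (tau (k0 + i).+1 - tau (k0 + i)%N) (B (k0 + i)%N))%E.
  have /= := levy_independent_increments levy1 (n := N) (t := fun i => tau (k0 + i)%N).
  move=> /(_ (t1 0%N)); have tS i : tau (k0 + i)%N <= tau (k0 + i.+1)%N by rewrite addnS.
  move=> /(_ tS (fun i => B (k0 + i)%N) (fun i => mB _)) => H.
  rewrite /E1; under eq_bigcapr do rewrite -addnS.
  rewrite H; apply: eq_bigr => i _; rewrite -addnS.
  exact: (increment_law1 (t1 i) (tS i) (mB _)).
have -> : P (\bigcap_(i in [set: 'I_k0]) E2 i) =
    (\prod_(j < k0) increment_law (tau j.+1 - tau j) (B j))%E.
  have tS i : - tau (k0 - i)%N <= - tau (k0 - i.+1)%N.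
    by rewrite lerN2 tau_mono// leq_sub2l.
  have /= := levy_independent_increments levy2 (n := k0) (t := fun i => - tau (k0 - i)%N).
  move=> /(_ (t2 0%N) tS (fun i => B (k0 - i.+1)%N) (fun i => mB _)) => H.
  rewrite H (reindex_inj rev_ord_inj)/=; apply: eq_bigr => i _.
  rewrite (_ : (k0 - (k0 - i.+1).+1)%N = i); last by have := ltn_ord i; lia.
  rewrite (_ : (k0 - (k0 - i.+1))%N = i.+1); last by have := ltn_ord i; lia.
  rewrite [LHS]increment_law2//.
  - by rewrite opprK addrC.
  - rewrite oppr_ge0 -tau0 tau_mono//.
  - by rewrite lerN2.
  - exact: mB.
by rewrite muleC big_split_ord.
Unshelve. all: by end_near. Qed.

End two_sided.
End levy_increments.

(** * Shift invariance of increments and of step integrals *)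

Section independent_increments.
Context {d : measure_display} {T : measurableType d} {R : realType}.
Variable P : probability T R.
Variable (L : R -> T -> R) (q : R -> set (measurableTypeR R) -> \bar R).
Hypothesis mL : forall t, measurable_fun setT (L t).
Hypothesis q1 : forall r, q r setT = 1%E.
Hypothesis incr : has_increment_law P L q.

Lemma two_increments x y z (A B : set (measurableTypeR R)) :
  x <= y -> y <= z -> [\/ x = 0, y = 0 | z = 0] -> measurable A -> measurable B ->
  P ([set w | A (L y w - L x w)] `&` [set w | B (L z w - L y w)]) =
  (q (y - x) A * q (z - y) B)%E.
Proof.
move=> xy yz xyz0 mA mB.
(* Constant from index 2 on; one of the three points is 0, as [has_increment_law] demands. *)
pose tau i : R := if i is i'.+1 then if i' is _.+1 then z else y else x.
have tauS i : tau i <= tau i.+1 by case: i => [|[|i]] //=.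
have [k0 [k02 tau0]] : exists k0, (k0 <= 2)%N /\ tau k0 = 0.
  by case: xyz0 => h; [exists 0%N|exists 1%N|exists 2%N].
have := @incr tau k0 (2 - k0)%N (fun j => if j is 0%N then A else B) tauS tau0 _.
rewrite subnKC// !big_ord_recr big_ord0/= mul1e => <-; last by case.
congr (P _); apply/seteqP; split => w /=.
  by move=> [h1 h2] [|[|]].
by move=> h; split; [exact: (h 0%N)|exact: (h 1%N)].
Qed.

Lemma increment_distribution x y (A : set (measurableTypeR R)) :
  x <= y -> (0 <= x) || (y <= 0) -> measurable A ->
  P [set w | A (L y w - L x w)] = q (y - x) A.
Proof.
move=> xy xy0 mA; have [x0|y0] : 0 <= x \/ y <= 0 by apply/orP.
  have := @two_increments 0 x y setT A x0 xy (Or31 _ _ erefl) measurableT mA.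
  by rewrite q1 mul1e setTI.
have := @two_increments x y 0 A setT xy y0 (Or33 _ _ erefl) mA measurableT.
by rewrite q1 mule1 setIT.
Qed.

Lemma increments_independent x y z : x <= y -> y <= z ->
  [\/ x = 0, y = 0 | z = 0] ->
  independent2 P (fun w => L y w - L x w) (fun w => L z w - L y w).
Proof.
move=> xy yz xyz0 A B mA mB.
have := two_increments xy yz xyz0 mA mB.
have s1 : (0 <= x) || (y <= 0).
  by case: xyz0 => h; apply/orP; [left; rewrite h|right; rewrite h|right; rewrite -h].
have s2 : (0 <= y) || (z <= 0).
  by case: xyz0 => h; apply/orP; [left; rewrite -h|left; rewrite h|right; rewrite h].
by rewrite -(increment_distribution xy s1 mA) -(increment_distribution yz s2 mB).
Qed.

(** Both [tau] and [tau + h] must pass through 0, hence the two marked points 0 and [-h]. Then the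
    product formula gives the same value for both, as cell lengths do not change. *)
Lemma increments_shift_law (tau : nat -> R) (h : R) (k0 k1 m : nat) :
  (forall i, tau i <= tau i.+1) -> tau k0 = 0 -> tau k1 = - h ->
  (k0 <= m)%N -> (k1 <= m)%N ->
  same_law P (fun (j : 'I_m) w => L (tau j.+1 + h) w - L (tau j + h) w)
    (fun (j : 'I_m) w => L (tau j.+1) w - L (tau j) w).
Proof.
move=> tauS tau0 tau1 k0m k1m.
have meas (t : nat -> R) (j : nat) : measurable_fun setT (fun w => L (t j.+1) w - L (t j) w).
  exact: measurable_funB.
apply: same_law_upper => [j|j|a].
- exact: (meas (fun i => tau i + h)).
- exact: meas.
pose B (j : nat) : set (measurableTypeR R) :=
  if (insub j : option 'I_m) is Some i then [set` `]a i, +oo[] else setT.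
have mB j : measurable (B j).
  by rewrite /B; case: insub => [i|]; [exact: measurable_itv|exact: measurableT].
have key (t : nat -> R) : upper_event (fun (j : 'I_m) w => L (t j.+1) w - L (t j) w) a =
    \bigcap_(j in [set j | (j < m)%N]) [set w | B j (L (t j.+1) w - L (t j) w)].
  apply/seteqP; split => [w H j /= jm|w H j].
    by rewrite /B insubT /= in_itv/= andbT; exact: (H (Ordinal jm)).
  by have := H j (ltn_ord j); rewrite /= /B (valK j) /= in_itv/= andbT.
rewrite (key (fun i => tau i + h)) (key tau).
have := @incr tau k0 (m - k0)%N B tauS tau0 mB; rewrite subnKC// => ->.
have := @incr (fun i => tau i + h) k1 (m - k1)%N B; rewrite subnKC// => ->//.
- by apply: eq_bigr => j _; congr q; ring.
- by move=> i; rewrite lerD2r.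
- by rewrite tau1 addNr.
Qed.

Definition shift_steps (h : R) (s : seq (R * R * R)) : seq (R * R * R) :=
  [seq (r.1.1, r.1.2 + h, r.2 + h) | r <- s].

(** All step integrals are linear images of the increments over one common partition through 0, [-h]
    and every step end, and the shifted ones are the same images of the shifted increments. *)
Lemma step_integral_shift_law n (s : 'I_n -> seq (R * R * R)) (h : R) :
  same_law P (fun i => step_integral L (shift_steps h (s i)))
    (fun i => step_integral L (s i)).
Proof.
pose ends : seq R := [:: 0, - h & flatten [seq flatten [seq [:: r.1.2; r.2] | r <- s i] | i <- enum 'I_n]].
pose pts := sort <=%R ends.
have ptsE x : (x \in pts) = (x \in ends) by rewrite mem_sort.
have spts : sorted <=%R pts by apply: sort_sorted; exact: le_total.
have pts0 : (0 < size pts)%N by rewrite size_sort.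
pose m := size pts.
(* The default is the last point, so that [tau] stays nondecreasing beyond the list. *)
pose tau i := nth (last 0 pts) pts i.
have tauS i : tau i <= tau i.+1.
  have [im|im] := ltnP i.+1 m.
    by move/sortedP : spts => /(_ (last 0 pts) i im).
  rewrite /tau (nth_default _ im).
  have [im'|im'] := ltnP i m; last by rewrite nth_default.
  have -> : i = m.-1 by move: im im'; rewrite -/m; lia.
  by rewrite nth_last; case: (pts) pts0.
have tauK x : x \in ends -> tau (index x pts) = x.
  by rewrite -ptsE => xp; rewrite /tau nth_index.
have idx x : x \in ends -> (index x pts <= m)%N by move=> _; exact: index_size.
have in0 : 0 \in ends by rewrite /ends inE eqxx.
have inh : - h \in ends by rewrite /ends !inE eqxx orbT.
have inends i r : r \in s i -> r.1.2 \in ends /\ r.2 \in ends.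
  move=> ri; rewrite /ends !inE.
  suff H x : x \in [:: r.1.2; r.2] ->
      x \in flatten [seq flatten [seq [:: r.1.2; r.2] | r <- s i] | i <- enum 'I_n].
    by rewrite !H ?inE ?eqxx ?orbT.
  move=> xr; apply/flattenP; exists (flatten [seq [:: r.1.2; r.2] | r <- s i]).
    by apply/mapP; exists i => //; rewrite mem_enum.
  by apply/flattenP; exists [:: r.1.2; r.2] => //; apply/mapP; exists r.
(* An increment of [L] is the difference of two telescoping sums from the first point; this needs no
   order between the ends of a step. *)
pose cf (i : 'I_n) (j : 'I_m) : R := \sum_(r <- s i)
  r.1.1 * ((j < index r.2 pts)%N%:R - (j < index r.1.2 pts)%N%:R).
pose F (x : m.-tuple (measurableTypeR R)) : n.-tuple (measurableTypeR R) :=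
  [tuple ((\sum_(j < m) cf i j * (tnth x j : R)) : measurableTypeR R) | i < n].
have tele (t : nat -> R) w k : (k <= m)%N ->
    \sum_(j < m) (j < k)%N%:R * (L (t j.+1) w - L (t j) w) = L (t k) w - L (t 0%N) w.
  move=> km; rewrite -(big_mkord xpredT (fun j => (j < k)%N%:R * (L (t j.+1) w - L (t j) w))).
  rewrite (big_cat_nat (n := k))//= [X in _ + X]big_nat_cond.
  rewrite [X in _ + X]big1 ?addr0; last first.
    by move=> j /andP[/andP[kj _] _]; rewrite ltnNge kj mul0r.
  rewrite big_nat_cond; under eq_bigr => j /andP[/andP[_ jk] _] do rewrite jk mul1r.
  by rewrite -big_nat_cond telescope_sumr.
have E (t : nat -> R) (sf : R -> R) i w :
    (forall x, x \in ends -> t (index x pts) = sf x) ->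
    \sum_(r <- s i) r.1.1 * (L (sf r.2) w - L (sf r.1.2) w) =
    \sum_(j < m) cf i j * (L (t j.+1) w - L (t j) w).
  move=> tsf.
  under [RHS]eq_bigr do rewrite /cf mulr_suml.
  rewrite exchange_big/= big_seq [RHS]big_seq; apply: eq_bigr => r ri.
  have [e1 e2] := inends _ _ ri.
  under eq_bigr do rewrite -mulrA mulrBl.
  rewrite -mulr_sumr sumrB !tele ?idx// !tsf//; congr (_ * _); ring.
apply: (@same_law_map _ _ _ P m n
  (fun (j : 'I_m) w => L (tau j.+1 + h) w - L (tau j + h) w)
  (fun (j : 'I_m) w => L (tau j.+1) w - L (tau j) w) _ _ F).
- apply/measurable_fun_tnthP => i.
  suff -> : (@tnth n (measurableTypeR R) ^~ i) \o F =
      (fun x : m.-tuple (measurableTypeR R) => \sum_(j < m) cf i j * (tnth x j : R)).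
    apply: measurable_sum => j; apply: measurable_funM; first exact: measurable_cst.
    exact: measurable_tnth.
  by apply: funext => x /=; rewrite /F tnth_mktuple.
- move=> w; apply: eq_from_tnth => i; rewrite !tnth_mktuple.
  rewrite /step_integral /shift_steps big_map/=.
  rewrite (E (fun i => tau i + h) (fun x => x + h)); last by move=> x /tauK ->.
  by apply: eq_bigr => j _; rewrite tnth_mktuple.
- move=> w; apply: eq_from_tnth => i; rewrite !tnth_mktuple.
  rewrite /step_integral (E tau id)//.
  by apply: eq_bigr => j _; rewrite tnth_mktuple.
apply: (@increments_shift_law tau h (index 0 pts) (index (- h) pts) m tauS) => //.
- exact: tauK.
- exact: tauK.
- exact: idx.
- exact: idx.
Qed.

End independent_increments.

(** * Variances and covariances of Levy increments *)

Section moments.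
Context {d : measure_display} {T : measurableType d} {R : realType}.
Variable P : probability T R.

(** If the positive or the negative part had infinite integral, the difference would be infinite in
    the extended reals, hence not 0. *)
Lemma integral0_integrable (X : T -> R) : measurable_fun setT X ->
  (\int[P]_w (X w)%:E = 0)%E -> P.-integrable setT (EFin \o X).
Proof.
move=> mX; have mE : measurable_fun setT (EFin \o X) by exact/measurable_EFinP.
rewrite integralE => H; apply/integrableP; split => //.
have p0 : (0 <= \int[P]_x (EFin \o X)^\+ x)%E by apply: integral_ge0.
have n0 : (0 <= \int[P]_x (EFin \o X)^\- x)%E by apply: integral_ge0.
rewrite (eq_integral (fun x => ((EFin \o X)^\+ x + (EFin \o X)^\- x)%E)); last first.
  by move=> x _; rewrite -[RHS]/(((EFin \o X)^\+ \+ (EFin \o X)^\-)%E x) -fune_abse.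
rewrite ge0_integralD//; [|exact: measurable_funepos|exact: measurable_funeneg].
by move: H p0 n0; case: (integral _ _ _) => [r||]; case: (integral _ _ _) => [r'||] //=;
  rewrite ltry.
Qed.

Lemma eq_law_integral_sqr (X Y : T -> R) :
  measurable_fun setT X -> measurable_fun setT Y ->
  (forall A : set (measurableTypeR R), measurable A ->
     P [set w | A (X w)] = P [set w | A (Y w)]) ->
  (\int[P]_w ((X w) ^+ 2)%:E = \int[P]_w ((Y w) ^+ 2)%:E)%E.
Proof.
move=> mX mY XY.
pose X' : {mfun T >-> R} := HB.pack X (isMeasurableFun.Build _ _ _ _ _ mX).
pose Y' : {mfun T >-> R} := HB.pack Y (isMeasurableFun.Build _ _ _ _ _ mY).
have m2 : measurable_fun setT (fun x : R => (x ^+ 2)%:E).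
  by apply/measurable_EFinP; exact: measurable_funX.
transitivity (\int[distribution P X']_x (x ^+ 2)%:E)%E.
  by rewrite ge0_integral_distribution// => x; rewrite lee_fin sqr_ge0.
transitivity (\int[distribution P Y']_x (x ^+ 2)%:E)%E; last first.
  by rewrite ge0_integral_distribution// => x; rewrite lee_fin sqr_ge0.
by apply: eq_measure_integral => A mA _; exact: XY.
Qed.

(** Cauchy's functional equation: nonnegativity makes [u] monotone, and monotonicity forces
    linearity between integer points. *)
Lemma additive_nonneg_linear (u : R -> R) : (forall r, 0 <= r -> 0 <= u r) ->
  (forall s r, 0 <= s -> 0 <= r -> u (s + r) = u s + u r) ->
  forall r, 0 <= r -> u r = r * u 1.
Proof.
move=> u0 uD.
have u00 : u 0 = 0 by have := uD 0 0 (lexx _) (lexx _); rewrite addr0; lra.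
have uN n r : 0 <= r -> u (n%:R * r) = n%:R * u r.
  move=> r0; elim: n => [|n IH]; first by rewrite !mul0r.
  by rewrite -natr1 !mulrDl !mul1r uD ?mulr_ge0// IH.
have umono s t : 0 <= s -> s <= t -> u s <= u t.
  move=> s0 st; rewrite -(subrKC s t) uD ?subr_ge0// lerDl u0// subr_ge0//.
have uk k : u k%:R = k%:R * u 1 by rewrite -[in LHS](mulr1 k%:R) uN.
move=> r r0; apply/eqP; rewrite -subr_eq0 -normr_le0; apply/ler_addgt0Pl => e e0.
rewrite addr0.
have u10 := u0 1 ler01.
(* With [k <= N r < k + 1], both [u (N r)] and [N r u 1] lie between [k u 1] and [(k + 1) u 1], so
   [N] times the error is at most [u 1 < N e]. *)
pose N := (Num.truncn (u 1 / e)).+1.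
have Ne : u 1 / e < N%:R by apply: real_truncnS_gt; exact: num_real.
have N0 : 0 < N%:R :> R by rewrite ltr0n.
have Nr0 : 0 <= N%:R * r by rewrite mulr_ge0// ltW.
have /andP[k1 k2] := truncn_itv Nr0.
set k := Num.truncn _ in k1 k2.
have := umono _ _ (ler0n _ _) k1; have := umono _ _ Nr0 (ltW k2).
rewrite (uN _ _ r0) !uk -natr1 => h1 h2.
rewrite ltr_pdivrMr// in Ne.
rewrite -(ler_pM2l N0).
have -> : N%:R * `|u r - r * u 1| = `|N%:R * (u r - r * u 1)|.
  by rewrite normrM (ger0_norm (ltW N0)).
rewrite ler_norml.
by apply/andP; split; nra.
Qed.

Section levy.
Variable (L : R -> T -> R) (q : R -> set (measurableTypeR R) -> \bar R).
Hypothesis mL : forall t, measurable_fun setT (L t).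
Hypothesis q1 : forall r, q r setT = 1%E.
Hypothesis incr : has_increment_law P L q.
Hypothesis L0 : {ae P, forall w, L 0 w = 0}.
Hypothesis EL : forall t, ('E_P[L t] = 0)%E.
Hypothesis EL1 : ('E_P[fun w => ((L 1 w) ^+ 2)%R] < +oo)%E.

Let D s t w := L t w - L s w.

Let mD s t : measurable_fun setT (D s t).
Proof. exact: measurable_funB. Qed.

Let iL t : P.-integrable setT (EFin \o L t).
Proof. by apply: integral0_integrable => //; have := EL t; rewrite unlock. Qed.

Let iD s t : P.-integrable setT (EFin \o D s t).
Proof.
by have := integrableB measurableT (iL t) (iL s); apply: eq_integrable.
Qed.

Let ED s t : (\int[P]_w (D s t w)%:E = 0)%E.
Proof.
rewrite /D; under eq_integral do rewrite EFinB.
rewrite (integralB measurableT (iL t) (iL s)).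
by have := EL t; have := EL s; rewrite unlock => -> ->; rewrite sube0.
Qed.

Let law_sqr s t : s <= t -> (0 <= s) || (t <= 0) ->
  (\int[P]_w ((D s t w) ^+ 2)%:E = \int[P]_w ((D 0 (t - s) w) ^+ 2)%:E)%E.
Proof.
move=> st st0; apply: eq_law_integral_sqr => // A mA.
rewrite (increment_distribution q1 incr st st0 mA).
by rewrite (increment_distribution q1 incr _ _ mA) ?lexx// ?subr0// subr_ge0.
Qed.

Let law_square_integrable s t : s <= t -> (0 <= s) || (t <= 0) ->
  square_integrable P (D 0 (t - s)) -> square_integrable P (D s t).
Proof. by move=> st st0 [_ h]; split => //; rewrite law_sqr. Qed.

Let D_split s t u w : D s t w + D t u w = D s u w.
Proof. by rewrite /D; ring. Qed.

Let si1 : square_integrable P (D 0 1).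
Proof.
split => //; move: EL1; rewrite unlock; apply: le_lt_trans.
rewrite le_eqVlt; apply/orP; left; apply/eqP; apply: ae_eq_integral => //.
- exact: measurable_EFin_sqr.
- exact: measurable_EFin_sqr.
by move: L0; apply: filterS => w h _; rewrite /D h subr0.
Qed.

Let si_add s r : 0 <= s -> 0 <= r -> square_integrable P (D 0 s) ->
  square_integrable P (D 0 r) -> square_integrable P (D 0 (s + r)).
Proof.
move=> s0 r0 hs hr.
have h2 : square_integrable P (D s (s + r)).
  by apply: law_square_integrable; rewrite ?lerDl ?s0// addrAC subrr add0r.
have := square_integrableD hs h2.
by under eq_fun do rewrite D_split.
Qed.

(** Times up to 1 are dominated by time 1, since the remaining increment is independent and centred.
    Integer times and then all times follow by adding increments. *)
Let si r : 0 <= r -> square_integrable P (D 0 r).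
Proof.
have si01 s : 0 <= s <= 1 -> square_integrable P (D 0 s).
  move=> /andP[s0 s1]; split => //; case: si1 => _; apply: le_lt_trans.
  apply: le_trans (integral_sqr_le_add_independent (mD 0 s) (mD s 1) _ (iD s 1) (ED s 1)) _.
    by apply: (increments_independent q1 incr) => //; exact: Or31.
  rewrite le_eqVlt; apply/orP; left; apply/eqP; apply: eq_integral => w _.
  by rewrite D_split.
have sin n : square_integrable P (D 0 n%:R).
  elim: n => [|n IH]; first by apply: si01; rewrite lexx ler01.
  by rewrite -natr1; apply: si_add.
move=> r0; have /andP[n1 n2] := truncn_itv r0.
rewrite -(subrKC (Num.truncn r)%:R r); apply: si_add => //; first by rewrite subr_ge0.
by apply: si01; rewrite subr_ge0 n1/=; move: n2; rewrite -natr1; lra.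
Qed.

Definition levy_variance := inner P (fun w => L 1 w - L 0 w) (fun w => L 1 w - L 0 w).

Let u r := inner P (D 0 r) (D 0 r).

Let u_law s t : s <= t -> (0 <= s) || (t <= 0) ->
  inner P (D s t) (D s t) = u (t - s).
Proof.
move=> st st0; have h := si (_ : 0 <= t - s); rewrite subr_ge0 in h.
have := law_sqr st st0.
rewrite !integral_sqr_inner; [by case|exact: h|].
by apply: law_square_integrable => //; exact: h.
Qed.

Let u_linear r : 0 <= r -> u r = r * levy_variance.
Proof.
apply: additive_nonneg_linear => [s _|s t s0 t0]; first exact: inner_ge0.
have st : s <= s + t by rewrite lerDl.
have hD : square_integrable P (D s (s + t)).
  by apply: law_square_integrable => //; rewrite ?s0// addrAC subrr add0r; exact: si.
have I := inner_independent (mD 0 s) (mD s (s + t))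
  (increments_independent q1 incr s0 st (Or31 _ _ erefl)) (iD _ _) (ED _ _) (si s0) hD.
have hs0 := si s0.
rewrite {1}/u (_ : D 0 (s + t) = fun w => D 0 s w + D s (s + t) w); last first.
  by apply/funext => w; rewrite D_split.
have e : s + t - s = t by rewrite addrAC subrr add0r.
rewrite (inner_sqrD hs0 hD) I (u_law st) ?s0// e /u; ring.
Qed.

Lemma increment_square_integrable s t :
  square_integrable P (fun w => L t w - L s w).
Proof.
wlog st : s t / s <= t.
  move=> W; have [st|/ltW ts] := leP s t; first exact: W.
  have := square_integrableZ (-1) (W _ _ ts).
  by under eq_fun do rewrite mulN1r opprB.
have [st0|] := boolP ((0 <= s) || (t <= 0)).
  by apply: law_square_integrable => //; apply: si; rewrite subr_ge0.
rewrite negb_or -!ltNge => /andP[s0 t0].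
have h1 : square_integrable P (D s 0).
  apply: law_square_integrable; rewrite ?lexx ?orbT ?(ltW s0)//.
  by apply: si; rewrite sub0r oppr_ge0 ltW.
have := square_integrableD h1 (si (ltW t0)).
by under eq_fun do rewrite D_split.
Qed.

Lemma increment_variance s t :
  inner P (fun w => L t w - L s w) (fun w => L t w - L s w) =
  `|t - s| * levy_variance.
Proof.
wlog st : s t / s <= t.
  move=> W; have [st|/ltW ts] := leP s t; first exact: W.
  rewrite distrC -W// /inner; apply: eq_Rintegral => w _; ring.
rewrite ger0_norm ?subr_ge0//.
have [st0|] := boolP ((0 <= s) || (t <= 0)).
  by rewrite [LHS]u_law// u_linear// subr_ge0.
rewrite negb_or -!ltNge => /andP[s0 t0].
have h1 : square_integrable P (D s 0) by exact: increment_square_integrable.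
have h2 := si (ltW t0).
have I := inner_independent (mD s 0) (mD 0 t)
  (increments_independent q1 incr (ltW s0) (ltW t0) (Or32 _ _ erefl))
  (iD _ _) (ED _ _) h1 h2.
rewrite (_ : (fun w => L t w - L s w) = fun w => D s 0 w + D 0 t w); last first.
  by apply/funext => w; rewrite D_split.
rewrite (inner_sqrD h1 h2) I.
rewrite (u_law (ltW s0)) ?lexx ?orbT// -/(u t) !u_linear ?subr_ge0 ?(ltW s0) ?(ltW t0)//.
ring.
Qed.

(** Polarisation of the variance. The bracket over 2 is the signed length of the overlap of the two
    intervals; absolute values spare a case distinction on their order, and [inner_box] has the same
    form. *)
Lemma increment_covariance a b c e :
  inner P (fun w => L b w - L a w) (fun w => L e w - L c w) =
  (`|b - c| + `|a - e| - `|b - e| - `|a - c|) / 2 * levy_variance.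
Proof.
pose W t w := L t w - L 0 w.
have hW t : square_integrable P (W t) by exact: increment_square_integrable.
have WE s t : inner P (W s) (W t) = (`|s| + `|t| - `|s - t|) / 2 * levy_variance.
  have := inner_sqrB (hW s) (hW t).
  rewrite (_ : (fun w => W s w - W t w) = (fun w => L s w - L t w)); last first.
    by apply/funext => w; rewrite /W; ring.
  by rewrite !increment_variance !subr0; lra.
have E s t : (fun w => L t w - L s w) = (fun w => W t w - W s w).
  by apply/funext => w; rewrite /W; ring.
have hWB s t := square_integrableB (hW s) (hW t).
rewrite !E.
have -> : inner P (fun w => W b w - W a w) (fun w => W e w - W c w) =
    inner P (W b) (W e) - inner P (W b) (W c) - (inner P (W a) (W e) - inner P (W a) (W c)).
  by rewrite innerBl ?(innerBr (hW e) (hW c))//; exact: hWB.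
rewrite !WE; lra.
Qed.

End levy.
End moments.

(** * Integrals of step functions and their limits *)

Section lebesgue_translation.
Context {R : realType}.
Local Notation leb := (@lebesgue_measure R).

Lemma integral_translation (f : R -> \bar R) (h : R) :
  measurable_fun setT f -> (forall x, 0 <= f x)%E ->
  (\int[leb]_x f (x - h)%R = \int[leb]_x f x)%E.
Proof.
move=> mf f0.
pose phi (x : measurableTypeR R) : measurableTypeR R := x - h.
have mphi : measurable_fun setT phi by exact: measurable_funB.
pose nu : {measure set (measurableTypeR R) -> \bar R} :=
  measure_function_pushforward__canonical__measure_function_Measure leb mphi.
transitivity (\int[nu]_x f x)%E.
  by rewrite (ge0_integral_pushforward mphi)// preimage_setT.
apply: eq_measure_integral => A mA _; symmetry.
apply: (@lebesgue_measure_unique R nu) => //.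
move=> _ [[a b] _ <-] /=; rewrite /nu /= /pushforward /phi.
rewrite [X in _ = leb X](_ : _ = [set` `]a + h, b + h]]); last first.
  by apply/seteqP; split => x /=; rewrite !in_itv/= ltrBrDr lerBlDr.
rewrite !lebesgue_measure_itv/= !lte_fin ltrD2r.
by case: ifP => // _; rewrite -!EFinB; congr EFin; ring.
Qed.

Definition box (a b x : R) : R := ((a < x) && (x <= b))%R%:R.

Lemma boxE a b : box a b = \1_[set` `]a, b]].
Proof. by apply/funext => x; rewrite /box indicE mem_setE in_itv. Qed.

Lemma measurable_box a b : measurable_fun setT (box a b).
Proof.
rewrite boxE; have m := @measurable_itv R `]a, b].
exact: (@measurable_indic _ (measurableTypeR R) R setT _ m).
Qed.

Lemma box_sqr a b x : box a b x ^+ 2 = box a b x.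
Proof. by rewrite /box; case: (_ && _); rewrite ?expr1n ?expr0n. Qed.

Lemma integral_box a b :
  (\int[leb]_x (box a b x)%:E = if (a < b)%R then (b - a)%:E else 0)%E.
Proof.
rewrite boxE integral_indic//.
rewrite setIT [LHS](lebesgue_measure_itv `]a, b])/= lte_fin.
by case: ifP.
Qed.

Lemma box_square_integrable a b : square_integrable leb (box a b).
Proof.
split; first exact: measurable_box.
under eq_integral do rewrite box_sqr.
by rewrite integral_box; case: ifP; rewrite ltry.
Qed.

Lemma inner_box a b c e : a <= b -> c <= e ->
  inner leb (box a b) (box c e) = (`|b - c| + `|a - e| - `|b - e| - `|a - c|) / 2.
Proof.
move=> ab ce.
have -> : inner leb (box a b) (box c e) =
    fine (\int[leb]_x (box (Num.max a c) (Num.min b e) x)%:E)%E.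
  congr fine; apply: eq_integral => x _; congr EFin.
  rewrite /box gt_max le_min.
  by case: (a < x); case: (c < x); case: (x <= b); case: (x <= e) => /=; rewrite ?(mulr0, mul0r, mulr1).
rewrite integral_box.
have [h1|h1] := leP a c; have [h2|h2] := leP b e; case: ltP => /= h3;
  have [l1|l1] := ger0P (b - c); have [l2|l2] := ger0P (a - e);
  have [l3|l3] := ger0P (b - e); have [l4|l4] := ger0P (a - c);
  lra.
Qed.

End lebesgue_translation.

Section step_functions.
Context {d : measure_display} {T : measurableType d} {R : realType}.
Variable P : probability T R.
Local Notation leb := (@lebesgue_measure R).
Implicit Types (s : seq (R * R * R)).

Definition ordered_steps s := forall r, r \in s -> r.1.2 <= r.2.

Definition sub_steps s s' : seq (R * R * R) :=
  s ++ [seq (- r.1.1, r.1.2, r.2) | r <- s'].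

Lemma ordered_sub_steps s s' : ordered_steps s -> ordered_steps s' ->
  ordered_steps (sub_steps s s').
Proof.
move=> h h' r; rewrite mem_cat => /orP[/h//|/mapP[r' /h' ? ->]//].
Qed.

Lemma ordered_shift_steps h s : ordered_steps s -> ordered_steps (shift_steps h s).
Proof. by move=> hs r /mapP[r' /hs ? ->] /=; rewrite lerD2r. Qed.

Lemma step_fun_sub s s' x : step_fun (sub_steps s s') x = step_fun s x - step_fun s' x.
Proof.
rewrite /step_fun /sub_steps big_cat big_map/= -sumrN; congr (_ + _).
by apply: eq_bigr => r _; rewrite mulNr.
Qed.

Lemma step_integral_sub (L : R -> T -> R) s s' w :
  step_integral L (sub_steps s s') w = step_integral L s w - step_integral L s' w.
Proof.
rewrite /step_integral /sub_steps big_cat big_map/= -sumrN; congr (_ + _).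
by apply: eq_bigr => r _; rewrite mulNr.
Qed.

Lemma step_fun_shift h s x : step_fun (shift_steps h s) x = step_fun s (x - h).
Proof.
rewrite /step_fun /shift_steps big_map; apply: eq_bigr => r _ /=.
by rewrite ltrBrDr lerBlDr.
Qed.

Lemma step_fun_boxE s : step_fun s = fun x => \sum_(r <- s) r.1.1 * box r.1.2 r.2 x.
Proof. by []. Qed.

Lemma step_fun_square_integrable s : square_integrable leb (step_fun s).
Proof.
rewrite step_fun_boxE; apply: square_integrable_sum => r.
apply: square_integrableZ; exact: box_square_integrable.
Qed.

Section isometry.
Variables (L : R -> T -> R) (lv : R).
Hypothesis siL : forall u t, square_integrable P (fun w => L t w - L u w).
Hypothesis covL : forall a b c e,
  inner P (fun w => L b w - L a w) (fun w => L e w - L c w) =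
  (`|b - c| + `|a - e| - `|b - e| - `|a - c|) / 2 * lv.

Lemma step_integral_square_integrable s : square_integrable P (step_integral L s).
Proof.
apply: square_integrable_sum => r; exact: square_integrableZ.
Qed.

(** Both sides are double sums with proportional Gram entries, by [covL] and [inner_box]. Steps must
    be ordered: a reversed box is the zero function, while a reversed increment only changes
    sign. *)
Lemma step_integral_isometry s : ordered_steps s ->
  (\int[P]_w ((step_integral L s w) ^+ 2)%:E =
   lv%:E * \int[leb]_x ((step_fun s x) ^+ 2)%:E)%E.
Proof.
move=> os.
rewrite !integral_sqr_inner; [|exact: step_fun_square_integrable|
  exact: step_integral_square_integrable].
rewrite -EFinM; congr EFin.
have E1 : inner P (step_integral L s) (step_integral L s) =
    \sum_(r <- s) \sum_(r' <- s) r.1.1 * r'.1.1 *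
      inner P (fun w => L r.2 w - L r.1.2 w) (fun w => L r'.2 w - L r'.1.2 w).
  exact: (inner_double_sum s (fun r : R * R * R => r.1.1) (fun r => siL r.1.2 r.2)).
have E2 : inner leb (step_fun s) (step_fun s) =
    \sum_(r <- s) \sum_(r' <- s) r.1.1 * r'.1.1 *
      inner leb (box r.1.2 r.2) (box r'.1.2 r'.2).
  exact: (inner_double_sum s (fun r : R * R * R => r.1.1)
    (fun r => box_square_integrable r.1.2 r.2)).
rewrite E1 [inner leb _ _]E2.
rewrite mulr_sumr big_seq [RHS]big_seq; apply: eq_bigr => r rs.
rewrite mulr_sumr big_seq [RHS]big_seq; apply: eq_bigr => r' rs'.
by rewrite covL inner_box ?os//; ring.
Qed.

End isometry.
End step_functions.

Section sqr_limits.
Context {d : measure_display} {T : measurableType d} {R : realType}.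
Variable mu : {measure set T -> \bar R}.

Lemma integral_sqrB_le (X Y : T -> R) : measurable_fun setT X -> measurable_fun setT Y ->
  (\int[mu]_w ((X w - Y w) ^+ 2)%:E <=
   2%:E * (\int[mu]_w ((X w) ^+ 2)%:E + \int[mu]_w ((Y w) ^+ 2)%:E))%E.
Proof.
move=> mX mY; have mNY : measurable_fun setT (fun w => - Y w) by exact: measurableT_comp.
have := integral_sqrD_le mu mX mNY.
by under [X in (_ <= _ * (_ + X))%E -> _]eq_integral do rewrite sqrrN.
Qed.

Lemma cvg_integral_sqrB (Xs Ys : nat -> T -> R) :
  (forall n, measurable_fun setT (Xs n)) -> (forall n, measurable_fun setT (Ys n)) ->
  (\int[mu]_w ((Xs n w) ^+ 2)%:E)%E @[n --> \oo] --> 0%E ->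
  (\int[mu]_w ((Ys n w) ^+ 2)%:E)%E @[n --> \oo] --> 0%E ->
  (\int[mu]_w ((Xs n w - Ys n w) ^+ 2)%:E)%E @[n --> \oo] --> 0%E.
Proof.
move=> mX mY cX cY.
have L : (2%:E * (\int[mu]_w ((Xs n w) ^+ 2)%:E + \int[mu]_w ((Ys n w) ^+ 2)%:E))%E
    @[n --> \oo] --> 0%E.
  rewrite -[X in _ --> X](mule0 2%:E); apply: cvgeZl => //.
  by rewrite -[X in _ --> X](adde0 0%E); apply: cvgeD.
apply: (squeeze_cvge _ (cvg_cst 0%E) L); apply: nearW => n.
rewrite integral_sqrB_le// andbT; apply: integral_ge0 => w _.
by rewrite lee_fin sqr_ge0.
Qed.

End sqr_limits.

(** * Bounds and shift invariance for L^2 integrals *)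

Section L2_integral.
Context {d : measure_display} {T : measurableType d} {R : realType}.
Variable P : probability T R.
Local Notation leb := (@lebesgue_measure R).
Variables (L : R -> T -> R) (lv : R).
Hypothesis mL : forall t, measurable_fun setT (L t).
Hypothesis siL : forall u t, square_integrable P (fun w => L t w - L u w).
Hypothesis covL : forall a b c e,
  inner P (fun w => L b w - L a w) (fun w => L e w - L c w) =
  (`|b - c| + `|a - e| - `|b - e| - `|a - c|) / 2 * lv.
Hypothesis lv0 : 0 <= lv.
Implicit Types (k : R -> R) (V : T -> R).

Let mS s : measurable_fun setT (step_integral L s).
Proof. by case: (step_integral_square_integrable siL s). Qed.

Let mF (s : seq (R * R * R)) : measurable_fun setT (step_fun s).
Proof. by case: (step_fun_square_integrable s). Qed.

Lemma is_L2_integralB k k' V V' : measurable_fun setT k -> measurable_fun setT k' ->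
  is_L2_integral P L k V -> is_L2_integral P L k' V' ->
  is_L2_integral P L (fun x => k x - k' x) (fun w => V w - V' w).
Proof.
move=> mk mk' [mV [s [os ks Vs]]] [mV' [s' [os' ks' Vs']]]; split.
  exact: measurable_funB.
exists (fun n => sub_steps (s n) (s' n)); split.
- by move=> n; apply: ordered_sub_steps; [exact: os|exact: os'].
- have := @cvg_integral_sqrB _ _ _ leb (fun n x => step_fun (s n) x - k x)
    (fun n x => step_fun (s' n) x - k' x) (fun n => measurable_funB (mF (s n)) mk)
    (fun n => measurable_funB (mF (s' n)) mk') ks ks'.
  apply: cvg_trans; apply: near_eq_cvg; apply: nearW => n.
  by apply: eq_integral => x _; rewrite step_fun_sub; congr EFin; ring.
- rewrite unlock in Vs; rewrite unlock in Vs'; rewrite unlock.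
  have := @cvg_integral_sqrB _ _ _ P (fun n w => step_integral L (s n) w - V w)
    (fun n w => step_integral L (s' n) w - V' w) (fun n => measurable_funB (mS (s n)) mV)
    (fun n => measurable_funB (mS (s' n)) mV') Vs Vs'.
  apply: cvg_trans; apply: near_eq_cvg; apply: nearW => n.
  by apply: eq_integral => x _; rewrite step_integral_sub; congr EFin; ring.
Qed.

(** Distances to the approximating step functions tend to 0 and so are eventually finite; one such
    step function suffices. This spares computing the norm of the fractional kernel. *)
Lemma is_L2_integral_kernel k V : measurable_fun setT k -> is_L2_integral P L k V ->
  (\int[leb]_x ((k x) ^+ 2)%:E < +oo)%E.
Proof.
move=> mk [mV [s [os ks Vs]]].
pose B n := (\int[leb]_x ((step_fun (s n) x - k x) ^+ 2)%:E)%E.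
have /fine_cvgP[[n _ /(_ n (leqnn n)) Bn] _] : B n @[n --> \oo] --> 0%:E by exact: ks.
have h := integral_sqrB_le leb (mF (s n)) (measurable_funB (mF (s n)) mk).
have -> : (\int[leb]_x ((k x) ^+ 2)%:E =
    \int[leb]_x ((step_fun (s n) x - (step_fun (s n) \- k) x) ^+ 2)%:E)%E.
  by apply: eq_integral => x _; congr EFin; rewrite /=; ring.
apply: le_lt_trans h _.
rewrite lte_mul_pinfty// lte_add_pinfty//.
  by case: (step_fun_square_integrable (s n)).
rewrite -[X in (X < _)%E]/(B n) -ge0_fin_numE//.
by apply: integral_ge0 => x _; rewrite lee_fin sqr_ge0.
Qed.

(** The factor 4 comes from two uses of [(x + y)^2 <= 2 (x^2 + y^2)], around the isometry for the
    approximating steps. Chaining only needs some constant. *)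
Lemma is_L2_integral_bound k V : measurable_fun setT k -> is_L2_integral P L k V ->
  (\int[P]_w ((V w) ^+ 2)%:E <= (4 * lv)%:E * \int[leb]_x ((k x) ^+ 2)%:E)%E.
Proof.
move=> mk HV; have Koo := is_L2_integral_kernel mk HV.
case: HV => mV [s [os ks Vs]]; rewrite unlock in Vs.
move: Koo; set K := (\int[leb]_x _)%E => Koo.
have K0 : (0 <= K)%E by apply: integral_ge0 => x _; rewrite lee_fin sqr_ge0.
pose A n := (\int[P]_w ((step_integral L (s n) w - V w) ^+ 2)%:E)%E.
pose B n := (\int[leb]_x ((step_fun (s n) x - k x) ^+ 2)%:E)%E.
have bnd n : (\int[P]_w ((V w) ^+ 2)%:E <=
    2%:E * (A n + lv%:E * (2%:E * (B n + K))))%E.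
  have h1 := integral_sqrB_le P (mS (s n)) (measurable_funB (mS (s n)) mV).
  have h2 := integral_sqrD_le leb (measurable_funB (mF (s n)) mk) mk.
  have e1 : (\int[P]_w ((V w) ^+ 2)%:E = \int[P]_w
      ((step_integral L (s n) w - (step_integral L (s n) \- V) w) ^+ 2)%:E)%E.
    by apply: eq_integral => w _; congr EFin; rewrite /=; ring.
  rewrite e1; apply: le_trans h1 _; rewrite lee_wpmul2l// addeC; apply: leeD => //.
  rewrite (step_integral_isometry siL covL)//; last exact: os.
  rewrite lee_wpmul2l//; apply: le_trans h2.
  rewrite le_eqVlt; apply/orP; left; apply/eqP; apply: eq_integral => x _.
  by congr EFin; rewrite /=; ring.
have [r Kr] : exists r : R, K = r%:E.
  by exists (fine K); rewrite fineK// ge0_fin_numE.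
have lim : (2%:E * (A n + lv%:E * (2%:E * (B n + r%:E))))%E @[n --> \oo] -->
    (2%:E * (0%:E + lv%:E * (2%:E * (0%:E + r%:E))))%E.
  apply: cvgeZl => //; apply: cvgeD => //.
  apply: cvgeZl => //; apply: cvgeZl => //; apply: cvgeD => //.
  exact: cvg_cst.
have -> : ((4 * lv)%:E * K = 2%:E * (0%:E + lv%:E * (2%:E * (0%:E + r%:E))))%E.
  rewrite Kr; transitivity (2 * (0 + lv * (2 * (0 + r))))%:E.
    by rewrite -EFinM; congr EFin; ring.
  by rewrite !(EFinM, EFinD).
move: bnd; rewrite Kr => bnd.
by apply: cvge_ge lim; apply: nearW.
Qed.

(** Shifted approximations of [k i] approximate the shifted kernel, so their integrals converge to
    [V' i], and step integrals have a shift-invariant joint law. The law then passes to the limit in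
    probability. *)
Lemma is_L2_integral_shift_law n (k : 'I_n -> R -> R) (V V' : 'I_n -> T -> R) (h : R)
    (q : R -> set (measurableTypeR R) -> \bar R) :
  has_increment_law P L q ->
  (forall i, measurable_fun setT (k i)) ->
  (forall i, is_L2_integral P L (k i) (V i)) ->
  (forall i, is_L2_integral P L (fun x => k i (x - h)) (V' i)) ->
  same_law P V' V.
Proof.
move=> incr mk HV HV'.
have mV i : measurable_fun setT (V i) by case: (HV i).
have mV' i : measurable_fun setT (V' i) by case: (HV' i).
have /choice[s Hs] : forall i, exists s : nat -> seq (R * R * R),
    [/\ forall n, ordered_steps (s n),
        (\int[leb]_x ((step_fun (s n) x - k i x) ^+ 2)%:E)%E @[n --> \oo] --> 0%E &
        (\int[P]_w ((step_integral L (s n) w - V i w) ^+ 2)%:E)%E @[n --> \oo] --> 0%E].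
  by move=> i; case: (HV i) => _ [s [os ks Vs]]; exists s; split => //; rewrite unlock in Vs.
have mkh i : measurable_fun setT (fun x : R => k i (x - h)).
  by apply: measurableT_comp => //; exact: measurable_funB.
apply: (@same_law_limit _ _ _ P n
  (fun m i => step_integral L (shift_steps h (s i m)))
  (fun m i => step_integral L (s i m))) => //.
- move=> i; apply: L2_cvg_in_probability => //.
  have [_ [r [or kr Vr]]] := HV' i; rewrite unlock in Vr.
  have [os ks Vs] := Hs i.
  (* [V' i] comes with its own approximations [r]; the isometry shows that the shifted steps have
     the same limit. *)
  have D0 : (\int[P]_w ((step_integral L (shift_steps h (s i m)) w -
      step_integral L (r m) w) ^+ 2)%:E)%E @[m --> \oo] --> 0%E.
    have ksh : (\int[leb]_x ((step_fun (shift_steps h (s i m)) x - k i (x - h)) ^+ 2)%:E)%E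
        @[m --> \oo] --> 0%E.
      apply: cvg_trans ks; apply: near_eq_cvg; apply: nearW => m.
      rewrite -(@integral_translation R (fun x => ((step_fun (s i m) x - k i x) ^+ 2)%:E) h).
      + by apply: eq_integral => x _; rewrite step_fun_shift.
      + by apply: measurable_EFin_sqr; exact: measurable_funB.
      + by move=> x; rewrite lee_fin sqr_ge0.
    have := @cvg_integral_sqrB _ _ _ leb
      (fun m x => step_fun (shift_steps h (s i m)) x - k i (x - h))
      (fun m x => step_fun (r m) x - k i (x - h))
      (fun m => measurable_funB (mF (shift_steps h (s i m))) (mkh i))
      (fun m => measurable_funB (mF (r m)) (mkh i)) ksh kr.
    move=> H; have {H} := cvgeZl (isT : lv%:E \is a fin_num) H; rewrite mule0.
    apply: cvg_trans; apply: near_eq_cvg; apply: nearW => m.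
    transitivity (\int[P]_w ((step_integral L
        (sub_steps (shift_steps h (s i m)) (r m)) w) ^+ 2)%:E)%E; last first.
      by apply: eq_integral => w _; rewrite step_integral_sub.
    rewrite (step_integral_isometry siL covL); last first.
      by apply: ordered_sub_steps; [exact: (ordered_shift_steps (os m))|exact: or].
    congr (_ * _)%E; apply: eq_integral => x _.
    by rewrite step_fun_sub; congr EFin; ring.
  have Vr' : (\int[P]_w ((V' i w - step_integral L (r m) w) ^+ 2)%:E)%E @[m --> \oo] --> 0%E.
    by under eq_fun do under eq_integral do rewrite -sqrrN opprB.
  have := @cvg_integral_sqrB _ _ _ P
    (fun m w => step_integral L (shift_steps h (s i m)) w - step_integral L (r m) w)
    (fun m w => V' i w - step_integral L (r m) w)
    (fun m => measurable_funB (mS (shift_steps h (s i m))) (mS (r m)))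
    (fun m => measurable_funB (mV' i) (mS (r m))) D0 Vr'.
  apply: cvg_trans; apply: near_eq_cvg; apply: nearW => m.
  by apply: eq_integral => w _; congr EFin; ring.
- by move=> i; apply: L2_cvg_in_probability => //; case: (Hs i).
- by move=> m; exact: (step_integral_shift_law mL incr (fun i => s i m) h).
Qed.

End L2_integral.

(** * The fractional Levy process *)

Section lebesgue_scaling.
Context {R : realType}.
Local Notation leb := (@lebesgue_measure R).

Lemma integral_scaling (f : R -> \bar R) (h : R) : 0 < h ->
  measurable_fun setT f -> (forall x, 0 <= f x)%E ->
  (\int[leb]_x f (x / h)%R = h%:E * \int[leb]_x f x)%E.
Proof.
move=> h0 mf f0.
pose phi (x : measurableTypeR R) : measurableTypeR R := x / h.
have mphi : measurable_fun setT phi by exact: measurable_funM.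
pose nu : {measure set (measurableTypeR R) -> \bar R} :=
  measure_function_pushforward__canonical__measure_function_Measure leb mphi.
have hi0 : 0 <= h^-1 by rewrite invr_ge0 ltW.
transitivity (\int[nu]_x f x)%E.
  by rewrite (ge0_integral_pushforward mphi)// preimage_setT.
have -> : (\int[leb]_x f x = \int[mscale (NngNum hi0) nu]_x f x)%E.
  apply: eq_measure_integral => A mA _.
  apply: (@lebesgue_measure_unique R (mscale (NngNum hi0) nu)) => //.
  move=> _ [[a b] _ <-] /=; rewrite /mscale/= /pushforward /phi.
  rewrite [X in (_ * leb X)%E](_ : _ = [set` `]a * h, b * h]]); last first.
    by apply/seteqP; split => x /=; rewrite !in_itv/= ltr_pdivlMr// ler_pdivrMr.
  rewrite !lebesgue_measure_itv/= !lte_fin ltr_pM2r//.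
  case: ifP => _; last by rewrite mule0.
  by rewrite -!EFinB -EFinM; congr EFin; field; rewrite gt_eqF.
rewrite ge0_integral_mscale//= muleA -EFinM divff ?gt_eqF// mul1e//.
Qed.

End lebesgue_scaling.

Section fractional.
Context {R : realType}.
Local Notation leb := (@lebesgue_measure R).
Variables (c dd : R).

Definition flp_kernel (t s : R) : R :=
  c * (pos_powR (t - s) dd - pos_powR (- s) dd).

Lemma measurable_pos_powR (a : R) : measurable_fun setT (pos_powR ^~ a : R -> R).
Proof.
have m : measurable_fun setT (fun x : R => Num.max x 0) by exact: measurable_maxr.
exact: (measurableT_comp (measurable_powR a) m).
Qed.

Lemma measurable_flp_kernel t : measurable_fun setT (flp_kernel t).
Proof.
apply: measurable_funM => //; apply: measurable_funB.
  have m : measurable_fun setT (fun s : R => t - s) by exact: measurable_funB.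
  exact: (measurableT_comp (measurable_pos_powR dd) m).
have m : measurable_fun setT (fun s : R => - s) by exact: measurableT_comp.
exact: (measurableT_comp (measurable_pos_powR dd) m).
Qed.

Lemma pos_powR_scale (h x : R) : 0 < h -> pos_powR (h * x) dd = h `^ dd * pos_powR x dd.
Proof.
move=> h0; rewrite /pos_powR -powRM ?le_max ?lexx ?orbT ?ltW//.
by rewrite maxr_pMr ?mulr0 ?ltW.
Qed.

Lemma flp_kernelB t s x : flp_kernel t x - flp_kernel s x = flp_kernel (t - s) (x - s).
Proof. by rewrite /flp_kernel opprB addrA subrK; ring. Qed.

Lemma flp_kernel_scale h x : 0 < h -> flp_kernel h x = h `^ dd * flp_kernel 1 (x / h).
Proof.
move=> h0; have hn0 : h != 0 by rewrite gt_eqF.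
have e1 : h - x = h * (1 - x / h) by field.
have e2 : - x = h * (- (x / h)) by field.
by rewrite /flp_kernel e1 e2 !pos_powR_scale//; ring.
Qed.

(** Translation reduces the difference to the kernel at [t - s]. Its homogeneity of degree [dd]
    contributes the power [2 dd], and rescaling Lebesgue measure the additional 1. *)
Lemma integral_flp_kernel_sqr s t : s < t ->
  (\int[leb]_x ((flp_kernel t x - flp_kernel s x) ^+ 2)%:E =
   ((t - s) `^ (dd *+ 2 + 1))%:E * \int[leb]_x ((flp_kernel 1 x) ^+ 2)%:E)%E.
Proof.
move=> st; have h0 : 0 < t - s by rewrite subr_gt0.
have mk2 r : measurable_fun setT (fun x : R => ((flp_kernel r x) ^+ 2)%:E).
  by apply/measurable_EFinP; apply: measurable_funX; exact: measurable_flp_kernel.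
have p2 r (x : R) : (0 <= ((flp_kernel r x) ^+ 2)%:E)%E by rewrite lee_fin sqr_ge0.
under eq_integral do rewrite flp_kernelB.
rewrite (@integral_translation R (fun x => ((flp_kernel (t - s) x) ^+ 2)%:E))//.
under eq_integral do rewrite flp_kernel_scale// exprMn EFinM.
have m : measurable_fun setT (fun x : R => ((flp_kernel 1 (x / (t - s))) ^+ 2)%:E).
  apply/measurable_EFinP; apply: measurable_funX.
  have m : measurable_fun setT (fun x : R => x / (t - s)) by exact: measurable_funM.
  exact: (measurableT_comp (measurable_flp_kernel 1) m).
have k0 : (0 <= (((t - s) `^ dd) ^+ 2)%:E)%E by rewrite lee_fin sqr_ge0.
rewrite (ge0_integralZl leb measurableT m (fun x _ => p2 1 (x / (t - s))) k0).
rewrite (@integral_scaling R (fun x => ((flp_kernel 1 x) ^+ 2)%:E))// muleA; congr (_ * _)%E.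
rewrite -EFinM; congr EFin; rewrite powRD; last by apply/implyP => _; rewrite gt_eqF.
rewrite powRr1 ?(ltW h0)//; congr (_ * _).
by rewrite mulr2n powRD ?expr2//; apply/implyP => _; rewrite gt_eqF.
Qed.

End fractional.

Section flp.
Context {disp : measure_display} {T : measurableType disp} {R : realType}.
Variable P : probability T R.
Hypothesis hP : measure_is_complete P.
Variables (d : R) (L Ld : R -> T -> R).
Hypothesis hLd : is_FLP P d L Ld.

Let c : R := (Gamma (d + 1))^-1.

Lemma FLP_measurable t : measurable_fun setT (Ld t).
Proof. by case: (FLP_L2_integral hLd t). Qed.

Lemma FLP_L2_kernel t : is_L2_integral P L (flp_kernel c d t) (Ld t).
Proof. exact: FLP_L2_integral hLd t. Qed.

Let mk t := @measurable_flp_kernel R c d t.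

Lemma FLP_driving_process : exists q,
  [/\ forall t, measurable_fun setT (L t), has_increment_law P L q,
      forall s t, square_integrable P (fun w => L t w - L s w) &
      forall a b c e, inner P (fun w => L b w - L a w) (fun w => L e w - L c w) =
        (`|b - c| + `|a - e| - `|b - e| - `|a - c|) / 2 * levy_variance P L].
Proof.
have [L1 [L2 [[levy1 levy2] law12 ind12 LE]]] := FLP_levy hLd.
have mL := measurable_two_sided hP levy1 levy2 LE.
have q1 r : increment_law P L1 r setT = 1%E by exact: probability_setT.
have incr := levy_increments_law hP levy1 levy2 law12 ind12 LE.
have L0 : {ae P, forall w, L 0 w = 0}.
  have := levy_start levy1; apply: filterS => w w0.
  by rewrite LE /two_sided lexx; exact: w0.
have siL := increment_square_integrable mL q1 incr L0 (FLP_zero_mean hLd) (FLP_second_moment hLd).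
have covL := increment_covariance mL q1 incr L0 (FLP_zero_mean hLd) (FLP_second_moment hLd).
by exists (increment_law P L1).
Qed.

Lemma FLP_increment_moment : exists2 C : R, 0 <= C & forall s t,
  (\int[P]_w ((Ld t w - Ld s w) ^+ 2)%:E <= (C * `|t - s| `^ (d *+ 2 + 1))%:E)%E.
Proof.
have [q [mL incr siL covL]] := FLP_driving_process.
pose lv := levy_variance P L.
have lv0 : 0 <= lv by exact: inner_ge0.
have K1 := is_L2_integral_kernel (mk 1) (FLP_L2_kernel 1).
have [r Kr] : exists r : R, (\int[lebesgue_measure]_x ((flp_kernel c d 1 x) ^+ 2)%:E)%E = r%:E.
  exists (fine (\int[lebesgue_measure]_x ((flp_kernel c d 1 x) ^+ 2)%:E)%E).
  rewrite fineK// ge0_fin_numE//; apply: integral_ge0 => x _.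
  by rewrite lee_fin sqr_ge0.
have r0 : 0 <= r.
  by rewrite -lee_fin -Kr; apply: integral_ge0 => x _; rewrite lee_fin sqr_ge0.
exists (4 * lv * r); first by rewrite !mulr_ge0.
move=> s t; wlog st : s t / s <= t.
  move=> W; have [st|/ltW ts] := leP s t; first exact: W.
  rewrite distrC; apply: le_trans (W _ _ ts).
  rewrite le_eqVlt; apply/orP; left; apply/eqP; apply: eq_integral => w _.
  by congr EFin; ring.
move: st; rewrite le_eqVlt => /predU1P[->|st].
  rewrite integral0_eq; last by move=> w _; rewrite subrr expr0n.
  by rewrite lee_fin !mulr_ge0// powR_ge0.
have B := is_L2_integralB siL (mk t) (mk s) (FLP_L2_kernel t) (FLP_L2_kernel s).
have mks : measurable_fun setT (fun x : R => flp_kernel c d t x - flp_kernel c d s x).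
  by apply: measurable_funB.
apply: le_trans (is_L2_integral_bound siL covL lv0 mks B) _.
rewrite integral_flp_kernel_sqr// Kr -!EFinM lee_fin gtr0_norm ?subr_gt0//.
by rewrite -/lv le_eqVlt; apply/orP; left; apply/eqP; ring.
Qed.

(** The compensating term of the kernel cancels in differences, so translating the kernel of an
    increment by [h] gives the kernel of the shifted increment. *)
Lemma FLP_stationary_increments n (s t : 'I_n -> R) (h : R) :
  same_law P (fun i w => Ld (t i + h) w - Ld (s i + h) w)
    (fun i w => Ld (t i) w - Ld (s i) w).
Proof.
have [q [mL incr siL covL]] := FLP_driving_process.
apply: (@is_L2_integral_shift_law _ _ _ P L _ mL siL covL n
  (fun i x => flp_kernel c d (t i) x - flp_kernel c d (s i) x) _ _ h _ incr).
- by move=> i; apply: measurable_funB.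
- by move=> i; apply: is_L2_integralB => //; exact: FLP_L2_kernel.
move=> i.
have -> : (fun x => flp_kernel c d (t i) (x - h) - flp_kernel c d (s i) (x - h)) =
    (fun x => flp_kernel c d (t i + h) x - flp_kernel c d (s i + h) x).
  apply/funext => x; rewrite !flp_kernelB; congr (flp_kernel _ _ _ _).
    by rewrite opprD addrACA subrr addr0.
  by rewrite opprD addrAC addrA.
by apply: is_L2_integralB => //; exact: FLP_L2_kernel.
Qed.

End flp.

(** * Almost sure growth from moment bounds *)

Section summable_arrays.
Context {d : measure_display} {T : measurableType d} {R : realType}.
Variable mu : {measure set T -> \bar R}.

Lemma nneseries_geometric_le (u : nat -> \bar R) (a q : R) : 0 <= a -> 0 <= q < 1 ->
  (forall n, (0 <= u n)%E) -> (forall n, (u n <= (a * q ^+ n)%:E)%E) ->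
  (\sum_(0 <= n <oo) u n <= (a / (1 - q))%:E)%E.
Proof.
move=> a0 q01 u0 uq; apply: lime_le; first by apply: is_cvg_nneseries => n _ _; exact: u0.
apply: nearW => n; rewrite big_mkord.
apply: (@le_trans _ _ (\sum_(i < n) (a * q ^+ i)%:E)%E); first exact: lee_sum.
by rewrite sumEFin lee_fin -mulr_sumr ler_wpM2l// geometric_sum_le.
Qed.

Lemma nneseries_term_le (u : nat -> \bar R) n : (forall n, (0 <= u n)%E) ->
  (u n <= \sum_(0 <= k <oo) u k)%E.
Proof.
move=> u0; apply: le_trans (nneseries_lim_ge n.+1 _); last by move=> k _ _; exact: u0.
by rewrite big_nat_recr//= leeDr// sume_ge0.
Qed.

(** The expected sum of all squares is finite: geometric in [j] at each level, then geometric in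
    [k]. Hence the sum is almost surely finite, and its square root bounds every entry. *)
Lemma ae_bounded_double_array (X : nat -> nat -> T -> R) (a q : nat -> R) (A r : R) :
  (forall k j, measurable_fun setT (X k j)) ->
  0 <= A -> 0 <= r < 1 -> (forall k, 0 <= a k) -> (forall k, 0 <= q k < 1) ->
  (forall k, a k / (1 - q k) <= A * r ^+ k) ->
  (forall k j, (\int[mu]_w ((X k j w) ^+ 2)%:E <= (a k * q k ^+ j)%:E)%E) ->
  {ae mu, forall w, exists2 M, 0 <= M & forall k j, `|X k j w| <= M}.
Proof.
move=> mX A0 r01 a0 q01 aq HX.
pose F k j w : \bar R := ((X k j w) ^+ 2)%:E.
have F0 k j w : (0 <= F k j w)%E by rewrite lee_fin sqr_ge0.
have mF k j : measurable_fun setT (F k j).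
  by apply/measurable_EFinP; exact: measurable_funX.
pose G k w : \bar R := (\sum_(0 <= j <oo) F k j w)%E.
have G0 k w : (0 <= G k w)%E by apply: nneseries_ge0 => j _ _; exact: F0.
have mG k : measurable_fun setT (G k).
  by apply: ge0_emeasurable_sum => [j x _ _|j _] //.
have IG k : (\int[mu]_w G k w <= (A * r ^+ k)%:E)%E.
  rewrite integral_nneseries//.
  apply: (@le_trans _ _ (a k / (1 - q k))%:E); last by rewrite lee_fin.
  apply: nneseries_geometric_le => // j; last exact: HX.
  by apply: integral_ge0 => w _; exact: F0.
pose S w : \bar R := (\sum_(0 <= k <oo) G k w)%E.
have S0 w : (0 <= S w)%E by apply: nneseries_ge0 => j _ _; exact: G0.
have mS : measurable_fun setT S.
  by apply: ge0_emeasurable_sum => [j x _ _|j _] //.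
have IS : (\int[mu]_w S w < +oo)%E.
  rewrite integral_nneseries//; apply: le_lt_trans (ltry (A / (1 - r))).
  by apply: nneseries_geometric_le => // k; exact: integral_ge0.
have iS : mu.-integrable setT S.
  apply/integrableP; split => //; apply: le_lt_trans IS.
  by rewrite le_eqVlt; apply/orP; left; apply/eqP; apply: eq_integral => w _; rewrite gee0_abs.
have := integrable_ae measurableT iS; apply: filterS => w /(_ I) Sw.
have S0w : 0 <= fine (S w) by rewrite fine_ge0.
exists (Num.sqrt (fine (S w))) => // k j.
rewrite -sqrtr_sqr ler_wsqrtr// -lee_fin fineK//.
apply: le_trans (nneseries_term_le k (G0 ^~ w)).
exact: (nneseries_term_le j (fun j => F0 k j w)).
Qed.

End summable_arrays.

Section moment_growth.
Context {disp : measure_display} {T : measurableType disp} {R : realType}.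
Variable P : probability T R.

(** With [y] proportional to the dyadic step, this says that a level costs no more than the inverse
    of its step, which one factor of the moment bound compensates. *)
Lemma expRN_gap (y : R) : 0 < y -> (1 - expR (- y))^-1 <= 1 + y^-1.
Proof.
move=> y0; have y1 : 0 < 1 + y by lra.
have e1 : expR (- y) <= (1 + y)^-1.
  by rewrite expRN lef_pV2 ?posrE ?expR_gt0// expR_ge1Dx.
have -> : 1 + y^-1 = (1 - (1 + y)^-1)^-1 by field; rewrite !gt_eqF//; lra.
have h : (1 + y)^-1 < 1 by rewrite invf_lt1//; lra.
by rewrite lef_pV2 ?posrE; lra.
Qed.

(* The squares of the dyadic increments on ]-oo, 0], weighted so that their
   expectations are summable, are almost surely bounded, and chaining applies. *)
Lemma increment_moment_growth (X : R -> T -> R) (C d lam : R) :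
  0 < d -> 0 < lam -> 0 <= C -> (forall t, measurable_fun setT (X t)) ->
  (forall s t, (\int[P]_w ((X t w - X s w) ^+ 2)%:E <=
     (C * `|t - s| `^ (d *+ 2 + 1))%:E)%E) ->
  {ae P, forall w, continuous (X ^~ w)} ->
  {ae P, forall w, exists K, forall x, x <= 0 ->
     `|X x w| <= K * expR (- (lam / 2) * x)}.
Proof.
move=> d0 lam0 C0 mX HX cX.
(* Chaining doubles the rate, so [c = lam / 4] ends at [lam / 2]. *)
pose c := lam / 4; have c0 : 0 < c by rewrite /c; lra.
(* The moment of a level-[k] increment is of order [r ^+ (4 k)] times the step. Normalising by
   [r ^+ k] uses up half of this power and leaves the summable factor [r ^+ (2 k)]. *)
pose r : R := 2 `^ (- (d / 2)).
have r0 : 0 < r by rewrite powR_gt0.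
have r1 : r < 1.
  rewrite /r powRN invf_lt1 ?powR_gt0// -[ltLHS](congr1 (@^~ (d / 2)) (powR1 R)).
  by rewrite gt0_ltr_powR ?nnegrE ?ltr1n//; lra.
pose h (k : nat) : R := (2 ^+ k)^-1.
have h0 k : 0 < h k by rewrite invr_gt0 exprn_gt0.
have hpow k : h k `^ (d *+ 2 + 1) = r ^+ (4 * k) * h k.
  rewrite powRD; last by apply/implyP => _; rewrite gt_eqF.
  rewrite powRr1 ?ltW//; congr (_ * _).
  have -> : h k = 2 `^ (- k%:R) by rewrite powRN powR_mulrn.
  have -> : r ^+ (4 * k) = 2 `^ (- (d / 2) * (4 * k)%:R).
    by rewrite powRrM powR_mulrn ?powR_ge0.
  by rewrite -powRrM natrM mulr2n; congr (_ `^ _); field.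
(* Ratio, within level [k], of the squared exponential weights at neighbouring points. *)
pose q k := expR (- (2 * c * h k)).
have y0 k : 0 < 2 * c * h k by rewrite !mulr_gt0.
have q1 k : q k < 1 by rewrite /q -[ltRHS]expR0 ltr_expR oppr_lt0.
pose D k j w := X (- (j.+1%:R / 2 ^+ k)) w - X (- (j%:R / 2 ^+ k)) w.
pose Z k j w := r ^- k * expR (- (c * (j%:R / 2 ^+ k))) * D k j w.
have mD k j : measurable_fun setT (D k j) by exact: measurable_funB.
have mZ k j : measurable_fun setT (Z k j).
  exact: (measurable_funM (measurable_cst _) (mD k j)).
have rr : 0 <= r ^+ 2 < 1 by rewrite sqr_ge0 expr_lt1// ltW.
have A0 : 0 <= C * (1 + (2 * c)^-1).
  by rewrite mulr_ge0// addr_ge0// invr_ge0 mulr_ge0// ltW.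
have := @ae_bounded_double_array _ _ _ P Z
  (fun k => C * (r ^+ 2) ^+ k * h k) q (C * (1 + (2 * c)^-1)) (r ^+ 2) mZ A0 rr.
have H1 k : 0 <= C * (r ^+ 2) ^+ k * h k.
  by rewrite !mulr_ge0 ?exprn_ge0 ?sqr_ge0// ltW.
have H2 k : 0 <= q k < 1 by rewrite expR_ge0 q1.
have H3 k : C * (r ^+ 2) ^+ k * h k / (1 - q k) <= C * (1 + (2 * c)^-1) * (r ^+ 2) ^+ k.
  have -> : C * (1 + (2 * c)^-1) * (r ^+ 2) ^+ k = C * (r ^+ 2) ^+ k * (1 + (2 * c)^-1).
    by ring.
  rewrite -[leLHS]mulrA ler_wpM2l ?mulr_ge0 ?exprn_ge0 ?(ltW r0)//.
  apply: le_trans (ler_wpM2l (ltW (h0 k)) (expRN_gap (y0 k))) _.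
  rewrite mulrDr mulr1 invfM mulrCA mulfV ?gt_eqF// mulr1 lerD2r.
  by rewrite /h invf_le1 ?exprn_gt0// exprn_ege1// ler1n.
move=> /(_ H1 H2 H3).
have H4 k j : (\int[P]_w ((Z k j w) ^+ 2)%:E <= (C * (r ^+ 2) ^+ k * h k * q k ^+ j)%:E)%E.
  under eq_integral do rewrite exprMn EFinM.
  have mDE : measurable_fun setT (fun w => ((D k j w) ^+ 2)%:E).
    by apply/measurable_EFinP; exact: measurable_funX.
  rewrite (ge0_integralZl P measurableT mDE); last 2 first.
  - by move=> w _; rewrite lee_fin sqr_ge0.
  - by rewrite lee_fin sqr_ge0.
  apply: (@le_trans _ _ (((r ^- k * expR (- (c * (j%:R / 2 ^+ k)))) ^+ 2)%:E *
      (C * `|- (j.+1%:R / 2 ^+ k) - - (j%:R / 2 ^+ k)| `^ (d *+ 2 + 1))%:E)%E).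
    by apply: lee_wpmul2l; [rewrite lee_fin sqr_ge0|exact: HX].
  rewrite -EFinM lee_fin.
  have -> : `|- (j.+1%:R / 2 ^+ k) - - (j%:R / 2 ^+ k)| = h k.
    by rewrite opprK addrC -mulrBl -natr1 opprD addrA subrr sub0r mulN1r normrN gtr0_norm.
  rewrite hpow exprMn.
  have -> : expR (- (c * (j%:R / 2 ^+ k))) ^+ 2 = q k ^+ j.
    rewrite /q -!expRM_natl; congr expR; rewrite /h; ring.
  have -> : r ^+ (4 * k) = (r ^+ 2) ^+ k * (r ^+ k) ^+ 2.
    by rewrite -!exprM -exprD; congr (_ ^+ _); lia.
  rewrite le_eqVlt; apply/orP; left; apply/eqP.
  by field; rewrite expf_neq0// gt_eqF.
move=> /(_ H4) H5.
near=> w.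
have cw : continuous (X ^~ w) by near: w; exact: cX.
have [M M0 HM] : exists2 M, 0 <= M & forall k j, `|Z k j w| <= M by near: w; exact: H5.
have r01 : 0 <= r < 1 by rewrite r1 ltW.
have := @chaining_growth R (X ^~ w) M r c M0 r01 c0 cw.
have -> : 2 * c = lam / 2 by rewrite /c; field.
apply=> k j.
have -> : X (- (j.+1%:R / 2 ^+ k)) w - X (- (j%:R / 2 ^+ k)) w =
    Z k j w * (r ^+ k * expR (c * (j%:R / 2 ^+ k))).
  rewrite /Z/= expRN -/(D k j w); field.
  by rewrite expf_neq0 ?gt_eqF// expR_gt0.
rewrite normrM [X in _ * X]ger0_norm; last by rewrite mulr_ge0 ?exprn_ge0 ?expR_ge0// ltW.
rewrite -[leRHS]mulrA ler_wpM2r// mulr_ge0 ?exprn_ge0 ?expR_ge0// ltW//.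
Unshelve. all: by end_near. Qed.

End moment_growth.

(** * The Ornstein-Uhlenbeck process *)

Section uniform_partitions.
Context {R : realType}.
Implicit Types (f g : R -> R) (a b : R).

Lemma tpart_steps dl (x : nat -> R) k n :
  (forall i, x i < x i.+1) -> (forall i, x i.+1 - x i < dl) ->
  tpart dl (x k) (x (k + n)%N) [seq (x i, x i.+1) | i <- iota k n].
Proof.
move=> x1 x2; elim: n k => [|n IH] k /=; first by rewrite addn0.
by split; rewrite ?lexx ?(ltW (x1 k))//= addnS -addSn.
Qed.

Lemma tsum_steps q (x : nat -> R) k n :
  tsum q (x k) [seq (x i, x i.+1) | i <- iota k n] =
  \sum_(i <- iota k n) q (x i) (x i) (x i.+1).
Proof.
by elim: n k => [|n IH] k /=; rewrite ?big_nil// big_cons IH.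
Qed.

(** Partitions independent of the path: applied to a process, the sums are measurable and depend on
    finitely many increments at fixed times. *)
Lemma uniform_sums_cvg f g a c : 0 < c -> RS_integrable f g a (a + c) ->
  \sum_(i < m.+1) f (a + i%:R * (c / m.+1%:R)) *
     (g (a + i.+1%:R * (c / m.+1%:R)) - g (a + i%:R * (c / m.+1%:R)))
  @[m --> \oo] --> RS_integral f g a (a + c).
Proof.
move=> c0 [v Hv]; rewrite (RS_integralE Hv).
move/is_RS_integralP: Hv => [_ Hv]; apply/cvgrPdist_lt => e /Hv[dl dl0 K].
near=> m; rewrite distrC.
pose x (i : nat) := a + i%:R * (c / m.+1%:R).
have st i : x i.+1 - x i = c / m.+1%:R by rewrite /x -natr1; ring.
have := @tpart_steps dl x 0 m.+1.
have -> : x 0%N = a by rewrite /x mul0r addr0.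
have -> : x (0 + m.+1)%N = a + c by rewrite /x add0n mulrC divfK.
move=> T; have {}T := T (fun i => _) (fun i => _).
have := K _ (T _ _).
have /= := tsum_steps (RS_term f g) x 0 m.+1.
have -> : x 0%N = a by rewrite /x mul0r addr0.
move=> -> E.
have <- : \sum_(i <- iota 0 m.+1) RS_term f g (x i) (x i) (x i.+1) = 
  \sum_(i < m.+1) f (x i) * (g (x i.+1) - g (x i)).
  by rewrite -(big_mkord xpredT (fun i => f (x i) * (g (x i.+1) - g (x i)))) /index_iota subn0.
apply: E => i.
  by rewrite -subr_gt0 st divr_gt0.
rewrite st ltr_pdivrMr//; apply: lt_trans (_ : dl * m%:R < _); last first.
  by rewrite ltr_pM2l// ltr_nat.
by rewrite mulrC -ltr_pdivrMr//; near: m; exact: nbhs_infty_gtr.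
Unshelve. all: by end_near. Qed.

End uniform_partitions.

(** * Measurability and stationarity of the Ornstein-Uhlenbeck process *)

Section flou.
Context {disp : measure_display} {T : measurableType disp} {R : realType}.
Variable P : probability T R.
Hypothesis hP : measure_is_complete P.
Variables (d lam : R) (L Ld : R -> T -> R).
Hypothesis hLd : is_FLP P d L Ld.
Hypothesis d0 : 0 < d.
Hypothesis lam0 : 0 < lam.

Lemma FLP_growth : {ae P, forall w, exists K, forall x, x <= 0 ->
  `|Ld x w| <= K * expR (- (lam / 2) * x)}.
Proof.
have [C C0 HC] := FLP_increment_moment hP hLd.
apply: (increment_moment_growth d0 lam0 C0 (FLP_measurable hLd) HC).
by have := FLP_continuous_modification hLd; apply: filterS => w [].
Qed.

Lemma FLOU_langevin : {ae P, forall w, [/\ continuous (Ld ^~ w),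
  langevin lam (Ld ^~ w) (FLOU lam Ld ^~ w) & forall t,
  RS_integral (fun s => expR (- lam * (t - s))) (Ld ^~ w) a t @[a --> -oo] -->
    FLOU lam Ld t w]}.
Proof.
near=> w.
have [cw _] : continuous (Ld ^~ w) /\ forall t, exists2 v : R,
      is_improper_riemann_line
        (fun s => (pos_powR (t - s) (d - 1) - pos_powR (- s) (d - 1)) * L s w)
        v & Ld t w = (Gamma d)^-1 * v.
  by near: w; exact: (FLP_continuous_modification hLd).
have [K HK] : exists K, forall x, x <= 0 -> `|Ld x w| <= K * expR (- (lam / 2) * x).
  by near: w; exact: FLP_growth.
have [U lU cU] := langevin_exp_growth lam0 cw HK.
have UE : U = FLOU lam Ld ^~ w.
  by apply/funext => t; symmetry; apply: cvg_lim; [exact: Rhausdorff|exact: cU].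
by rewrite UE in lU cU; split.
Unshelve. all: by end_near. Qed.

(** The weights depend on [t - s] only, hence not on [t]: a time shift acts on the nodes alone, and
    stationary increments suffice. *)
Let weight (N m i : nat) : R := expR (- lam * (N.+1%:R - i%:R * (N.+1%:R / m.+1%:R))).
Let node (N m : nat) (t : R) (i : nat) : R := t - N.+1%:R + i%:R * (N.+1%:R / m.+1%:R).

Definition flou_sum (N m : nat) (t : R) (w : T) : R :=
  \sum_(i < m.+1) weight N m i * (Ld (node N m t i.+1) w - Ld (node N m t i) w).

Definition flou_trunc (N : nat) (t : R) (w : T) : R :=
  RS_integral (fun s => expR (- lam * (t - s))) (Ld ^~ w) (t - N.+1%:R) t.

Lemma flou_sum_cvg N t : {ae P, forall w, flou_sum N m t w @[m --> \oo] --> flou_trunc N t w}.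
Proof.
have := FLOU_langevin; apply: filterS => w [cw _ _].
have tE : t = t - N.+1%:R + N.+1%:R by rewrite subrK.
have i0 : RS_integrable (fun s => expR (- lam * (t - s))) (Ld ^~ w)
    (t - N.+1%:R) (t - N.+1%:R + N.+1%:R).
  by rewrite -tE; apply: RS_integrable_exp => //; rewrite gerBl.
have := uniform_sums_cvg (ltr0Sn R N) i0; rewrite -tE.
apply: cvg_trans; apply: near_eq_cvg; apply: nearW => m.
apply: eq_bigr => i _; congr (expR _ * _); rewrite /node; ring.
Qed.

Lemma flou_trunc_cvg t : {ae P, forall w, flou_trunc N t w @[N --> \oo] --> FLOU lam Ld t w}.
Proof.
have := FLOU_langevin; apply: filterS => w [_ _ /(_ t) H].
have h : t - n.+1%:R @[n --> \oo] --> -oo%R.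
  apply/cvgrNyPle => A; near=> n.
  rewrite lerBlDr -lerBlDl; apply: (@le_trans _ _ n%:R); last by rewrite ler_nat.
  by near: n; exact: nbhs_infty_ger.
exact: cvg_comp h H.
Unshelve. all: by end_near. Qed.

Lemma measurable_flou_sum N m t : measurable_fun setT (flou_sum N m t).
Proof.
apply: measurable_sum => i; apply: measurable_funM => //.
by apply: measurable_funB; exact: FLP_measurable hLd _.
Qed.

Lemma measurable_flou_trunc N t : measurable_fun setT (flou_trunc N t).
Proof.
exact: (ae_cvg_measurable_fun hP (fun m => measurable_flou_sum N m t) (flou_sum_cvg N t)).
Qed.

Lemma measurable_FLOU t : measurable_fun setT (FLOU lam Ld t).
Proof.
exact: (ae_cvg_measurable_fun hP (fun N => measurable_flou_trunc N t) (flou_trunc_cvg t)).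
Qed.

Lemma flou_sum_shift_law N m n (t : 'I_n -> R) (h : R) :
  same_law P (fun i => flou_sum N m (t i + h)) (fun i => flou_sum N m (t i)).
Proof.
pose q := #|{: 'I_n * 'I_m.+1}|.
(* The pairs of a time and a cell are flattened into one index, so that all increments are shifted
   jointly; [r = 0] and [r = 1] are the two ends of a cell. *)
pose s (r : nat) (k : 'I_q) := node N m (t (enum_val k).1) ((enum_val k).2 + r).
have := @FLP_stationary_increments _ _ _ P hP d L Ld hLd q (s 0%N) (s 1%N) h.
pose F (x : q.-tuple (measurableTypeR R)) : n.-tuple (measurableTypeR R) :=
  [tuple (\sum_(j < m.+1) weight N m j * (tnth x (enum_rank (i, j)) : R) : measurableTypeR R)
   | i < n].
have mF : measurable_fun setT F.
  apply/measurable_fun_tnthP => i.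
  rewrite (_ : _ \o F = fun x => \sum_(j < m.+1) weight N m j *
    (tnth x (enum_rank (i, j)) : R)); last first.
    by apply/funext => x /=; rewrite tnth_mktuple.
  apply: measurable_sum => j; apply: measurable_funM => //; exact: measurable_tnth.
apply: (same_law_map mF) => w; apply: eq_from_tnth => i; rewrite !tnth_mktuple;
  apply: eq_bigr => j _; rewrite tnth_mktuple /s enum_rankK/= addn0 addn1.
- have e k : node N m (t i + h) k = node N m (t i) k + h by rewrite /node; ring.
  by rewrite !e.
- by [].
Qed.

Lemma flou_trunc_shift_law N n (t : 'I_n -> R) (h : R) :
  same_law P (fun i => flou_trunc N (t i + h)) (fun i => flou_trunc N (t i)).
Proof.
apply: (same_law_limit (Vs := fun m i => flou_sum N m (t i + h))
  (Vs' := fun m i => flou_sum N m (t i))) => *.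
- exact: measurable_flou_sum.
- exact: measurable_flou_sum.
- exact: measurable_flou_trunc.
- exact: measurable_flou_trunc.
- apply: ae_cvg_in_probability => [m||]; [exact: measurable_flou_sum|
    exact: measurable_flou_trunc|exact: flou_sum_cvg].
- apply: ae_cvg_in_probability => [m||]; [exact: measurable_flou_sum|
    exact: measurable_flou_trunc|exact: flou_sum_cvg].
- exact: flou_sum_shift_law.
Qed.

Lemma FLOU_shift_law n (t : 'I_n -> R) (h : R) :
  same_law P (fun i => FLOU lam Ld (t i + h)) (fun i => FLOU lam Ld (t i)).
Proof.
apply: (same_law_limit (Vs := fun N i => flou_trunc N (t i + h))
  (Vs' := fun N i => flou_trunc N (t i))) => *.
- exact: measurable_flou_trunc.
- exact: measurable_flou_trunc.
- exact: measurable_FLOU.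
- exact: measurable_FLOU.
- apply: ae_cvg_in_probability => [m||]; [exact: measurable_flou_trunc|
    exact: measurable_FLOU|exact: flou_trunc_cvg].
- apply: ae_cvg_in_probability => [m||]; [exact: measurable_flou_trunc|
    exact: measurable_FLOU|exact: flou_trunc_cvg].
- exact: flou_trunc_shift_law.
Qed.

End flou.

(** * Stationary solutions *)

Section explosion.
Context {disp : measure_display} {T : measurableType disp} {R : realType}.
Variable P : probability T R.
Variable f : R -> R.
Hypothesis f_mono : forall x y, x <= y -> f x <= f y.

(** For [X = f H] this is the event that [H] leaves [-M, M], but expressed through [X], whose
    measurability and stationarity are known. *)
Let tail (M : R) : set (measurableTypeR R) := ~` `[f (- M), f M].

Let measurable_tail M : measurable (tail M).
Proof. by apply: measurableC; exact: measurable_itv. Qed.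

Lemma stationary_tail (X : R -> T -> R) t M : stationary P X ->
  P [set w | tail M (X t w)] = P [set w | tail M (X 0 w)].
Proof.
move=> sX.
pose A : set (1.-tuple (measurableTypeR R)) := [set x | tail M (tnth x ord0)].
have mA : measurable A.
  rewrite -[A]/((fun x : 1.-tuple (measurableTypeR R) => tnth x ord0) @^-1` tail M).
  by rewrite -[X in measurable X]setTI; apply: measurable_tnth.
have := sX 1%N (fun=> 0) t A mA.
have E s : fdd_event X (fun _ : 'I_1 => s) A = [set w | tail M (X s w)].
  by apply/seteqP; split=> w; rewrite /fdd_event /A /= tnth_mktuple.
by rewrite add0r !E.
Qed.

(** As [V] almost surely takes a value of [f], the indicators of the tail events vanish
    eventually. *)
Lemma tail_probability_cvg (V : T -> R) (M : nat -> R) : measurable_fun setT V ->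
  {ae P, forall w, exists x, V w = f x} -> M n @[n --> \oo] --> +oo ->
  P [set w | tail (M n) (V w)] @[n --> \oo] --> 0%E.
Proof.
move=> mV HV HM.
have mT n : measurable [set w | tail (M n) (V w)].
  by have := mV measurableT _ (measurable_tail (M n)); rewrite setTI.
have := @ae_cvg_in_probability _ T R P
  (fun n w => \1_[set w | tail (M n) (V w)] w) (cst 0).
have H1 n : measurable_fun setT (fun w : T => \1_[set w | tail (M n) (V w)] w : R).
  exact: measurable_indic.
move=> /(_ H1 (measurable_cst _)).
have H2 : {ae P, forall w, (\1_[set w | tail (M n) (V w)] w : R) @[n --> \oo] --> (cst 0 w : R)}.
  apply: filterS HV => w [x Vx].
  apply: cvg_near_cst; near=> n; rewrite indicE memNset// /tail/= Vx in_itv/=; apply/negP/negPn.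
  have Mn : `|x| <= M n by near: n; exact: (cvgryPge _).1.
  by move: Mn; rewrite ler_norml => /andP[h1 h2]; rewrite !f_mono.
have e0 : 0 < 1 / 2 :> R by rewrite divr_gt0.
move=> /(_ H2 _ e0); apply: cvg_trans; apply: near_eq_cvg; apply: nearW => n.
congr (P _); apply/seteqP; split => w /=; rewrite subr0 indicE.
  by case: (boolP (_ \in _)); rewrite ?inE// normr0 ltNge divr_ge0.
by move=> h; rewrite mem_set// normr1 ltr_pdivrMr// mul1r ltr1n.
Unshelve. all: by end_near. Qed.

(** If the difference at time 0 exceeds [e], then at each time [-n] one of the two processes lies in
    its tail beyond [M n]. A union bound needs only the marginals of [X] and [Y], which are
    stationary separately, not jointly. *)
Lemma stationary_explosion (lam : R) (X Y H H' : R -> T -> R) : 0 < lam ->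
  is_process X -> is_process Y -> stationary P X -> stationary P Y ->
  (forall x y, f x <= f y -> x <= y) ->
  {ae P, forall w t, X t w = f (H t w)} -> {ae P, forall w t, Y t w = f (H' t w)} ->
  {ae P, forall w t, H t w - H' t w = expR (- lam * t) * (H 0 w - H' 0 w)} ->
  {ae P, forall w, H 0 w = H' 0 w}.
Proof.
move=> lam0 mX mY sX sY f_inj XH YH HH.
suff K (k : nat) : {ae P, forall w, `|H 0 w - H' 0 w| <= k.+1%:R^-1}.
  have := ae_foralln K; apply: filterS => w Kw; apply/eqP; rewrite -subr_eq0 -normr_le0.
  apply/ler_addgt0Pl => e e0; rewrite addr0; apply: le_trans (Kw (Num.truncn e^-1)) _.
  by rewrite -[leRHS]invrK lef_pV2 ?posrE ?invr_gt0// ltW// real_truncnS_gt// num_real.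
have k0 : 0 < k.+1%:R^-1 :> R by [].
move: (k.+1%:R^-1) k0 => e e0.
(* Half of the least gap at time [-n], so the two processes cannot both stay within [-M n, M n]. *)
pose M (n : nat) := expR (lam * n%:R) * (e / 2).
have HM : M n @[n --> \oo] --> +oo.
  apply/cvgryPge => A; near=> n.
  apply: (@le_trans _ _ (lam * n%:R * (e / 2))); last first.
    by rewrite ler_wpM2r ?divr_ge0 ?(ltW e0)// (le_trans _ (expR_ge1Dx _))// lerDr.
  rewrite -ler_pdivrMr ?divr_gt0// [leRHS]mulrC -ler_pdivrMr//.
  by near: n; exact: nbhs_infty_ger.
pose F n := [set w | tail (M n) (X (- n%:R) w)] `|` [set w | tail (M n) (Y (- n%:R) w)].
have mF1 n : measurable [set w | tail (M n) (X (- n%:R) w)].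
  by have := mX (- n%:R) measurableT _ (measurable_tail (M n)); rewrite setTI.
have mF2 n : measurable [set w | tail (M n) (Y (- n%:R) w)].
  by have := mY (- n%:R) measurableT _ (measurable_tail (M n)); rewrite setTI.
have mF n : measurable (F n) by exact: measurableU.
have mI : measurable (\bigcap_n F n) by exact: bigcapT_measurable.
have PF n : (P (F n) <= P [set w | tail (M n) (X 0%R w)] + P [set w | tail (M n) (Y 0%R w)])%E.
  rewrite -(stationary_tail (- n%:R) (M n) sX) -(stationary_tail (- n%:R) (M n) sY).
  exact: measureU2.
(* By stationarity the tails at time [-n] are as likely as those at time 0, which vanish. The
   measurable intersection stands in for the event of a large difference, which need not be known to
   be measurable. *)
have P0 : P (\bigcap_n F n) = 0%E.
  apply/eqP; rewrite eq_le measure_ge0 andbT.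
  have rX : {ae P, forall w, exists x, X 0 w = f x}.
    by apply: filterS XH => w h; exists (H 0 w).
  have rY : {ae P, forall w, exists x, Y 0 w = f x}.
    by apply: filterS YH => w h; exists (H' 0 w).
  have c0 : ((0 : \bar R) +? 0)%E by [].
  have := cvgeD c0 (tail_probability_cvg (mX 0) rX HM) (tail_probability_cvg (mY 0) rY HM).
  rewrite adde0 => c; apply: (cvge_ge _ (c _)).
  apply: nearW => n; apply: le_trans (PF n); apply: le_measure; rewrite ?inE//.
  exact: bigcap_inf.
have aeI : {ae P, forall w, ~ (\bigcap_n F n) w}.
  by exists (\bigcap_n F n); split => // w /= /contrapT.
near=> w.
have Xw t : X t w = f (H t w) by move: t; near: w.
have Yw t : Y t w = f (H' t w) by move: t; near: w.
have Hw t : H t w - H' t w = expR (- lam * t) * (H 0 w - H' 0 w) by move: t; near: w.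
have Iw : ~ (\bigcap_n F n) w by near: w.
rewrite leNgt; apply/negP => eD; apply: Iw => n _.
apply: contrapT => /not_orP[/= /contrapT h1 /contrapT h2].
move: h1 h2; rewrite /= !in_itv/= Xw Yw => /andP[/f_inj h1 /f_inj h2] /andP[/f_inj h3 /f_inj h4].
have : `|H (- n%:R) w - H' (- n%:R) w| <= M n + M n.
  by rewrite ler_norml; apply/andP; split; lra.
rewrite Hw normrM gtr0_norm ?expR_gt0// mulrNN leNgt => /negP; apply.
by rewrite /M -mulrDr -splitr ltr_pM2l ?expR_gt0.
Unshelve. all: by end_near. Qed.

End explosion.

(** * Existence and uniqueness of the stationary solution *)

Section solutions.
Context {disp : measure_display} {T : measurableType disp} {R : realType}.
Variable P : probability T R.
Hypothesis hP : measure_is_complete P.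
Variables (d p : R) (L Ld : R -> T -> R).
Hypothesis d0 : 0 < d.
Hypothesis p12 : 1 <= p < 2.
Hypothesis hLd : is_FLP P d L Ld.
Hypothesis hLdp : bounded_p_variation_paths P p Ld.
Variables (a b : \bar R) (mu sigma psi phi : R -> R) (lam : R).
Hypothesis hsp : strongly_proper a b mu sigma psi phi lam.
Let f := state_space_transform phi lam.
Let lam0 : 0 < lam. Proof. exact: sp_lam_gt0 hsp. Qed.

Lemma state_space_transform_continuous : continuous f.
Proof. exact: (is_derive_continuous (state_space_transform_derive hsp)). Qed.

Lemma le_state_space_transform x y : (f x <= f y) = (x <= y).
Proof.
have lt z t : z < t -> f z < f t.
  move=> zt; rewrite ltNge; apply/negP; rewrite le_eqVlt => /predU1P[E|H].
    have := psi_state_space_transform hsp z; rewrite -/f -E (psi_state_space_transform hsp).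
    have l0 : - lam != 0 by rewrite oppr_eq0 gt_eqF.
    by move=> /(mulfI l0) tz; move: zt; rewrite tz ltxx.
  have := sp_psi_decreasing hsp (state_space_transform_in hsp _)
    (state_space_transform_in hsp _) H.
  by rewrite !(psi_state_space_transform hsp) ltr_nM2l ?oppr_lt0// ltNge ltW.
by case: (ltgtP x y) => [/lt/ltW //|/lt yx|->]; [rewrite leNgt yx|rewrite lexx].
Qed.

Let X t w := f (FLOU lam Ld t w).

Lemma transformed_FLOU_process : is_process X.
Proof.
move=> t; apply: measurableT_comp; last exact: (measurable_FLOU hP hLd d0 lam0).
exact: continuous_measurable_fun state_space_transform_continuous.
Qed.

Lemma transformed_FLOU_stationary : stationary P X.
Proof.
move=> n t h A mA.
pose F (x : n.-tuple (measurableTypeR R)) : n.-tuple (measurableTypeR R) :=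
  [tuple (f (tnth x i) : measurableTypeR R) | i < n].
have mF : measurable_fun setT F.
  apply/measurable_fun_tnthP => i.
  rewrite (_ : _ \o F = fun x => f (tnth x i)); last first.
    by apply/funext => x /=; rewrite tnth_mktuple.
  apply: (measurableT_comp (continuous_measurable_fun state_space_transform_continuous)).
  exact: measurable_tnth.
apply: (@same_law_map _ _ _ P n n _ _ (fun i => X (t i + h)) (fun i => X (t i)) F mF
  _ _ (FLOU_shift_law hP hLd d0 lam0 t h) A mA) => w;
  by apply: eq_from_tnth => i; rewrite !tnth_mktuple.
Qed.

Lemma transformed_FLOU_solution : is_pathwise_solution P p a b mu sigma Ld X.
Proof.
split; first exact: transformed_FLOU_process.
near=> w.
have [cw lw _] : [/\ continuous (Ld ^~ w), langevin lam (Ld ^~ w) (FLOU lam Ld ^~ w) &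
  forall t, RS_integral (fun s => expR (- lam * (t - s))) (Ld ^~ w) a t @[a --> -oo] -->
    FLOU lam Ld t w].
  by near: w; exact: (FLOU_langevin hP hLd d0 lam0).
have pw : locally_bounded_p_variation p (Ld ^~ w) by near: w; exact: hLdp.
have [WX S] := langevin_to_sde p12 (conj cw pw) lw cw (state_space_transform_derive hsp)
  (sigma_transform_lipschitz hsp) (mu_state_space_transform hsp).
split => // [t|s t st]; first exact: (state_space_transform_in hsp).
split; first by eexists; exact: S.
by rewrite (RS_integralE (S s t st)) [RHS]addrC subrK.
Unshelve. all: by end_near. Qed.

Hypothesis sigma0 : forall x : R, open_interval a b x -> sigma x != 0.

(** The process [- psi Y / lam] is the preimage of [Y] under [f]. Stationarity enters only
    afterwards, when two such preimages are compared. *)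
Lemma stationary_solution_langevin (Y : R -> T -> R) :
  is_pathwise_solution P p a b mu sigma Ld Y ->
  {ae P, forall w, (forall t, open_interval a b (Y t w)) /\
     langevin lam (Ld ^~ w) (fun t => - lam^-1 * psi (Y t w))}.
Proof.
move=> [mY HY]; near=> w.
have [WY IY SY] : [/\ W_con p (Y ^~ w), forall t, open_interval a b (Y t w) &
      forall s t, s <= t ->
        RS_integrable (fun u => sigma (Y u w)) (Ld ^~ w) s t /\
        Y t w - Y s w =
          Rintegral lebesgue_measure `[s, t] (fun u => mu (Y u w)) +
          RS_integral (fun u => sigma (Y u w)) (Ld ^~ w) s t].
  by near: w; exact: HY.
have cw : continuous (Ld ^~ w).
  by near: w; have := FLP_continuous_modification hLd; apply: filterS => w [].
split => //; pose h t := - lam^-1 * psi (Y t w).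
have fh : f \o h = Y ^~ w.
  by apply/funext => t; rewrite /= /h /f (state_space_transform_psi hsp).
have fhE t : f (h t) = Y t w by rewrite -[LHS]/((f \o h) t) fh.
apply: (@sde_to_langevin R p lam (Ld ^~ w) h f sigma mu) => //.
- move=> t; apply: cvgMl_tmp; apply: (@cvg_comp _ _ _ (Y ^~ w) psi); first exact: WY.1.
  exact: strongly_proper_psi_continuous hsp _ (IY t).
- by rewrite fh; exact: WY.2.
- exact: state_space_transform_derive hsp.
- exact: sigma_transform_lipschitz hsp.
- by move=> x; apply: sigma0; exact: state_space_transform_in hsp _.
- exact: mu_state_space_transform hsp.
- move=> s t /SY; rewrite !fhE.
  by under [fun r => sigma (f (h r))]funext do rewrite fhE;
    under [fun r => mu (f (h r))]funext do rewrite fhE.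
Unshelve. all: by end_near. Qed.

Lemma stationary_solution_unique (Y Y' : R -> T -> R) :
  is_stationary_pathwise_solution P p a b mu sigma Ld Y ->
  is_stationary_pathwise_solution P p a b mu sigma Ld Y' ->
  {ae P, forall w, forall t, Y t w = Y' t w}.
Proof.
move=> [sY stY] [sY' stY'].
have lY := stationary_solution_langevin sY; have lY' := stationary_solution_langevin sY'.
pose H (Z : R -> T -> R) t w := - lam^-1 * psi (Z t w).
have ZH (Z : R -> T -> R) w : (forall t, open_interval a b (Z t w)) ->
    forall t, Z t w = f (H Z t w).
  by move=> Iw t; rewrite /f /H (state_space_transform_psi hsp).
have HH : {ae P, forall w t, H Y t w - H Y' t w = expR (- lam * t) * (H Y 0 w - H Y' 0 w)}.
  by apply: filterS2 lY lY' => w [_ l1] [_ l2] t; exact: (langevin_diff l1 l2).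
have YH : {ae P, forall w t, Y t w = f (H Y t w)}.
  by apply: filterS lY => w [/ZH].
have YH' : {ae P, forall w t, Y' t w = f (H Y' t w)}.
  by apply: filterS lY' => w [/ZH].
have H0 : {ae P, forall w, H Y 0 w = H Y' 0 w}.
  apply: (@stationary_explosion _ _ _ P f _ lam Y Y' _ _ lam0 sY.1 sY'.1 stY stY' _ YH YH' HH);
  by move=> x y; rewrite le_state_space_transform.
near=> w => t.
have -> : Y t w = f (H Y t w) by move: t; near: w.
have -> : Y' t w = f (H Y' t w) by move: t; near: w.
congr (f _); apply/eqP; rewrite -subr_eq0; apply/eqP.
have -> : H Y t w - H Y' t w = expR (- lam * t) * (H Y 0 w - H Y' 0 w).
  by move: t; near: w.
by have -> : H Y 0 w = H Y' 0 w; [near: w|rewrite subrr mulr0].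
Unshelve. all: by end_near. Qed.

End solutions.

Theorem corollary4p6
  (disp : measure_display) (T : measurableType disp) (R : realType)
  (P : probability T R) (hP : measure_is_complete P)
  (d p : R) (hd : 0 < d < 1 / 2) (hp : 1 <= p < 2)
  (L Ld : R -> T -> R) (hLd : is_FLP P d L Ld)
  (hLdp : bounded_p_variation_paths P p Ld)
  (a b : \bar R) (mu sigma psi phi : R -> R) (lam : R)
  (hsp : strongly_proper a b mu sigma psi phi lam) :
  let X := fun (t : R) (w : T) =>
    state_space_transform phi lam (FLOU lam Ld t w) in
  is_stationary_pathwise_solution P p a b mu sigma Ld X /\
  ((forall x : R, open_interval a b x -> sigma x != 0) ->
   forall Y : R -> T -> R,
     is_stationary_pathwise_solution P p a b mu sigma Ld Y ->
     {ae P, forall w, forall t : R, Y t w = X t w}).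
Proof.
move=> X; have /andP[d0 _] := hd.
have sX : is_stationary_pathwise_solution P p a b mu sigma Ld X.
  split; first exact: (transformed_FLOU_solution hP d0 hp hLd hLdp hsp).
  exact: (transformed_FLOU_stationary hP d0 hLd hsp).
by split=> // sigma0 Y sY; exact: (stationary_solution_unique hp hLd hsp sigma0 sY sX).
Qed.
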